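(* Let $(M^{d},\boldsymbol{c},I)$, $d\geq 4$, be an almost pseudo-Riemannian structure with scale tractor $I=\frac1dD\sigma$ and scale singularity set $\Sigma:=\mathcal{Z}(\sigma)\neq\emptyset$ that is asymptotically Einstein in the sense that $I^2|_\Sigma=\pm1$ (one fixed sign) and $\nabla_aI_B=\sigma^2f_{aB}$ for some smooth weight $-2$ tractor-valued $1$-form field $f_{aB}$, where $\nabla$ is the tractor connection. (Then $\Sigma$ is a smoothly embedded nondegenerate hypersurface.) Then the tractor connection of $(M,\boldsymbol{c})$ preserves, along $\Sigma$, the intrinsic tractor bundle $\mathcal{T}_\Sigma$ of $\Sigma$, viewed as a subbundle $\mathcal{T}_\Sigma\cong N^\perp\subset\mathcal{T}|_\Sigma$ of the ambient tractors. Furthermore, the restriction to $\mathcal{T}_\Sigma$ of the parallel transport (along curves in $\Sigma$) of $\nabla^{\mathcal{T}}$ coincides with the intrinsic tractor parallel transport of $\nabla^{\mathcal{T}_\Sigma}$.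
   Context: All objects are smooth. A conformal manifold $(M^d,\boldsymbol{c})$, $d\ge 3$, is a $d$-manifold with a conformal class $\boldsymbol{c}$ of metrics of fixed signature ($\widehat g=\Omega^2g$, $\Omega>0$). $\mathcal{E}[w]$ is the bundle of conformal densities of weight $w$ (a section is a family of functions $(f^g)_{g\in\boldsymbol{c}}$ with $f^{\Omega^2g}=\Omega^wf^g$), $\mathcal{B}[w]:=\mathcal{B}\otimes\mathcal{E}[w]$. The conformal metric $\mathbf{g}\in\Gamma(S^2T^*M[2])$ is $\mathbf{g}=\sigma_g^2g$, with $\sigma_g\in\Gamma(\mathcal{E}[1])$ represented by $1$ in the scale $g$; indices are raised/lowered with $\mathbf{g}$. For $g\in\boldsymbol{c}$, $\nabla$ is the Levi-Civita connection, acting on $\mathcal{E}[w]$ by $\nabla\tau=\sigma_g^wd(\sigma_g^{-w}\tau)$; $\Delta=\mathbf{g}^{ab}\nabla_a\nabla_b$; the Schouten tensor $P_{ab}$ satisfies $\mathrm{Ric}_{ab}=(d-2)P_{ab}+J\mathbf{g}_{ab}$, $J=\mathbf{g}^{ab}P_{ab}$. Standard tractor bundle: each $g\in\boldsymbol{c}$ identifies $\mathcal{T}=\mathcal{E}_A$ with $\mathcal{E}[1]\oplus T^*M[1]\oplus\mathcal{E}[-1]$, triples in the scale $\widehat g=\Omega^2g$ being related to those in scale $g$ by $\widehat\sigma=\sigma$, $\widehat\mu_b=\mu_b+\Upsilon_b\sigma$, $\widehat\rho=\rho-\Upsilon^b\mu_b-\frac12\Upsilon^b\Upsilon_b\sigma$,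 $\Upsilon=\Omega^{-1}d\Omega$. It carries the invariant tractor connection $\nabla^{\mathcal{T}}_a(\sigma,\mu_b,\rho)=(\nabla_a\sigma-\mu_a,\ \nabla_a\mu_b+\mathbf{g}_{ab}\rho+P_{ab}\sigma,\ \nabla_a\rho-P_{ab}\mu^b)$ and the parallel tractor metric $h$ with quadratic form $2\sigma\rho+\mathbf{g}^{ab}\mu_a\mu_b$. For $\sigma\in\Gamma(\mathcal{E}[1])$ the scale tractor is $I=\frac1dD\sigma\stackrel{g}{=}(\sigma,\nabla_a\sigma,-\frac1d(\Delta\sigma+J\sigma))$; $I^2=h(I,I)$. $(M,\boldsymbol{c},I)$ is almost pseudo-Riemannian if $I$ is nowhere zero. Hypersurfaces: let $\Sigma$ be a nondegenerate hypersurface with induced conformal structure $\overline{\boldsymbol c}$ (dimension $d-1\ge3$), and $n_a$ a weight $1$ conormal with $\mathbf{g}^{ab}n_an_b=\pm1$. In the scale $g$ the second fundamental form is $L_{ab}=\nabla_an_b\mp n_an^c\nabla_cn_b$ on $\Sigma$ and the mean curvature is $H=\frac1{d-1}\overline{\mathbf{g}}^{ab}L_{ab}$. The normal tractor is $N\stackrel{g}{=}(0,n_a,-H)\in\Gamma(\mathcal{T}|_\Sigma)$, with $h(N,N)=\pm1$; it does not depend on $g$. $\mathcal{T}_\Sigma$, with connection $\nabla^{\mathcal{T}_\Sigma}$, is the standard tractor bundle and tractor connection of the conformal manifold $(\Sigma,\overline{\boldsymbol c})$. It is identified with $N^\perp\subset\mathcal{T}|_\Sigma$ by the conformally invariant isomorphism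 $N^\perp\to\mathcal{T}_\Sigma$ given in the scale $g$ (with $\overline g$ the metric induced on $\Sigma$) by $(\sigma,\mu_b,\rho)\mapsto(\sigma,\ \mu_b\mp Hn_b\sigma,\ \rho\pm\frac12H^2\sigma)$, where $T^*\Sigma$ is viewed as the subbundle of $T^*M|_\Sigma$ annihilating $n^a$. *)

(* Defs.v *)
From HB Require Import structures.
From mathcomp Require Import all_boot all_order all_algebra.
From mathcomp Require Import all_classical all_reals all_analysis.

Set Implicit Arguments.
Unset Strict Implicit.
Unset Printing Implicit Defensive.

Import Order.TTheory GRing.Theory Num.Theory.
Import numFieldNormedType.Exports.

Local Open Scope classical_set_scope.
Local Open Scope ring_scope.

(* Tensor fields on a manifold are given by their components in charts, and
   conformally weighted objects by their values in a scale g of the conformal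
   class: trivialising E[w] by the density that is 1 in the scale g turns the
   conformal metric into g and the induced connection on E[w] into d. *)

Section Smooth.
Context {R : realType} {V : normedModType R}.

(* On a finite-dimensional V and an open U this is C^k: f is differentiable on
   U with all directional derivatives of class C^(k-1). *)
Fixpoint class_C (k : nat) (U : set V) (f : V -> R) : Prop :=
  if k is k'.+1 then
    (forall x, U x -> differentiable f x) /\
    (forall v : V, class_C k' U ('D_v f))
  else forall x, U x -> {for x, continuous f}.

Definition smooth_on (U : set V) (f : V -> R) := forall k, class_C k U f.

End Smooth.

Section LocalGeometry.
Context {R : realType} {n : nat}.
Implicit Types (G : 'rV[R]_n -> 'M[R]_n) (x : 'rV[R]_n) (a b c e : 'I_n).

Definition basis_vec a : 'rV[R]_n := delta_mx 0 a.

Definition pd a (f : 'rV[R]_n -> R) : 'rV[R]_n -> R :=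
  fun x => 'D_(basis_vec a) f x.

Definition inv_metric G x a b : R := invmx (G x) a b.

Definition christoffel G c a b x : R :=
  2^-1 * \sum_e inv_metric G x c e *
    (pd a (fun y => G y e b) x + pd b (fun y => G y e a) x
     - pd e (fun y => G y a b) x).

Definition ricci G a b x : R :=
  \sum_c (pd c (christoffel G c a b) x - pd b (christoffel G c a c) x
          + \sum_e (christoffel G c c e x * christoffel G e a b x
                    - christoffel G c b e x * christoffel G e a c x)).

Definition scalar_curv G x : R := \sum_a \sum_b inv_metric G x a b * ricci G a b x.

(* The solution of Ric = (n - 2) P + J g, J = tr P: tracing gives
   Scal = 2 (n - 1) J. See schoutenE and schouten_traceE. *)
Definition schouten_trace G x : R := (2 * (n%:R - 1))^-1 * scalar_curv G x.

Definition schouten G a b x : R :=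
  (n%:R - 2)^-1 * (ricci G a b x - schouten_trace G x * G x a b).

Definition cov_deriv G (w : 'rV[R]_n -> 'rV[R]_n) a b x : R :=
  pd a (fun y => w y 0 b) x - \sum_c christoffel G c a b x * w x 0 c.

Definition grad (f : 'rV[R]_n -> R) x : 'rV[R]_n := \row_a pd a f x.

Definition laplacian G (f : 'rV[R]_n -> R) x : R :=
  \sum_a \sum_b inv_metric G x a b * cov_deriv G (grad f) a b x.

Definition raise G x (w : 'rV[R]_n) : 'rV[R]_n :=
  \row_a \sum_b inv_metric G x a b * w 0 b.

Definition cov_pairing G x (w w' : 'rV[R]_n) : R :=
  \sum_a \sum_b inv_metric G x a b * w 0 a * w' 0 b.

End LocalGeometry.

Lemma schoutenE (R : realType) (n : nat) (G : 'rV[R]_n -> 'M[R]_n) a b x :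
  (2 < n)%N ->
  ricci G a b x = (n%:R - 2) * schouten G a b x + schouten_trace G x * G x a b.
Proof.
move=> n2; have nz : (n%:R - 2 : R) != 0.
  by rewrite subr_eq0 -[2]/(2%:R) eqr_nat gtn_eqF.
by rewrite /schouten mulrA mulfV // mul1r subrK.
Qed.

Lemma schouten_traceE (R : realType) (n : nat) (G : 'rV[R]_n -> 'M[R]_n) x :
  (2 < n)%N -> (G x)^T = G x -> G x \in unitmx ->
  schouten_trace G x = \sum_a \sum_b inv_metric G x a b * schouten G a b x.
Proof.
move=> n2 sG uG; have nz : (n%:R - 2 : R) != 0.
  by rewrite subr_eq0 -[2]/(2%:R) eqr_nat gtn_eqF.
have nz1 : (n%:R - 1 : R) != 0.
  by rewrite subr_eq0 -[1]/(1%:R) eqr_nat gtn_eqF // ltnW.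
have trg : \sum_a \sum_b inv_metric G x a b * G x a b = n%:R.
  rewrite -(mxtrace1 R n) -(mulVmx uG) /mxtrace; apply: eq_bigr => a _.
  rewrite mxE; apply: eq_bigr => b _; congr (_ * _).
  by rewrite -[in LHS]sG mxE.
have -> : \sum_a \sum_b inv_metric G x a b * schouten G a b x =
  (n%:R - 2)^-1 * (scalar_curv G x - schouten_trace G x * n%:R).
  rewrite -[in schouten_trace G x * _]trg /scalar_curv mulr_sumr -sumrB mulr_sumr; apply: eq_bigr => a _.
  rewrite mulr_sumr -sumrB mulr_sumr; apply: eq_bigr => b _.
  by rewrite /schouten [LHS]mulrCA mulrBr; congr (_ * (_ - _)); exact: mulrCA.
have -> : scalar_curv G x = 2 * (n%:R - 1) * schouten_trace G x.
  by rewrite /schouten_trace mulVKf // mulf_neq0 // pnatr_eq0.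
apply: (mulfI nz); rewrite mulVKf // [_ * n%:R]mulrC -mulrBl; congr (_ * _).
by rewrite mulrBr mulr1 addrAC mulr_natl mulr2n addrK.
Qed.

(* A standard tractor (sigma, mu_b, rho) in a scale and in coordinates. *)
Notation tractor R n := (R * 'rV[R]_n * R)%type.

Section Tractors.
Context {R : realType} {n : nat}.
Implicit Types (G : 'rV[R]_n -> 'M[R]_n) (x : 'rV[R]_n).

Definition tr_metric G x (S T : tractor R n) : R :=
  S.1.1 * T.2 + S.2 * T.1.1 + cov_pairing G x S.1.2 T.1.2.

(* From the scale g to Omega^2 g, with u = d Omega in coordinates at x and
   o = Omega: the slots have weights 1, 1, -1, and raising an index with the
   conformal metric is raising with g in the scale g. *)
Definition tr_rescale G x (o : R) (u : 'rV[R]_n) (S : tractor R n) : tractor R n :=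
  let Y := o^-1 *: u in
  (o * S.1.1,
   o *: (S.1.2 + S.1.1 *: Y),
   o^-1 * (S.2 - cov_pairing G x Y S.1.2
           - 2^-1 * cov_pairing G x Y Y * S.1.1)).

(* Change of coordinates, with J a b the derivative of the old coordinate b
   with respect to the new coordinate a. *)
Definition tr_coord_change (J : 'M[R]_n) (S : tractor R n) : tractor R n :=
  (S.1.1, S.1.2 *m J^T, S.2).

Definition tr_smooth {V : normedModType R} (U : set V) (S : V -> tractor R n) :=
  [/\ smooth_on U (fun u => (S u).1.1),
      forall b, smooth_on U (fun u => (S u).1.2 0 b) &
      smooth_on U (fun u => (S u).2)].

(* The pull-back of the tractor connection along a map x into coordinate
   space, applied to a section S along x, at u in the direction v. It is the
   connection itself when x = id, its restriction to a submanifold when x is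
   a parametrisation, and the derivative along a curve when V = R. *)
Definition tr_conn {V : normedModType R} G (x : V -> 'rV[R]_n)
    (S : V -> tractor R n) (u v : V) : tractor R n :=
  let X a := 'D_v (fun w => x w 0 a) u in
  let sigma := (S u).1.1 in
  let mu := (S u).1.2 in
  let rho := (S u).2 in
  ('D_v (fun w => (S w).1.1) u - \sum_a X a * mu 0 a,
   \row_b ('D_v (fun w => (S w).1.2 0 b) u
     + \sum_a X a * (- (\sum_c christoffel G c a b (x u) * mu 0 c)
                     + G (x u) a b * rho + schouten G a b (x u) * sigma)),
   'D_v (fun w => (S w).2) u
     - \sum_a X a * \sum_b schouten G a b (x u) * raise G (x u) mu 0 b).

Definition scale_tractor G (s : 'rV[R]_n -> R) x : tractor R n :=
  (s x, grad s x, - (n%:R^-1 * (laplacian G s x + schouten_trace G x * s x))).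

End Tractors.

Section Manifolds.
Context {R : realType} {T : topologicalType} {n : nat}.

(* coord and param are mutually inverse between cdom and cimg, and are
   unconstrained elsewhere. *)
Record chart := Chart {
  cdom : set T;
  cimg : set 'rV[R]_n;
  coord : T -> 'rV[R]_n;
  param : 'rV[R]_n -> T }.

Record atlas := Atlas { idx : Type; ch : idx -> chart }.

Definition is_chart (k : chart) :=
  [/\ open (cdom k), open (cimg k),
      forall p, cdom k p ->
        [/\ cimg k (coord k p), param k (coord k p) = p
          & {for p, continuous (coord k)}] &
      forall x, cimg k x ->
        [/\ cdom k (param k x), coord k (param k x) = x
          & {for x, continuous (param k)}]].

Definition smooth_transition (k l : chart) := forall b,
  smooth_on [set x | cimg k x /\ cdom l (param k x)]
            (fun x => coord l (param k x) 0 b).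

Definition compatible (k l : chart) :=
  smooth_transition k l /\ smooth_transition l k.

(* T is a smooth n-manifold with maximal atlas X. *)
Definition is_manifold (X : atlas) :=
  [/\ hausdorff_space T /\ @second_countable T,
      forall i : idx X, is_chart (ch i),
      forall p, exists i : idx X, cdom (ch i) p,
      forall i j : idx X, compatible (ch i) (ch j) &
      forall k, is_chart k -> (forall i : idx X, compatible (ch i) k) ->
        exists i : idx X, ch i = k].

Variable X : atlas.
Implicit Types (i j : idx X) (p : T).

Definition dom i : set T := cdom (ch i).
Definition im i : set 'rV[R]_n := cimg (ch i).

Definition jacobian i j p : 'M[R]_n :=
  \matrix_(a, b) pd a (fun y => coord (ch j) (param (ch i) y) 0 b)
                   (coord (ch i) p).

Definition smooth_fun (f : T -> R) :=
  forall i, smooth_on (im i) (fun x => f (param (ch i) x)).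

Definition metric : Type := idx X -> 'rV[R]_n -> 'M[R]_n.
Implicit Types (g : metric) (c : set metric).

(* p is the number of positive squares. *)
Definition has_signature (p : nat) (A : 'M[R]_n) :=
  exists2 Q : 'M[R]_n, Q \in unitmx &
    Q *m A *m Q^T = diag_mx (\row_(k < n) (if (k < p)%N then 1 else -1)).

Definition is_metric (q : nat) g :=
  [/\ forall i a b, smooth_on (im i) (fun x => g i x a b),
      forall i x, im i x -> has_signature q (g i x) &
      forall p i j, dom i p -> dom j p ->
        g i (coord (ch i) p)
        = jacobian i j p *m g j (coord (ch j) p) *m (jacobian i j p)^T].

Definition is_rescaling g g' (Om : T -> R) :=
  [/\ smooth_fun Om, forall p, 0 < Om p &
      forall i x, im i x -> g' i x = Om (param (ch i) x) ^+ 2 *: g i x].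

Definition is_conformal_class c :=
  c !=set0 /\
  exists2 q : nat, (q <= n)%N &
    forall g, c g -> is_metric q g /\
      forall g', c g' <-> exists Om, is_rescaling g g' Om.

Definition is_density c (w : int) (s : metric -> T -> R) :=
  forall g, c g -> smooth_fun (s g) /\
    forall g' Om, is_rescaling g g' Om -> forall p, s g' p = Om p ^ w * s g p.

(* f g i a x: the tractor f_a at the point with coordinates x in the chart i,
   in the scale g. *)
Definition is_tractor_1form c (w : int)
    (f : metric -> idx X -> 'I_n -> 'rV[R]_n -> tractor R n) :=
  forall g, c g ->
  [/\ forall i a, tr_smooth (im i) (f g i a),
      forall p i j a, dom i p -> dom j p ->
        f g i a (coord (ch i) p)
        = \sum_b jacobian i j p a b *:
            tr_coord_change (jacobian i j p) (f g j b (coord (ch j) p)) &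
      forall g' Om, is_rescaling g g' Om -> forall i a x, im i x ->
        let om y := Om (param (ch i) y) in
        f g' i a x
        = om x ^ w *: tr_rescale (g i) x (om x) (grad om x) (f g i a x)].

Definition scaleT (s : metric -> T -> R) g i : 'rV[R]_n -> tractor R n :=
  scale_tractor (g i) (fun x => s g (param (ch i) x)).

Definition zero_locus c (s : metric -> T -> R) : set T :=
  [set p | forall g, c g -> s g p = 0].

Definition almost_pseudo_riemannian c (s : metric -> T -> R) :=
  is_density c 1 s /\
  forall g i x, c g -> im i x -> scaleT s g i x != 0.

Definition asymptotically_einstein c (s : metric -> T -> R) (eps : R) :=
  (forall g p i, c g -> zero_locus c s p -> dom i p ->
     let x := coord (ch i) p in
     tr_metric (g i) x (scaleT s g i x) (scaleT s g i x) = eps) /\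
  exists2 f, is_tractor_1form c (-2) f &
    forall g i x a, c g -> im i x ->
      tr_conn (g i) id (scaleT s g i) x (basis_vec a)
      = s g (param (ch i) x) ^+ 2 *: f g i a x.

(* An element of the fibre of the tractor bundle at p, in a fixed scale: its
   components in every chart around p. *)
Definition is_tractor p (V : idx X -> tractor R n) :=
  forall i j, dom i p -> dom j p ->
    V i = tr_coord_change (jacobian i j p) (V j).

Definition eq_tractor p (V W : idx X -> tractor R n) :=
  forall i, dom i p -> V i = W i.

(* Curves are defined on an open interval, so that transport along a compact
   piece involves no one-sided derivative. *)
Definition smooth_curve (l r : R) (gam : R -> T) :=
  (forall t, l < t < r -> {for t, continuous gam}) /\
  forall i b, smooth_on [set t | l < t < r /\ dom i (gam t)]
                        (fun t => coord (ch i) (gam t) 0 b).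

Definition section_along (l r : R) (gam : R -> T)
    (V : idx X -> R -> tractor R n) :=
  (forall t, l < t < r -> is_tractor (gam t) (V ^~ t)) /\
  forall i, tr_smooth [set t | l < t < r /\ dom i (gam t)] (V i).

Definition parallel_along g (l r : R) (gam : R -> T)
    (V : idx X -> R -> tractor R n) :=
  forall i t, l < t < r -> dom i (gam t) ->
    tr_conn (g i) (fun u => coord (ch i) (gam u)) (V i) t 1 = 0.

(* The graph of the parallel transport of the tractor connection of g along
   gam from the fibre at gam t0 to the fibre at gam t1. *)
Definition parallel_transport g (l r : R) (gam : R -> T) (t0 t1 : R)
    (V0 V1 : idx X -> tractor R n) :=
  exists V, [/\ section_along l r gam V, parallel_along g l r gam V,
    eq_tractor (gam t0) (V ^~ t0) V0 & eq_tractor (gam t1) (V ^~ t1) V1].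

End Manifolds.

Arguments chart : clear implicits.
Arguments atlas : clear implicits.

Section Hypersurfaces.
Context {R : realType} {T : topologicalType} {m : nat}.

Definition slice_in (u : 'rV[R]_m) : 'rV[R]_m.+1 :=
  \row_a (if unlift ord0 a is Some k then u 0 k else 0).

(* Pull-back of (coordinates of) covectors under slice_in. *)
Definition slice_pull (w : 'rV[R]_m.+1) : 'rV[R]_m := \row_k w 0 (lift ord0 k).

Variables (S : set T) (X : atlas R T m.+1).

(* In a slice chart S is the vanishing locus of the coordinate 0. *)
Definition is_slice (i : idx X) :=
  forall p, dom i p -> (S p <-> coord (ch i) p 0 ord0 = 0).

Definition slice_chart (k : chart R T m.+1) : chart R T m :=
  Chart (cdom k `&` S) [set u | cimg k (slice_in u)]
        (fun p => slice_pull (coord k p)) (fun u => param k (slice_in u)).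

Definition hyp_atlas : atlas R T m :=
  Atlas (fun i : {i : idx X | is_slice i} => slice_chart (ch (sval i))).

Definition induced_metric (g : metric X) : metric hyp_atlas :=
  fun i u => \matrix_(k, l) g (sval i) (slice_in u) (lift ord0 k) (lift ord0 l).

Definition embedded_hypersurface :=
  forall p, S p -> exists2 i : idx X, is_slice i & dom i p.

Definition nondegenerate_hypersurface (c : set (metric X)) :=
  embedded_hypersurface /\
  forall g (i : idx hyp_atlas) u, c g -> im i u -> induced_metric g i u \in unitmx.

Section Chartwise.
Variables (G : 'rV[R]_m.+1 -> 'M[R]_m.+1) (eps : R)
  (nu : 'rV[R]_m.+1 -> 'rV[R]_m.+1).
Implicit Types x : 'rV[R]_m.+1.

Definition second_ff (a b : 'I_m.+1) x : R :=
  cov_deriv G nu a b x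
  - eps * nu x 0 a * \sum_c raise G x (nu x) 0 c * cov_deriv G nu c b x.

(* g^ab - eps n^a n^b is the inverse of the induced metric. *)
Definition mean_curv x : R :=
  m%:R^-1 * \sum_a \sum_b
    (inv_metric G x a b
     - eps * raise G x (nu x) 0 a * raise G x (nu x) 0 b) * second_ff a b x.

Definition normal_tractor x : tractor R m.+1 := (0, nu x, - mean_curv x).

(* The isomorphism from the orthogonal of the normal tractor to the intrinsic
   tractor bundle, in a slice chart: the middle slot annihilates n^a and is
   viewed as a covector of the hypersurface by restriction. *)
Definition tr_ident x (V : tractor R m.+1) : tractor R m :=
  (V.1.1,
   slice_pull (V.1.2 - (eps * mean_curv x * V.1.1) *: nu x),
   V.2 + eps * 2^-1 * mean_curv x ^+ 2 * V.1.1).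

End Chartwise.

(* A conormal field along S with norm eps, weight 1, in the scale g; it is
   given in each chart by a smooth extension off S, on which the second
   fundamental form at points of S does not depend. *)
Definition unit_conormal (g : metric X) (eps : R)
    (nu : idx X -> 'rV[R]_m.+1 -> 'rV[R]_m.+1) :=
  [/\ forall i a, smooth_on (im i) (fun x => nu i x 0 a),
      forall p i j, S p -> dom i p -> dom j p ->
        nu i (coord (ch i) p)
        = nu j (coord (ch j) p) *m (jacobian i j p)^T,
      forall p i, S p -> dom i p -> is_slice i ->
        slice_pull (nu i (coord (ch i) p)) = 0 &
      forall p i, S p -> dom i p ->
        let x := coord (ch i) p in
        cov_pairing (g i) x (nu i x) (nu i x) = eps].

Variables (g : metric X) (eps : R) (nu : idx X -> 'rV[R]_m.+1 -> 'rV[R]_m.+1).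

Definition normal_perp (p : T) (V : idx X -> tractor R m.+1) :=
  forall i, dom i p -> let x := coord (ch i) p in
    tr_metric (g i) x (V i) (normal_tractor (g i) eps (nu i) x) = 0.

Definition hyp_ident (p : T) (V : idx X -> tractor R m.+1) :
    idx hyp_atlas -> tractor R m :=
  fun i => tr_ident (g (sval i)) eps (nu (sval i))
                    (coord (ch (sval i)) p) (V (sval i)).

(* Covariant derivatives, in directions tangent to S, of sections of the
   orthogonal of the normal tractor over an open piece of S are again
   sections of it. *)
Definition preserves_normal_perp :=
  forall (i : idx hyp_atlas) (V : 'rV[R]_m -> tractor R m.+1),
    let G := g (sval i) in
    let N := normal_tractor G eps (nu (sval i)) in
    tr_smooth (im i) V ->
    (forall u, im i u -> tr_metric G (slice_in u) (V u) (N (slice_in u)) = 0) ->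
    forall u v, im i u ->
      tr_metric G (slice_in u) (tr_conn G slice_in V u v) (N (slice_in u)) = 0.

(* On the orthogonal of the normal tractor, ambient parallel transport along
   curves in S is intrinsic parallel transport, under hyp_ident. *)
Definition transports_coincide :=
  forall (l r : R) (gam : R -> T) (t0 t1 : R),
    smooth_curve X l r gam -> (forall t, l < t < r -> S (gam t)) ->
    l < t0 < r -> l < t1 < r ->
  forall V0 V1 : idx X -> tractor R m.+1,
    is_tractor (gam t0) V0 -> is_tractor (gam t1) V1 ->
    normal_perp (gam t0) V0 ->
    (parallel_transport g l r gam t0 t1 V0 V1 <->
     normal_perp (gam t1) V1 /\
     parallel_transport (induced_metric g) l r gam t0 t1
       (hyp_ident (gam t0) V0) (hyp_ident (gam t1) V1)).

End Hypersurfaces.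

(* Main.v *)
Require Import Defs.
From HB Require Import structures.
From mathcomp Require Import all_boot all_order all_algebra.
From mathcomp Require Import all_classical all_reals all_analysis.
From mathcomp Require Import ring lra.

Set Implicit Arguments.
Unset Strict Implicit.
Unset Printing Implicit Defensive.

Import Order.TTheory GRing.Theory Num.Theory.
Import numFieldNormedType.Exports.

Local Open Scope classical_set_scope.
Local Open Scope ring_scope.

(* Along the zero locus S of the scale s, the slots of the equation
   nabla I = O(s^2) for the scale tractor I = (s, ds, rho) give
   nabla ds = - rho g and d rho = P(ds) and, after one more derivative, that
   the Weyl tensor annihilates ds.  Since |ds|^2 = I^2 = eps on S, the zero
   locus is a nondegenerate hypersurface; it is umbilic, its mean curvature is
   - rho up to the sign of the unit conormal, and its normal tractor is I up to
   the same sign, hence parallel along S.  By the Gauss equation the Schouten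
   tensor of S is the restriction of P plus eps rho^2 h / 2, with h the induced
   metric, which is exactly what makes
   (sigma, mu, tau) |-> (sigma, mu|_S, tau + eps rho^2 sigma / 2) intertwine the
   two tractor connections on the orthogonal of I.  Parallel sections along a
   curve in S stay orthogonal to I, so they restrict to parallel sections of the
   intrinsic bundle; conversely a parallel intrinsic section is the restriction
   of a unique section orthogonal to I, whose derivative vanishes because it is
   orthogonal to I and restricts to 0. *)

(** * Smooth functions *)

(** The square in [s ^+ 2 *: f] matters: the error term still vanishes on the zero locus after one
    derivative, so the equation for the gradient can be differentiated there and antisymmetrised; a
    single factor [s] would leave a multiple of ds times [f].

    The constant 1/2 in the intertwining map is fixed by the middle slot. Orthogonality to [I] turns
    the normal term of the Gauss formula into - eps rho^2 sigma, and this is cancelled half by the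
    shift of the bottom slot and half by the correction of the Schouten tensor.

    Ambient sections have components in every chart, intrinsic ones only in slice charts. The
    hypersurface is therefore treated as an immersion [slice_map j i] of slice coordinates [j] into
    an arbitrary chart [i], and the Gauss equation is proved for immersions into the zero locus
    instead of coordinate slices.

    Parallel transport is a relation witnessed by a section, so each implication builds a section in
    all charts at once; patching it rests on the transformation law of [I] between charts along the
    zero locus. *)

Section Differentiability.
Context {R : realType} {V W : normedModType R}.

Lemma differentiable_eps (f : V -> W) x : differentiable f x ->
  forall e, 0 < e ->
    \forall y \near x, `|f y - f x - 'd f x (y - x)| <= e * `|y - x|.
Proof.
move=> df e e0; have /eqaddoP /(_ _ e0) := diff_locally df.
move=> h; rewrite (near_shift 0) subr0; apply: filterS h => y /= h.
by rewrite addrK -addrA -opprD; exact: h.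
Qed.

(** The form in which the inverse of the straightening map is differentiated: a candidate
    differential is guessed and only an epsilon estimate is left. *)
Lemma eps_differentiable (f : V -> W) x (L : {linear V -> W}) :
  continuous L ->
  (forall e, 0 < e ->
    \forall y \near x, `|f y - f x - L (y - x)| <= e * `|y - x|) ->
  differentiable f x /\ 'd f x = L :> (V -> W).
Proof.
move=> cL h; have E : f \o shift x = cst (f x) + L +o_ 0 id.
  apply/eqaddoP => e e0; have := h e e0; rewrite (near_shift 0) subr0.
  apply: filterS => y /=; rewrite addrK -addrA -opprD => H; exact: H.
have dE := diff_unique cL E; split=> //.
by apply/diff_locallyP; rewrite dE.
Qed.

Lemma near_differentiable (f g : V -> W) x :
  (\forall y \near x, f y = g y) -> differentiable f x -> differentiable g x.
Proof.
move=> fg df; have fgx := fg.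
have [] // := @eps_differentiable g x ('d f x) (diff_continuous df).
move=> e e0; have := differentiable_eps df e0.
by apply: filterS2 fg => y <-; rewrite (nbhs_singleton fgx).
Qed.

End Differentiability.

Section Smoothness.
Context {R : realType} {V : normedModType R}.
Implicit Types (U : set V) (f g : V -> R) (k : nat).

Lemma near_open U (P : V -> Prop) x :
  open U -> U x -> (forall y, U y -> P y) -> \forall y \near x, P y.
Proof. by move=> oU Ux UP; apply: filterS UP _; exact: open_nbhs_nbhs. Qed.

Lemma class_C_ext k U f g : open U -> (forall x, U x -> f x = g x) ->
  class_C k U f -> class_C k U g.
Proof.
move=> oU; elim: k f g => [|k IH] f g fg /=.
  move=> cf x Ux; rewrite /prop_for /continuous_at -(fg x Ux).
  apply: cvg_trans (cf x Ux); apply: near_eq_cvg.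
  by apply: near_open Ux _ => // y /fg.
case=> df Df; split=> [x Ux|v].
  by apply: near_differentiable (df x Ux); exact: near_open Ux _.
by apply: IH (Df v) => x Ux; apply: near_eq_derive; exact: near_open Ux _.
Qed.

Lemma class_C_sub k U U' f : U' `<=` U -> class_C k U f -> class_C k U' f.
Proof.
move=> U'U; elim: k f => [|k IH] f /=; first by move=> cf x /U'U /cf.
by move=> [df Df]; split=> [x /U'U /df //|v]; exact: IH.
Qed.

(** [class_C] is a conjunction of conditions at single points on iterated derivatives of the total
    function [f], so the set [U'] may vary with the point. *)
Lemma class_C_local k U f :
  (forall x, U x -> exists2 U', U' x & class_C k U' f) -> class_C k U f.
Proof.
elim: k f => [|k IH] f /= h; first by move=> x /h[U' U'x]; apply.
split=> [x /h[U' U'x [df _]]|v]; first exact: df.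
by apply: IH => x /h[U' U'x [_ Df]]; exists U'.
Qed.

Lemma class_CS k U f : class_C k.+1 U f -> class_C k U f.
Proof.
elim: k f => [|k IH] f [df Df].
  by move=> x /df /differentiable_continuous.
by split=> // v; apply: IH; exact: Df.
Qed.

Lemma class_C_cst k U (c : R) : class_C k U (fun=> c).
Proof.
elim: k c => [|k IH] c /=; first by move=> x _; exact: cvg_cst.
split=> [x _|v]; first exact: differentiable_cst.
have -> : 'D_v (fun=> c) = (fun=> 0) :> (V -> R).
  by apply/funext => x; exact: derive_cst.
exact: IH.
Qed.

Lemma class_CD k U f g : open U -> class_C k U f -> class_C k U g ->
  class_C k U (fun x => f x + g x).
Proof.
move=> oU; elim: k f g => [|k IH] f g /=.
  by move=> cf cg x Ux; apply: continuousD; [exact: cf|exact: cg].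
move=> [df Df] [dg Dg]; split=> [x Ux|v].
  by apply: differentiableD; [exact: df|exact: dg].
apply: (class_C_ext oU _ (IH _ _ (Df v) (Dg v))) => x Ux.
by rewrite deriveD //; apply: diff_derivable; [exact: df|exact: dg].
Qed.

Lemma class_C_sum k U (I : Type) (r : seq I) (P : pred I) (F : I -> V -> R) :
  open U -> (forall i, class_C k U (F i)) ->
  class_C k U (fun x => \sum_(i <- r | P i) F i x).
Proof.
move=> oU CF; elim: r => [|i r IH].
  by apply: class_C_ext (class_C_cst k U 0) => // x _; rewrite big_nil.
case Pi : (P i); last by apply: class_C_ext IH => // x _; rewrite big_cons Pi.
by apply: class_C_ext (class_CD oU (CF i) IH) => // x _; rewrite big_cons Pi.
Qed.

Lemma class_CM k U f g : open U -> class_C k U f -> class_C k U g ->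
  class_C k U (fun x => f x * g x).
Proof.
move=> oU; elim: k f g => [|k IH] f g.
  by move=> cf cg x Ux; apply: continuousM; [exact: cf|exact: cg].
move=> Cf Cg; have [df Df] := Cf; have [dg Dg] := Cg.
split=> [x Ux|v].
  by apply: differentiableM; [exact: df|exact: dg].
have := class_CD oU (IH _ _ (class_CS Cf) (Dg v)) (IH _ _ (class_CS Cg) (Df v)).
apply: (class_C_ext oU) => x Ux.
by rewrite deriveM //; apply: diff_derivable; [exact: df|exact: dg].
Qed.

Lemma class_CV k U f : open U -> (forall x, U x -> f x != 0) ->
  class_C k U f -> class_C k U (fun x => (f x)^-1).
Proof.
move=> oU f0; elim: k => [|k IH] Cf.
  by move=> x Ux; apply: continuousV; [exact: f0|exact: Cf].
have [df Df] := Cf; split=> [x Ux|v].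
  by apply: differentiableV; [exact: df|exact: f0].
have CV := IH (class_CS Cf).
have := class_CM oU (class_CM oU (class_C_cst k U (-1)) (class_CM oU CV CV)) (Df v).
apply: (class_C_ext oU) => x Ux.
rewrite deriveV ?f0 //; last by apply: diff_derivable; exact: df.
by rewrite /GRing.scale /= mulN1r -exprVn expr2.
Qed.

Lemma smooth_ext U f g : open U -> (forall x, U x -> f x = g x) ->
  smooth_on U f -> smooth_on U g.
Proof. by move=> oU fg sf k; exact: class_C_ext (sf k). Qed.

Lemma smooth_sub U U' f : U' `<=` U -> smooth_on U f -> smooth_on U' f.
Proof. by move=> U'U sf k; exact: class_C_sub (sf k). Qed.

Lemma smooth_local U f :
  (forall x, U x -> exists2 U', U' x & smooth_on U' f) -> smooth_on U f.
Proof. by move=> h k; apply: class_C_local => x /h[U' U'x sf]; exists U'. Qed.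

Lemma smooth_cst U c : smooth_on U (fun=> c).
Proof. by move=> k; exact: class_C_cst. Qed.

Lemma smoothD U f g : open U -> smooth_on U f -> smooth_on U g ->
  smooth_on U (fun x => f x + g x).
Proof. by move=> oU sf sg k; exact: class_CD. Qed.

Lemma smoothM U f g : open U -> smooth_on U f -> smooth_on U g ->
  smooth_on U (fun x => f x * g x).
Proof. by move=> oU sf sg k; exact: class_CM. Qed.

Lemma smoothN U f : open U -> smooth_on U f -> smooth_on U (fun x => - f x).
Proof.
move=> oU sf; apply: smooth_ext (smoothM oU (smooth_cst U (-1)) sf) => // x _.
by rewrite mulN1r.
Qed.

Lemma smoothB U f g : open U -> smooth_on U f -> smooth_on U g ->
  smooth_on U (fun x => f x - g x).
Proof. by move=> oU sf sg; apply: smoothD => //; exact: smoothN. Qed.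

Lemma smoothX U f n : open U -> smooth_on U f -> smooth_on U (fun x => f x ^+ n).
Proof.
move=> oU sf; elim: n => [|n IH]; first exact: smooth_cst.
by apply: smooth_ext (smoothM oU sf IH) => // x _; rewrite exprS.
Qed.

Lemma smoothV U f : open U -> (forall x, U x -> f x != 0) ->
  smooth_on U f -> smooth_on U (fun x => (f x)^-1).
Proof. by move=> oU f0 sf k; exact: class_CV. Qed.

Lemma smooth_sum U (I : Type) (r : seq I) (P : pred I) (F : I -> V -> R) :
  open U -> (forall i, smooth_on U (F i)) ->
  smooth_on U (fun x => \sum_(i <- r | P i) F i x).
Proof. by move=> oU sF k; apply: class_C_sum => // i; exact: sF. Qed.

Lemma smooth_prod U (I : Type) (r : seq I) (P : pred I) (F : I -> V -> R) :
  open U -> (forall i, smooth_on U (F i)) ->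
  smooth_on U (fun x => \prod_(i <- r | P i) F i x).
Proof.
move=> oU sF; elim: r => [|i r IH].
  by apply: smooth_ext (smooth_cst U 1) => // x _; rewrite big_nil.
case Pi : (P i); last by apply: smooth_ext IH => // x _; rewrite big_cons Pi.
by apply: smooth_ext (smoothM oU (sF i) IH) => // x _; rewrite big_cons Pi.
Qed.

Lemma smooth_derive U f v : smooth_on U f -> smooth_on U ('D_v f).
Proof. by move=> sf k; have [_] := sf k.+1; apply. Qed.

Lemma smooth_diff U f x : smooth_on U f -> U x -> differentiable f x.
Proof. by move=> sf; have [df _] := sf 1%N; exact: df. Qed.

Lemma smooth_derivable U f x v : smooth_on U f -> U x -> derivable f x v.
Proof. by move=> sf Ux; apply/diff_derivable/(smooth_diff sf). Qed.

Lemma smooth_continuous U f x : smooth_on U f -> U x -> {for x, continuous f}.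
Proof. by move=> sf Ux; apply/differentiable_continuous/(smooth_diff sf). Qed.

Lemma eq_derive U f g x v : open U -> U x -> (forall y, U y -> f y = g y) ->
  'D_v f x = 'D_v g x.
Proof. by move=> oU Ux fg; apply: near_eq_derive; exact: near_open Ux _. Qed.

End Smoothness.

Section ChainRule.
Context {R : realType} {n : nat}.
Implicit Types (x w : 'rV[R]_n) (f : 'rV[R]_n -> R).

Lemma derive_pd f x w : differentiable f x ->
  'D_w f x = \sum_a w 0 a * pd a f x.
Proof.
move=> df; rewrite deriveE // {1}(row_sum_delta w) linear_sum.
by apply: eq_bigr => a _; rewrite linearZ /pd deriveE.
Qed.

Context {V : normedModType R}.
Implicit Types (y : V -> 'rV[R]_n) (u v : V).

Lemma differentiable_row y u :
  (forall a, differentiable (fun u => y u 0 a) u) -> differentiable y u.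
Proof.
move=> dy; have -> : y = \sum_a (fun u => y u 0 a *: delta_mx 0 a).
  by apply/funext => z; rewrite fct_sumE -row_sum_delta.
by apply: differentiable_sum => a; apply: differentiableZl.
Qed.

Lemma derive_row y u v a :
  (forall a, differentiable (fun u => y u 0 a) u) ->
  ('D_v y u) 0 a = 'D_v (fun u => y u 0 a) u.
Proof.
by move=> dy; rewrite derive_mx ?mxE //; exact/diff_derivable/differentiable_row.
Qed.

Lemma derive_comp f y u v : differentiable f (y u) ->
  (forall a, differentiable (fun u => y u 0 a) u) ->
  'D_v (fun z => f (y z)) u = \sum_a 'D_v (fun z => y z 0 a) u * pd a f (y u).
Proof.
move=> df dy; have dy' := differentiable_row dy.
rewrite (_ : (fun z => f (y z)) = f \o y) // deriveE; last exact: differentiable_comp.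
rewrite diff_comp //= -deriveE // -deriveE // derive_pd //.
by apply: eq_bigr => a _; rewrite derive_row.
Qed.

Lemma continuous_row y u :
  (forall a, {for u, continuous (fun u => y u 0 a)}) -> {for u, continuous y}.
Proof.
move=> cy; have -> : y = \sum_a (fun u => y u 0 a *: delta_mx 0 a).
  by apply/funext => z; rewrite fct_sumE -row_sum_delta.
elim/big_ind: _ => [|f g cf cg|a _]; first exact: cvg_cst.
- exact: continuousD.
- by apply: continuousZ; [exact: cy|exact: cvg_cst].
Qed.

Lemma class_C_comp k (O : set V) (U : set 'rV[R]_n) f y : open O ->
  (forall u, O u -> U (y u)) -> class_C k U f ->
  (forall a, class_C k O (fun u => y u 0 a)) -> class_C k O (fun u => f (y u)).
Proof.
move=> oO OU; elim: k f => [|k IH] f Cf Cy.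
  move=> u Ou; apply: continuous_comp; last exact/Cf/OU.
  by apply: continuous_row => a; exact: Cy.
have dy u a : O u -> differentiable (fun u => y u 0 a) u.
  by move=> Ou; have [dy _] := Cy a; exact: dy.
have [df Df] := Cf; split=> [u Ou|v].
  apply: (@differentiable_comp _ _ _ _ y f); last exact/df/OU.
  by apply: differentiable_row => a; exact: dy.
have CS : class_C k O (fun u => \sum_a 'D_v (fun z => y z 0 a) u * pd a f (y u)).
  apply: class_C_sum => // a; apply: class_CM => //; first by have [_] := Cy a; apply.
  by apply: IH (Df _) _ => b; exact: class_CS.
apply: (class_C_ext oO _ CS) => u Ou; rewrite derive_comp //; first exact/df/OU.
by move=> a; exact: dy.
Qed.

Lemma smooth_comp (O : set V) (U : set 'rV[R]_n) f y : open O ->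
  (forall u, O u -> U (y u)) -> smooth_on U f ->
  (forall a, smooth_on O (fun u => y u 0 a)) -> smooth_on O (fun u => f (y u)).
Proof.
move=> oO OU sf sy k; apply: class_C_comp OU (sf k) _ => // a; exact: sy.
Qed.

End ChainRule.

(** * Symmetry of second derivatives *)

Section Schwarz.
Context {R : realType} {V : normedModType R}.
Implicit Types (f : V -> R) (x z v w : V) (U : set V).

Lemma is_derive_line f z v (t : R) : differentiable f (z + t *: v) ->
  is_derive t (1 : R) (fun t => f (z + t *: v)) ('D_v f (z + t *: v)).
Proof.
move=> df; pose l (t : R^o) := z + t *: v.
have dl : is_diff (t : R^o) l ( *:%R ^~ v).
  by apply: is_diff_eq; rewrite add0r.
have [ddl dlE] := dl.
have dfl : differentiable (f \o l) (t : R^o).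
  exact: differentiable_comp.
apply: DeriveDef; first exact: diff_derivable.
rewrite deriveE // -[LHS]/('d (f \o l) (t : R^o) 1).
by rewrite diff_comp //= dlE scale1r deriveE.
Qed.

Lemma mean_value_line f z v (h : R) : 0 < h ->
  (forall t, 0 <= t <= h -> differentiable f (z + t *: v)) ->
  exists2 t, 0 < t < h & f (z + h *: v) - f z = 'D_v f (z + t *: v) * h.
Proof.
move=> h0 df.
have [t|t|t] := @MVT R (fun t => f (z + t *: v)) (fun t => 'D_v f (z + t *: v)) 0 h h0.
- by rewrite in_itv /= => /andP[t0 th]; apply: is_derive_line; apply: df; rewrite !ltW.
- apply: continuous_in_subspaceT => s; rewrite inE /= in_itv /= => sh.
  have [dl _] := is_derive_line (df _ sh).
  exact/differentiable_continuous/derivable1_diffP.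
by rewrite in_itv /= scale0r addr0 subr0 => th E; exists t.
Qed.

(** The mean value theorem twice: along [v] for the increment [f (z + h *: w) - f z], then along [w]
    for the derivative ['D_v f]. *)
Lemma second_difference f x v w U (h : R) : smooth_on U f -> 0 < h ->
  (forall s t, 0 <= s <= h -> 0 <= t <= h -> U (x + s *: v + t *: w)) ->
  exists s t, [/\ 0 < s < h, 0 < t < h &
    f (x + h *: v + h *: w) - f (x + h *: v) - (f (x + h *: w) - f x)
    = 'D_w ('D_v f) (x + s *: v + t *: w) * h * h].
Proof.
move=> sf h0 xU; pose g z := f (z + h *: w) - f z.
have hh : 0 <= h <= h by rewrite lexx ltW.
have h00 : 0 <= (0 : R) <= h by rewrite lexx ltW.
have dfw t : 0 <= t <= h -> differentiable (fun z => f (z + h *: w)) (x + t *: v).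
  move=> th; apply: (@differentiable_comp _ _ _ _ (fun z => z + h *: w) f).
    by apply: differentiableD => //; exact: differentiable_cst.
  exact/(smooth_diff sf)/xU.
have dg t : 0 <= t <= h -> differentiable g (x + t *: v).
  move=> th; apply: differentiableB; first exact: dfw.
  by apply: (smooth_diff sf); have := xU t 0 th h00; rewrite scale0r addr0.
have [s sh Es] := mean_value_line h0 dg.
have sh' : 0 <= s <= h by case/andP: sh => s0 sh; rewrite !ltW.
have Ds : 'D_v g (x + s *: v) = 'D_v f (x + s *: v + h *: w) - 'D_v f (x + s *: v).
  have d1 : derivable f (x + s *: v) v.
    apply: smooth_derivable sf _; by have := xU s 0 sh' h00; rewrite scale0r addr0.
  have E : 'D_v (fun z => f (z + h *: w)) (x + s *: v) = 'D_v f (x + s *: v + h *: w).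
    rewrite /derive; set F := (F in F @ _); set F' := (F in _ = lim (F @ _)).
    by rewrite (_ : F = F') //; apply/funext => t; rewrite /F /F' /= -!addrA.
  rewrite -E; pose F z := f (z + h *: w); have gE : g = F - f by [].
  have d2 : derivable F (x + s *: v) v by exact/diff_derivable/dfw.
  by rewrite gE; exact: deriveB d2 d1.
have [|t th Et] := @mean_value_line ('D_v f) (x + s *: v) w h h0.
  by move=> t th; apply: (@smooth_diff _ _ U); [exact: smooth_derive|exact: xU].
by exists s, t; split=> //; rewrite -Et -Ds -Es /g.
Qed.

(** The common value may be taken at two different points, because two uses of the mean value
    theorem give unrelated intermediate points. *)
Lemma continuous_coincide (A B : V -> R) x :
  {for x, continuous A} -> {for x, continuous B} ->
  (forall P, nbhs x P -> exists z z', [/\ P z, P z' & A z = B z']) -> A x = B x.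
Proof.
move=> /cvgrPdist_lt cA /cvgrPdist_lt cB AB; apply/eqP; apply: contraT => neq.
have e0 : 0 < `|A x - B x| / 2 by rewrite divr_gt0 // normr_gt0 subr_eq0.
have [z [z' [[Az _] [_ Bz] E]]] := AB _ (filterI (cA _ e0) (cB _ e0)).
move: Az Bz; rewrite E => Az Bz.
suff : `|A x - B x| < `|A x - B x| by rewrite ltxx.
rewrite {1}(_ : A x - B x = (A x - B z') - (B x - B z')); last by ring.
by apply: (le_lt_trans (ler_normB _ _)); rewrite [ltRHS]splitr ltrD.
Qed.

(** The second difference over a parallelogram is symmetric in [v] and [w], so the two mixed
    derivatives share a value in every small parallelogram at [x]; continuity transfers this to
    [x]. *)
Lemma derive_derive_sym f x v w U : open U -> smooth_on U f -> U x ->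
  'D_v ('D_w f) x = 'D_w ('D_v f) x.
Proof.
move=> oU sf Ux; apply: (@continuous_coincide ('D_v ('D_w f)) ('D_w ('D_v f))).
- by apply: (@smooth_continuous _ _ U) => //; do 2 apply: smooth_derive.
- by apply: (@smooth_continuous _ _ U) => //; do 2 apply: smooth_derive.
move=> P nP; have nU : nbhs x U by exact: open_nbhs_nbhs.
have nUP : nbhs x (U `&` P) by exact: filterI.
move/nbhs_ballP: nUP => [d /= d0 xd].
have k0 : 0 < 2 * (1 + `|v| + `|w|) by rewrite mulr_gt0 // ltr_wpDr // ltr_wpDr.
(* This keeps the whole parallelogram in the ball, as [h * (|v| + |w|) < d]; the summand 1 keeps the
   denominator positive when [v] and [w] vanish. *)
pose h := d / (2 * (1 + `|v| + `|w|)).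
have h0 : 0 < h by rewrite divr_gt0.
have hd s t : 0 <= s <= h -> 0 <= t <= h -> ball x d (x + s *: v + t *: w).
  move=> /andP[s0 sh] /andP[t0 th]; rewrite -ball_normE /= -addrA opprD addrA.
  rewrite subrr sub0r normrN (le_lt_trans (ler_normD _ _)) // !normrZ.
  rewrite !ger0_norm //; apply: (@le_lt_trans _ _ (h * (`|v| + `|w|))).
    by rewrite mulrDr lerD // ler_wpM2r.
  rewrite /h mulrAC ltr_pdivrMr // ltr_pM2l //.
  by have := normr_ge0 v; have := normr_ge0 w; lra.
have hd' s t : 0 <= s <= h -> 0 <= t <= h -> ball x d (x + s *: w + t *: v).
  by move=> sh th; rewrite addrAC; exact: hd.
have [|s [t [sh th E]]] := @second_difference f x v w U h sf h0.
  by move=> s t sh th; have [] := xd _ (hd _ _ sh th).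
have [|s' [t' [sh' th' E']]] := @second_difference f x w v U h sf h0.
  by move=> s' t' sh' th'; have [] := xd _ (hd' _ _ sh' th').
have lw a : 0 < a < h -> 0 <= a <= h by case/andP => a0 ah; rewrite !ltW.
exists (x + s' *: w + t' *: v), (x + s *: v + t *: w); split.
- by have [] := xd _ (hd' _ _ (lw _ sh') (lw _ th')).
- by have [] := xd _ (hd _ _ (lw _ sh) (lw _ th)).
apply: (mulIf (lt0r_neq0 h0)); apply: (mulIf (lt0r_neq0 h0)).
by apply: (etrans (esym E') (etrans _ E)); rewrite [x + h *: w + _]addrAC; ring.
Qed.

End Schwarz.

(** * Calculus of matrix-valued functions *)

Section Entries.
Context {R : realType}.

Lemma addmxE p q (A B : 'M[R]_(p, q)) i j : (A + B) i j = A i j + B i j.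
Proof. exact: mxE. Qed.

Lemma oppmxE p q (A : 'M[R]_(p, q)) i j : (- A) i j = - A i j.
Proof. exact: mxE. Qed.

Lemma scalemxE p q k (A : 'M[R]_(p, q)) i j : (k *: A) i j = k * A i j.
Proof. exact: mxE. Qed.

Lemma trmxD p q (A B : 'M[R]_(p, q)) : (A + B)^T = A^T + B^T.
Proof. exact: raddfD. Qed.

Lemma trmxN p q (A : 'M[R]_(p, q)) : (- A)^T = - A^T.
Proof. exact: raddfN. Qed.

Lemma trmxZ p q k (A : 'M[R]_(p, q)) : (k *: A)^T = k *: A^T.
Proof. exact: linearZ. Qed.

Lemma rowD p q i (A B : 'M[R]_(p, q)) : row i (A + B) = row i A + row i B.
Proof. exact: raddfD. Qed.

Lemma row_entry p q i (A : 'M[R]_(p, q)) j : row i A 0 j = A i j.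
Proof. exact: mxE. Qed.

Definition entryE := (addmxE, oppmxE, scalemxE).

Lemma trmx00 (A : 'M[R]_1) : A^T 0 0 = A 0 0.
Proof. exact: mxE. Qed.

End Entries.

HB.lock Definition derive_mat (R : realType) (V : normedModType R) (p q : nat) (v : V)
  (M : V -> 'M[R]_(p, q)) (u : V) : 'M[R]_(p, q) :=
  \matrix_(i, j) 'D_v (fun w => M w i j) u.

Notation "''d_' v M" := (derive_mat v M) (at level 10, v, M at next level).

Section MatrixDerivative.
Context {R : realType} {V : normedModType R}.
Implicit Types (U : set V) (u v w : V).

Definition smooth_mx p q U (M : V -> 'M[R]_(p, q)) :=
  forall i j, smooth_on U (fun u => M u i j).

Lemma derive_matE p q (A : V -> 'M[R]_(p, q)) v u i j :
  'd_v A u i j = 'D_v (fun u => A u i j) u.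
Proof. by rewrite derive_mat.unlock mxE. Qed.

Lemma derive_mat_entry p q (A : V -> 'M[R]_(p, q)) v i j :
  (fun u => 'd_v A u i j) = 'D_v (fun u => A u i j).
Proof. by apply/funext => u; rewrite derive_matE. Qed.

Lemma derive_add (f g : V -> R) U u v : smooth_on U f -> smooth_on U g -> U u ->
  'D_v (fun w => f w + g w) u = 'D_v f u + 'D_v g u.
Proof.
by move=> sf sg Uu; rewrite -deriveD //; [exact: (smooth_derivable sf)|exact: (smooth_derivable sg)].
Qed.

Lemma derive_opp (f : V -> R) U u v : smooth_on U f -> U u ->
  'D_v (fun w => - f w) u = - 'D_v f u.
Proof. by move=> sf Uu; rewrite -deriveN //; exact: (smooth_derivable sf). Qed.

Lemma derive_mul (f g : V -> R) U u v : smooth_on U f -> smooth_on U g -> U u ->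
  'D_v (fun w => f w * g w) u = 'D_v f u * g u + f u * 'D_v g u.
Proof.
move=> sf sg Uu; have df := smooth_derivable (v := v) sf Uu.
have dg := smooth_derivable (v := v) sg Uu.
have /= -> := deriveM df dg.
by rewrite /GRing.scale /= addrC mulrC.
Qed.

Lemma derive_bigsum n (F : 'I_n -> V -> R) U u v :
  (forall i, smooth_on U (F i)) -> U u ->
  'D_v (fun w => \sum_i F i w) u = \sum_i 'D_v (F i) u.
Proof.
move=> sF Uu; rewrite -derive_sum; last by move=> i; exact: (smooth_derivable (sF i)).
by congr ('D_v _ u); apply/funext => w; rewrite fct_sumE.
Qed.

Section Rules.
Variables (U : set V) (oU : open U).
Context {p q r : nat}.

Lemma smooth_mxM (A : V -> 'M[R]_(p, q)) (B : V -> 'M[R]_(q, r)) :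
  smooth_mx U A -> smooth_mx U B -> smooth_mx U (fun u => A u *m B u).
Proof.
move=> sA sB i j; have := smooth_sum (index_enum 'I_q) xpredT oU
  (fun k => smoothM oU (sA i k) (sB k j)).
by apply: smooth_ext => // u _; rewrite mxE.
Qed.

Lemma smooth_mxD (A B : V -> 'M[R]_(p, q)) :
  smooth_mx U A -> smooth_mx U B -> smooth_mx U (fun u => A u + B u).
Proof.
move=> sA sB i j; have := smoothD oU (sA i j) (sB i j).
by apply: smooth_ext => // u _; rewrite mxE.
Qed.

Lemma smooth_mxZ f (A : V -> 'M[R]_(p, q)) :
  smooth_on U f -> smooth_mx U A -> smooth_mx U (fun u => f u *: A u).
Proof.
move=> sf sA i j; have := smoothM oU sf (sA i j).
by apply: smooth_ext => // u _; rewrite mxE.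
Qed.

Lemma smooth_mxN (A : V -> 'M[R]_(p, q)) :
  smooth_mx U A -> smooth_mx U (fun u => - A u).
Proof.
move=> sA i j; have := smoothN oU (sA i j).
by apply: smooth_ext => // u _; rewrite mxE.
Qed.

Lemma smooth_mx_tr (A : V -> 'M[R]_(p, q)) :
  smooth_mx U A -> smooth_mx U (fun u => (A u)^T).
Proof.
move=> sA i j; have := sA j i.
by apply: smooth_ext => // u _; rewrite mxE.
Qed.

Lemma smooth_mx_ext (A B : V -> 'M[R]_(p, q)) :
  (forall u, U u -> A u = B u) -> smooth_mx U A -> smooth_mx U B.
Proof. by move=> AB sA i j; apply: smooth_ext (sA i j) => // u Uu; rewrite AB. Qed.

Lemma derive_matM (A : V -> 'M[R]_(p, q)) (B : V -> 'M[R]_(q, r)) u v :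
  smooth_mx U A -> smooth_mx U B -> U u ->
  'd_v (fun u => A u *m B u) u = 'd_v A u *m B u + A u *m 'd_v B u.
Proof.
move=> sA sB Uu; apply/matrixP => i j; rewrite derive_matE !mxE -big_split /=.
under eq_fun do rewrite mxE.
rewrite (derive_bigsum (U := U)) //; last first.
  by move=> k; apply: smoothM.
by apply: eq_bigr => k _; rewrite !derive_matE (derive_mul _ (sA i k) (sB k j)).
Qed.

Lemma derive_matD (A B : V -> 'M[R]_(p, q)) u v :
  smooth_mx U A -> smooth_mx U B -> U u ->
  'd_v (fun u => A u + B u) u = 'd_v A u + 'd_v B u.
Proof.
move=> sA sB Uu; apply/matrixP => i j; rewrite derive_matE !entryE !derive_matE.
by under eq_fun do rewrite mxE; rewrite (derive_add _ (sA i j) (sB i j)).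
Qed.

Lemma derive_matN (A : V -> 'M[R]_(p, q)) u v :
  smooth_mx U A -> U u -> 'd_v (fun u => - A u) u = - 'd_v A u.
Proof.
move=> sA Uu; apply/matrixP => i j; rewrite derive_matE !entryE !derive_matE.
by under eq_fun do rewrite mxE; rewrite (derive_opp _ (sA i j)).
Qed.

Lemma derive_matZ f (A : V -> 'M[R]_(p, q)) u v :
  smooth_on U f -> smooth_mx U A -> U u ->
  'd_v (fun u => f u *: A u) u = 'D_v f u *: A u + f u *: 'd_v A u.
Proof.
move=> sf sA Uu; apply/matrixP => i j; rewrite derive_matE !entryE !derive_matE.
by under eq_fun do rewrite mxE; rewrite (derive_mul _ sf (sA i j)).
Qed.

Lemma derive_mat_tr (A : V -> 'M[R]_(p, q)) u v :
  'd_v (fun u => (A u)^T) u = ('d_v A u)^T.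
Proof. by apply/matrixP => i j; rewrite mxE !derive_matE; under eq_fun do rewrite mxE. Qed.

Lemma derive_mat_ext (A B : V -> 'M[R]_(p, q)) u v :
  (forall u, U u -> A u = B u) -> U u -> 'd_v A u = 'd_v B u.
Proof.
by move=> AB Uu; apply/matrixP => i j; rewrite !derive_matE; apply: (@eq_derive _ _ U) => // w /AB ->.
Qed.

Lemma derive_mat_sym (A : V -> 'M[R]_(p, q)) u v w :
  smooth_mx U A -> U u -> 'd_v ('d_w A) u = 'd_w ('d_v A) u.
Proof.
move=> sA Uu; apply/matrixP => i j; rewrite !derive_matE.
by rewrite !derive_mat_entry; exact: derive_derive_sym (sA i j) Uu.
Qed.

Lemma smooth_derive_mat (A : V -> 'M[R]_(p, q)) v :
  smooth_mx U A -> smooth_mx U ('d_v A).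
Proof.
by move=> sA i j; rewrite derive_mat_entry; exact: smooth_derive.
Qed.

End Rules.

Lemma smooth_mx_sum p q n (F : 'I_n -> V -> 'M[R]_(p, q)) U : open U ->
  (forall a, smooth_mx U (F a)) -> smooth_mx U (fun u => \sum_a F a u).
Proof.
move=> oU sF i j; have := smooth_sum (index_enum 'I_n) xpredT oU (fun a => sF a i j).
by apply: smooth_ext => // u _; rewrite summxE.
Qed.

Lemma derive_mat_sum p q n (F : 'I_n -> V -> 'M[R]_(p, q)) U u v :
  (forall a, smooth_mx U (F a)) -> U u ->
  'd_v (fun u => \sum_a F a u) u = \sum_a 'd_v (F a) u.
Proof.
move=> sF Uu; apply/matrixP => i j; rewrite derive_matE summxE.
under eq_fun do rewrite summxE.
rewrite (derive_bigsum (U := U)) //; last by move=> a; exact: sF.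
by apply: eq_bigr => a _; rewrite derive_matE.
Qed.

Lemma derive_mat_cst p q (A : 'M[R]_(p, q)) u v : 'd_v (fun=> A) u = 0.
Proof. by apply/matrixP => i j; rewrite derive_matE derive_cst mxE. Qed.

Section Inverse.
Variables (U : set V) (oU : open U) (n : nat).

Lemma smooth_det (A : V -> 'M[R]_n) :
  smooth_mx U A -> smooth_on U (fun u => \det (A u)).
Proof.
move=> sA; rewrite /determinant; apply: smooth_sum => // s.
by apply: smoothM (smooth_cst _ _) _ => //; apply: smooth_prod => // i; exact: sA.
Qed.

(** Differentiation of [invmx A *m A = 1]. *)
Lemma derive_inv (A : V -> 'M[R]_n) u v :
  smooth_mx U A -> (forall u, U u -> A u \in unitmx) ->
  smooth_mx U (fun u => invmx (A u)) -> U u ->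
  'd_v (fun u => invmx (A u)) u = - (invmx (A u) *m 'd_v A u *m invmx (A u)).
Proof.
move=> sA uA sI Uu; have := derive_matM oU v sI sA Uu.
rewrite (derive_mat_ext (B := fun=> 1%:M) oU) //; last by move=> w /uA /mulVmx.
rewrite derive_mat_cst => /esym/eqP; rewrite addr_eq0 => /eqP E.
by rewrite -[LHS](mulmxK (uA _ Uu)) E mulNmx.
Qed.

End Inverse.

(** Cramer's formula: the entries are cofactors divided by the determinant. *)
Lemma smooth_inv (U : set V) n (A : V -> 'M[R]_n) : open U ->
  smooth_mx U A -> (forall u, U u -> A u \in unitmx) ->
  smooth_mx U (fun u => invmx (A u)).
Proof.
move=> oU sA uA i j.
have s1 : smooth_on U (fun u => (\det (A u))^-1 * \adj (A u) i j).
  apply: smoothM => //.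
    by apply: smoothV => // [u /uA|]; [rewrite unitmxE unitfE|exact: smooth_det].
  have s2 : smooth_on U (fun u => cofactor (A u) j i).
    apply: smoothM (smooth_cst _ _) _ => //; apply: smooth_det => // k l.
    by apply: smooth_ext (sA (lift j k) (lift i l)) => // u _; rewrite !mxE.
  by apply: smooth_ext s2 => // u _; rewrite mxE.
by apply: smooth_ext s1 => // u Uu; rewrite /invmx uA // [RHS]mxE.
Qed.

End MatrixDerivative.

Section MatrixChainRule.
Context {R : realType} {V : normedModType R}.

Lemma derive_mat_comp (O : set V) n (U : set 'rV[R]_n) p q (M : 'rV[R]_n -> 'M[R]_(p, q))
    (y : V -> 'rV[R]_n) u v :
  (forall u, O u -> U (y u)) -> smooth_mx U M -> smooth_mx O y -> O u ->
  'd_v (fun u => M (y u)) u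
  = \sum_a ('d_v y u) 0 a *: 'd_(basis_vec a) M (y u).
Proof.
move=> OU sM sy Ou; apply/matrixP => i j; rewrite derive_matE (@derive_comp _ _ _ (fun x => M x i j) y).
- by rewrite summxE; apply: eq_bigr => a _; rewrite mxE !derive_matE.
- by apply: smooth_diff (sM i j) _; exact: OU.
- by move=> a; exact: smooth_diff (sy 0 a) Ou.
Qed.

Lemma smooth_mx_comp (O : set V) n (U : set 'rV[R]_n) p q (M : 'rV[R]_n -> 'M[R]_(p, q))
    (y : V -> 'rV[R]_n) : open O ->
  (forall u, O u -> U (y u)) -> smooth_mx U M -> smooth_mx O y ->
  smooth_mx O (fun u => M (y u)).
Proof. by move=> oO OU sM sy i j; apply: smooth_comp OU (sM i j) (sy 0). Qed.

End MatrixChainRule.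

(** * The Levi-Civita and tractor connections in coordinates *)

(** Rows carry the lower index and columns the upper one, so a covector field written as a row [w]
    has covariant derivative ['d_(basis_vec a) w x - w x *m (conn_mx G a x)^T]. *)
HB.lock Definition conn_mx (R : realType) (n : nat) (G : 'rV[R]_n -> 'M[R]_n) (a : 'I_n)
  (x : 'rV[R]_n) : 'M[R]_n := \matrix_(b, c) christoffel G c a b x.

HB.lock Definition schouten_mx (R : realType) (n : nat) (G : 'rV[R]_n -> 'M[R]_n)
  (x : 'rV[R]_n) : 'M[R]_n := \matrix_(a, b) schouten G a b x.

Section LeviCivita.
Context {R : realType} {n : nat}.
Implicit Types (G : 'rV[R]_n -> 'M[R]_n) (x : 'rV[R]_n) (a b c e : 'I_n).

(** Twice the Christoffel symbols of the first kind, with the lowered index [e] as column. *)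
Definition koszul_mx G a x : 'M[R]_n := \matrix_(b, e)
  (pd a (fun y => G y e b) x + pd b (fun y => G y e a) x
   - pd e (fun y => G y a b) x).

Lemma conn_mx_entry G a x b c : conn_mx G a x b c = christoffel G c a b x.
Proof. by rewrite conn_mx.unlock mxE. Qed.

Lemma schouten_mx_entry G x a b : schouten_mx G x a b = schouten G a b x.
Proof. by rewrite schouten_mx.unlock mxE. Qed.

(** The Riemann tensor: entry [(b, d)] is the [d]-component of R(e_a, e_c) e_b, with e_a the
    coordinate fields. Since rows carry the lower index, the products come in the order opposite to
    composition of endomorphisms. *)
Definition curv_mx G a c x : 'M[R]_n :=
  'd_(basis_vec a) (conn_mx G c) x - 'd_(basis_vec c) (conn_mx G a) x
  + conn_mx G c x *m conn_mx G a x - conn_mx G a x *m conn_mx G c x.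

Lemma conn_mxE G a x :
  conn_mx G a x = 2^-1 *: (koszul_mx G a x *m (invmx (G x))^T).
Proof.
apply/matrixP => b c; rewrite conn_mx_entry !mxE /christoffel; congr (_ * _).
by apply: eq_bigr => e _; rewrite !mxE mulrC.
Qed.

Section Metric.
Variables (U : set 'rV[R]_n) (G : 'rV[R]_n -> 'M[R]_n).
Hypotheses (oU : open U) (sG : smooth_mx U G)
  (symG : forall x, U x -> (G x)^T = G x) (uG : forall x, U x -> G x \in unitmx).

Lemma metric_sym x i j : U x -> G x i j = G x j i.
Proof. by move=> Ux; rewrite -[in LHS]symG // mxE. Qed.

Lemma pd_metric_sym a i j x : U x ->
  pd a (fun y => G y i j) x = pd a (fun y => G y j i) x.
Proof. by move=> Ux; apply: (@eq_derive _ _ U) => // y /metric_sym. Qed.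

Lemma inv_metric_sym x : U x -> (invmx (G x))^T = invmx (G x).
Proof. by move=> Ux; rewrite trmx_inv symG. Qed.

Lemma christoffelC c a b x : U x -> christoffel G c a b x = christoffel G c b a x.
Proof.
move=> Ux; rewrite /christoffel; congr (_ * _); apply: eq_bigr => e _.
by congr (_ * _); rewrite (pd_metric_sym e a b Ux); ring.
Qed.

Lemma conn_mx_metric a x : U x -> conn_mx G a x *m G x = 2^-1 *: koszul_mx G a x.
Proof. by move=> Ux; rewrite conn_mxE inv_metric_sym // -scalemxAl mulmxKV // uG. Qed.

(** Metric compatibility: twice the derivative of the metric is the symmetrisation of Koszul's
    expression. *)
Lemma derive_metric a x : U x ->
  'd_(basis_vec a) G x = conn_mx G a x *m G x + G x *m (conn_mx G a x)^T.
Proof.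
move=> Ux; have -> : G x *m (conn_mx G a x)^T = (conn_mx G a x *m G x)^T.
  by rewrite trmx_mul symG.
rewrite conn_mx_metric //; apply/matrixP => i j; rewrite derive_matE !mxE -/(pd a _ x).
rewrite (pd_metric_sym a j i Ux) (pd_metric_sym i j a Ux) (pd_metric_sym j a i Ux).
by field.
Qed.

Lemma smooth_conn a : smooth_mx U (conn_mx G a).
Proof.
have sK : smooth_mx U (koszul_mx G a).
  move=> b e; have s1 i j k : smooth_on U (pd i (fun y => G y j k)).
    by apply: smooth_derive; exact: sG.
  have := smoothB oU (smoothD oU (s1 a e b) (s1 b e a)) (s1 e a b).
  by apply: smooth_ext => // x _; rewrite mxE.
have := smooth_mxZ oU (smooth_cst U 2^-1)
  (smooth_mxM oU sK (smooth_mx_tr oU (smooth_inv oU sG uG))).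
by apply: smooth_mx_ext => // x _; rewrite conn_mxE.
Qed.

Lemma smooth_christoffel c a b : smooth_on U (christoffel G c a b).
Proof. by apply: smooth_ext (smooth_conn a b c) => // x _; rewrite conn_mx_entry. Qed.

Lemma smooth_ricci a b : smooth_on U (ricci G a b).
Proof.
have sc := smooth_christoffel; apply: smooth_sum => // c.
apply: smoothD => //; first by apply: smoothB => //; apply: smooth_derive.
by apply: smooth_sum => // e; apply: smoothB => //; apply: smoothM.
Qed.

Lemma smooth_schouten_trace : smooth_on U (schouten_trace G).
Proof.
apply: smoothM => //; first exact: smooth_cst.
apply: smooth_sum => // a; apply: smooth_sum => // b.
by apply: smoothM; [|exact: smooth_inv|exact: smooth_ricci].
Qed.

Lemma smooth_schouten a b : smooth_on U (schouten G a b).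
Proof.
apply: smoothM => //; first exact: smooth_cst.
apply: smoothB => //; first exact: smooth_ricci.
by apply: smoothM => //; exact: smooth_schouten_trace.
Qed.

Lemma smooth_schouten_mx : smooth_mx U (schouten_mx G).
Proof. by move=> a b; apply: smooth_ext (smooth_schouten a b) => // x _; rewrite schouten_mx_entry. Qed.

Lemma derive_trace (M : 'rV[R]_n -> 'M[R]_n) x v : smooth_mx U M -> U x ->
  'D_v (fun y => \tr (M y)) x = \tr ('d_v M x).
Proof.
move=> sM Ux; rewrite (derive_bigsum (U := U)) //.
by apply: eq_bigr => i _; rewrite derive_matE.
Qed.

Lemma trace_conn a x : U x ->
  \tr (conn_mx G a x) = 2^-1 * \tr (invmx (G x) *m 'd_(basis_vec a) G x).
Proof.
move=> Ux; rewrite derive_metric // mulmxDr mulKmx ?uG // mxtraceD mxtrace_tr.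
by rewrite mxtrace_mulC mulmxK ?uG //; field.
Qed.

(** The traces of the connection matrices are the partial derivatives of log sqrt |det G|, hence a
    closed 1-form. Differentiating the half trace of [trace_conn] gives one term symmetric by
    equality of mixed derivatives and one symmetric by cyclicity of the trace. *)
Lemma pd_trace_conn_sym a b x : U x ->
  pd b (fun y => \tr (conn_mx G a y)) x = pd a (fun y => \tr (conn_mx G b y)) x.
Proof.
move=> Ux; have sI := smooth_inv oU sG uG.
have E c e : pd e (fun y => \tr (conn_mx G c y)) x =
    2^-1 * (\tr (invmx (G x) *m 'd_(basis_vec e) ('d_(basis_vec c) G) x)
      - \tr (invmx (G x) *m 'd_(basis_vec e) G x *m invmx (G x) *m 'd_(basis_vec c) G x)).
  have sP : smooth_mx U (fun y => 2^-1 *: (invmx (G y) *m 'd_(basis_vec c) G y)).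
    apply: smooth_mxZ (smooth_cst _ _) _ => //.
    by apply: smooth_mxM => //; exact: smooth_derive_mat.
  rewrite /pd (eq_derive (U := U)
    (g := fun y => \tr (2^-1 *: (invmx (G y) *m 'd_(basis_vec c) G y)))) //; last first.
    by move=> y Uy; rewrite trace_conn // mxtraceZ.
  rewrite derive_trace // (derive_matZ _ (smooth_cst U _)) //; last first.
    by apply: smooth_mxM => //; exact: smooth_derive_mat.
  rewrite derive_cst scale0r add0r mxtraceZ; congr (_ * _).
  rewrite (derive_matM oU) //; last exact: smooth_derive_mat.
  rewrite (derive_inv oU _ sG uG sI Ux) mxtraceD addrC; congr (_ + _).
  by rewrite mulNmx raddfN.
have S (K A B : 'M[R]_n) : \tr (K *m A *m K *m B) = \tr (K *m B *m K *m A).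
  by rewrite -(mulmxA (K *m A)) mxtrace_mulC mulmxA.
have D := derive_mat_sym oU (basis_vec a) (basis_vec b) sG Ux.
apply: (etrans (E a b)); apply: (etrans _ (esym (E b a))).
move: D; set Dab := derive_mat _ _ _; set Dba := derive_mat _ _ _ => ->.
move: Dba ('d_(basis_vec a) G x) ('d_(basis_vec b) G x) (invmx (G x)) => D A B K.
by rewrite (S K B A).
Qed.

Lemma ricci_trace_conn a b x : ricci G a b x =
  (\sum_c (pd c (christoffel G c a b) x
    + \sum_e (christoffel G c c e x * christoffel G e a b x
              - christoffel G c b e x * christoffel G e a c x)))
  - \sum_c pd b (christoffel G c a c) x.
Proof. by rewrite -sumrB; apply: eq_bigr => c _; rewrite addrAC. Qed.

(** Torsion-freeness makes every term symmetric except the derivative of the contracted Christoffel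
    symbol, for which [pd_trace_conn_sym] is used. *)
Lemma ricciC a b x : U x -> ricci G a b x = ricci G b a x.
Proof.
move=> Ux; rewrite !ricci_trace_conn; apply: (f_equal2 (fun s t => s - t)); last first.
  have E c e : \sum_f pd e (christoffel G f c f) x = pd e (fun y => \tr (conn_mx G c y)) x.
    apply/esym; apply: (etrans (derive_trace _ (smooth_conn c) Ux)).
    by apply: eq_bigr => f _; rewrite derive_matE; under eq_fun do rewrite conn_mx_entry.
  apply: (etrans (E a b)); apply: (etrans _ (esym (E b a))).
  exact: pd_trace_conn_sym.
have C := christoffelC; move: (christoffel G) C => Gam C.
rewrite !big_split /=; apply: (f_equal2 (fun s t => s + t)).
  by apply: eq_bigr => c _; apply: (@eq_derive _ _ U) => // z Uz; exact: C.
transitivity (\sum_c \sum_e Gam c c e x * Gam e a b x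
  - \sum_c \sum_e Gam c b e x * Gam e a c x).
  by rewrite -sumrB; apply: eq_bigr => c _; rewrite -sumrB.
rewrite [X in _ - X]exchange_big /= -sumrB; apply: eq_bigr => c _.
rewrite -sumrB; apply: eq_bigr => e _.
by rewrite (C e a b) // [X in _ - X]mulrC.
Qed.

Lemma ricci_curv a b x : U x -> ricci G a b x = \sum_c curv_mx G c b x a c.
Proof.
move=> Ux; rewrite /ricci; apply: eq_bigr => c _; rewrite /curv_mx !entryE !derive_matE.
have E i j k : (fun z => conn_mx G i z j k) = christoffel G k i j.
  by apply/funext => z; rewrite conn_mx_entry.
have M i j k l : (conn_mx G i x *m conn_mx G j x) k l
    = \sum_e christoffel G e i k x * christoffel G l j e x.
  by rewrite mxE; apply: eq_bigr => e _; rewrite !conn_mx_entry.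
rewrite !E !M; have C := christoffelC; move: (christoffel G) C => Gam C {E M}.
rewrite -[RHS]addrA; apply: (f_equal2 (fun s t => s + t)).
  apply: (f_equal2 (fun s t => s - t)).
    by apply: (@eq_derive _ _ U) => // z Uz; exact: C.
  by apply: (@eq_derive _ _ U) => // z Uz; exact: C.
rewrite -sumrB; apply: eq_bigr => e _.
by rewrite (C e a b) // (C e a c) //; ring.
Qed.

Lemma schoutenC a b x : U x -> schouten G a b x = schouten G b a x.
Proof. by move=> Ux; rewrite /schouten ricciC // metric_sym. Qed.

End Metric.
End LeviCivita.

Section TractorConnection.
Context {R : realType} {n : nat} {V : normedModType R}.
Variables (U : set 'rV[R]_n) (G : 'rV[R]_n -> 'M[R]_n) (O : set V) (y : V -> 'rV[R]_n).
Hypotheses (oU : open U) (sG : smooth_mx U G)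
  (symG : forall x, U x -> (G x)^T = G x) (uG : forall x, U x -> G x \in unitmx)
  (oO : open O) (OU : forall u, O u -> U (y u)) (sy : smooth_mx O y).

Definition conn_along v u : 'M[R]_n := \sum_a ('d_v y u) 0 a *: conn_mx G a (y u).

Lemma derive_along p q (M : 'rV[R]_n -> 'M[R]_(p, q)) u v : smooth_mx U M -> O u ->
  'd_v (fun u => M (y u)) u = \sum_a ('d_v y u) 0 a *: 'd_(basis_vec a) M (y u).
Proof. by move=> sM Ou; exact: derive_mat_comp OU sM sy Ou. Qed.

Lemma derive_metric_along u v : O u -> 'd_v (fun u => G (y u)) u
  = conn_along v u *m G (y u) + G (y u) *m (conn_along v u)^T.
Proof.
move=> Ou; rewrite derive_along // /conn_along mulmx_suml raddf_sum mulmx_sumr.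
rewrite -big_split; apply: eq_bigr => a _ /=.
rewrite linearZ /= -scalemxAl -scalemxAr -scalerDr.
by rewrite (derive_metric oU symG uG) //; exact: OU.
Qed.

Lemma derive_inv_metric_along u v : O u -> 'd_v (fun u => invmx (G (y u))) u
  = - (invmx (G (y u)) *m conn_along v u + (conn_along v u)^T *m invmx (G (y u))).
Proof.
move=> Ou; have uGy w : O w -> G (y w) \in unitmx by move=> /OU /uG.
have sGy := smooth_mx_comp oO OU sG sy.
rewrite (derive_inv oO _ sGy uGy (smooth_inv oO sGy uGy) Ou) derive_metric_along //.
by congr (- _); rewrite mulmxDr mulmxDl mulKmx ?uGy // !mulmxA mulmxK ?uGy // addrC.
Qed.

Lemma raiseE x w : raise G x w = w *m (invmx (G x))^T.
Proof.
by apply/rowP => a; rewrite !mxE; apply: eq_bigr => b _; rewrite mxE mulrC.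
Qed.

Lemma cov_pairingE x w w' : cov_pairing G x w w' = (w *m invmx (G x) *m w'^T) 0 0.
Proof.
rewrite /cov_pairing exchange_big mxE /=; apply: eq_bigr => b _.
by rewrite !mxE mulr_suml; apply: eq_bigr => a _; rewrite [w 0 a * _]mulrC.
Qed.

Lemma tr_metricE x (S T : tractor R n) : tr_metric G x S T =
  S.1.1 * T.2 + S.2 * T.1.1 + (S.1.2 *m invmx (G x) *m T.1.2^T) 0 0.
Proof. by rewrite /tr_metric cov_pairingE. Qed.

Lemma tr_connE (S : V -> tractor R n) u v :
  tr_conn G y S u v =
  ('D_v (fun w => (S w).1.1) u - ('d_v y u *m (S u).1.2^T) 0 0,
   'd_v (fun w => (S w).1.2) u - (S u).1.2 *m (conn_along v u)^T
     + (S u).2 *: ('d_v y u *m G (y u)) + (S u).1.1 *: ('d_v y u *m schouten_mx G (y u)),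
   'D_v (fun w => (S w).2) u
     - ('d_v y u *m schouten_mx G (y u) *m invmx (G (y u)) *m (S u).1.2^T) 0 0).
Proof.
congr (_, _, _).
- by congr (_ - _); rewrite mxE; apply: eq_bigr => a _; rewrite derive_matE mxE.
- apply/rowP => b; rewrite mxE !addmxE oppmxE !scalemxE derive_matE -!addrA; congr (_ + _).
  have -> : ((S u).1.2 *m (conn_along v u)^T) 0 b = \sum_a ('d_v y u) 0 a *
      \sum_c christoffel G c a b (y u) * (S u).1.2 0 c.
    rewrite mxE; under eq_bigr do rewrite mxE /conn_along summxE mulr_sumr.
    rewrite exchange_big; apply: eq_bigr => a _; rewrite mulr_sumr.
    by apply: eq_bigr => c _; rewrite entryE conn_mx_entry; ring.
  rewrite ![(_ *m _) 0 b]mxE -sumrN !mulr_sumr -!big_split; apply: eq_bigr => a _ /=.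
  by rewrite derive_matE schouten_mx_entry; ring.
- congr (_ - _); rewrite -!mulmxA mxE; apply: eq_bigr => a _.
  rewrite derive_matE; congr (_ * _); rewrite mxE; apply: eq_bigr => b _.
  rewrite schouten_mx_entry !mxE; congr (_ * _).
  by apply: eq_bigr => c _; rewrite mxE.
Qed.

End TractorConnection.

Section TractorMetric.
Context {R : realType} {n : nat}.

(** The reason that the tractor metric is parallel: [M] is the metric, [K] its inverse, [X] the
    direction, [C] the connection and [P] the Schouten tensor. The [M] terms of the middle slot
    cancel against the top slot, the [P] terms against the bottom slot. *)
Lemma tr_metric_leibniz_alg (K C P M : 'M[R]_n) (X mu mu' dmu dmu' : 'rV[R]_n)
    (s r s' r' ds dr ds' dr' : R) :
  M *m K = 1%:M -> K *m M = 1%:M -> K^T = K -> M^T = M ->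
  ds * r' + s * dr' + (dr * s' + r * ds')
  + ((dmu *m K + mu *m - (K *m C + C^T *m K)) *m mu'^T + mu *m K *m dmu'^T) 0 0
  = (ds - (X *m mu^T) 0 0) * r' + (dr - (X *m P *m K *m mu^T) 0 0) * s'
    + ((dmu - mu *m C^T + r *: (X *m M) + s *: (X *m P)) *m K *m mu'^T) 0 0
  + (s * (dr' - (X *m P *m K *m mu'^T) 0 0) + r * (ds' - (X *m mu'^T) 0 0)
    + (mu *m K *m (dmu' - mu' *m C^T + r' *: (X *m M) + s' *: (X *m P))^T) 0 0).
Proof.
move=> MK KM sK sM.
rewrite !(trmxD, trmxN, trmxZ) !trmx_mul !trmxK sM.
rewrite !(mulmxDl, mulmxDr, mulNmx, mulmxN) -!(scalemxAl, scalemxAr) !entryE.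
rewrite -!mulmxA (mulmxA M K) (mulmxA K M) MK KM !mul1mx.
have E1 : (mu *m X^T) 0 0 = (X *m mu^T) 0 0 by rewrite -trmx00 trmx_mul trmxK.
have E2 : (mu *m (K *m (P^T *m X^T))) 0 0 = (X *m (P *m (K *m mu^T))) 0 0.
  by rewrite -trmx00 !trmx_mul !trmxK sK !mulmxA.
rewrite E1 E2; ring.
Qed.

Context {V : normedModType R}.
Variables (U : set 'rV[R]_n) (G : 'rV[R]_n -> 'M[R]_n) (O : set V) (y : V -> 'rV[R]_n).
Hypotheses (oU : open U) (sG : smooth_mx U G)
  (symG : forall x, U x -> (G x)^T = G x) (uG : forall x, U x -> G x \in unitmx)
  (oO : open O) (OU : forall u, O u -> U (y u)) (sy : smooth_mx O y).

Lemma smooth_row (f : V -> 'rV[R]_n) :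
  (forall b, smooth_on O (fun u => f u 0 b)) -> smooth_mx O f.
Proof. by move=> sf i b; rewrite ord1; exact: sf. Qed.

Lemma derive_tr_metric (S T : V -> tractor R n) u v :
  tr_smooth O S -> tr_smooth O T -> O u ->
  'D_v (fun w => tr_metric G (y w) (S w) (T w)) u
  = tr_metric G (y u) (tr_conn G y S u v) (T u)
    + tr_metric G (y u) (S u) (tr_conn G y T u v).
Proof.
move=> [sS1 /smooth_row sS2 sS3] [sT1 /smooth_row sT2 sT3] Ou.
have uGy w : O w -> G (y w) \in unitmx by move=> /OU /uG.
have sGy := smooth_mx_comp oO OU sG sy.
have sK := smooth_inv oO sGy uGy.
have sTt := smooth_mx_tr oO sT2.
have sSK := smooth_mxM oO sS2 sK.
have sm := smooth_mxM oO sSK sTt.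
under eq_fun do rewrite tr_metricE.
rewrite (derive_add _ (smoothD oO (smoothM oO sS1 sT3) (smoothM oO sS3 sT1)) (sm 0 0)) //.
rewrite (derive_add _ (smoothM oO sS1 sT3) (smoothM oO sS3 sT1)) //.
rewrite (derive_mul _ sS1 sT3) // (derive_mul _ sS3 sT1) //.
have := derive_matM oO v sSK sTt Ou.
rewrite (derive_matM oO v sS2 sK Ou) derive_mat_tr => /matrixP /(_ 0 0).
rewrite derive_matE => ->.
rewrite (derive_inv_metric_along oU sG symG uG oO OU sy) //.
rewrite !tr_metricE !tr_connE /=.
have uu := uG (OU Ou); have ss := symG (OU Ou).
apply: tr_metric_leibniz_alg => //; first exact: mulmxV.
  exact: mulVmx.
by rewrite trmx_inv ss.
Qed.

End TractorMetric.

Section ScaleTractor.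
Context {R : realType} {n : nat}.
Variables (U : set 'rV[R]_n) (G : 'rV[R]_n -> 'M[R]_n) (s : 'rV[R]_n -> R).
Hypotheses (oU : open U) (sG : smooth_mx U G)
  (symG : forall x, U x -> (G x)^T = G x) (uG : forall x, U x -> G x \in unitmx)
  (ss : smooth_on U s).

Definition scale_rho G s x : R := (@scale_tractor R n G s x).2.

Lemma smooth_grad : smooth_mx U (grad s).
Proof.
move=> i a; apply: smooth_ext (smooth_derive (basis_vec a) ss) => // x _.
by rewrite mxE.
Qed.

Lemma smooth_scale_tractor : tr_smooth U (scale_tractor G s).
Proof.
split=> //; first by move=> b; exact: smooth_grad.
apply: smoothN => //; apply: smoothM (smooth_cst _ _) _ => //; apply: smoothD => //.
  apply: smooth_sum => // a; apply: smooth_sum => // b; apply: smoothM => //.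
    exact: smooth_inv.
  apply: smoothB => //; first by apply: smooth_derive; exact: smooth_grad.
  apply: smooth_sum => // c; apply: smoothM => //; last exact: smooth_grad.
  exact: smooth_christoffel.
by apply: smoothM => //; exact: smooth_schouten_trace.
Qed.

Lemma smooth_scale_rho : smooth_on U (scale_rho G s).
Proof. by have [] := smooth_scale_tractor. Qed.

End ScaleTractor.

Section Identity.
Context {R : realType} {n : nat}.

Lemma derive_coord (x v : 'rV[R]_n) i a : 'D_v (fun x : 'rV[R]_n => x i a) x = v i a.
Proof.
have -> : (fun x : 'rV[R]_n => x i a) = (fun x : 'rV[R]_n => x 0 a).
  by rewrite ord1.
rewrite -(@derive_row R n _ id) ?derive_id ?ord1 // => b.
exact: differentiable_coord.
Qed.

Lemma smooth_mx_id (U : set 'rV[R]_n) : open U -> smooth_mx U (fun x : 'rV[R]_n => x).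
Proof.
move=> oU i a [|k]; first by move=> x _; exact: coord_continuous.
split=> [x _|v]; first exact: differentiable_coord.
by apply: class_C_ext (class_C_cst k U (v i a)) => // x _; rewrite derive_coord.
Qed.

Lemma derive_mat_id (x v : 'rV[R]_n) : 'd_v (fun x : 'rV[R]_n => x) x = v.
Proof. by apply/matrixP => i a; rewrite derive_matE derive_coord. Qed.

Lemma conn_along_id (G : 'rV[R]_n -> 'M[R]_n) a x :
  conn_along G (fun x : 'rV[R]_n => x) (basis_vec a) x = conn_mx G a x.
Proof.
rewrite /conn_along derive_mat_id (bigD1 a) //= big1 ?addr0 => [|b ba].
  by rewrite mxE !eqxx scale1r.
by rewrite mxE (negPf ba) andbF scale0r.
Qed.

End Identity.

(** * Almost Einstein scales *)

Section AlmostEinstein.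
Context {R : realType} {n : nat}.
Variables (U : set 'rV[R]_n) (G : 'rV[R]_n -> 'M[R]_n) (s : 'rV[R]_n -> R)
  (f : 'I_n -> 'rV[R]_n -> tractor R n).
Hypotheses (oU : open U) (sG : smooth_mx U G)
  (symG : forall x, U x -> (G x)^T = G x) (uG : forall x, U x -> G x \in unitmx)
  (ss : smooth_on U s) (sf : forall a, tr_smooth U (f a))
  (parI : forall x a, U x ->
     tr_conn G id (scale_tractor G s) x (basis_vec a) = s x ^+ 2 *: f a x).

Let om := grad s.
Let rho := scale_rho G s.
Let C := conn_mx G.
Let P := schouten_mx G.
Let K x := invmx (G x).

Lemma derive_grad x a : U x -> 'd_(basis_vec a) om x
  = om x *m (C a x)^T - rho x *: row a (G x) - s x *: row a (P x)
    + s x ^+ 2 *: (f a x).1.2.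
Proof.
move=> Ux; have := parI a Ux.
rewrite tr_connE conn_along_id derive_mat_id -!rowE.
move=> /(congr1 (fun S => S.1.2)) /= <-.
rewrite -/(om) -/(rho x) -/(C a x) -/(P x).
by apply/rowP => b; rewrite !entryE -[- (n%:R^-1 * _)]/(rho x); ring.
Qed.

Lemma derive_scale_rho x a : U x -> pd a rho x
  = (row a (P x) *m K x *m (om x)^T) 0 0 + s x ^+ 2 * (f a x).2.
Proof.
move=> Ux; have := parI a Ux.
rewrite tr_connE conn_along_id derive_mat_id -!rowE.
move=> /(congr1 (fun S => S.2)) /= E.
by rewrite -[s x ^+ 2 * _]/(s x ^+ 2 *: (f a x).2) -E addrC subrK.
Qed.

Lemma derive_grad_zero x a : U x -> s x = 0 ->
  'd_(basis_vec a) om x = om x *m (C a x)^T - rho x *: row a (G x).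
Proof. by move=> Ux s0; rewrite derive_grad // s0 expr0n !scale0r subr0 addr0. Qed.

Lemma derive_scale_rho_zero x a : U x -> s x = 0 ->
  pd a rho x = (row a (P x) *m K x *m (om x)^T) 0 0.
Proof. by move=> Ux s0; rewrite derive_scale_rho // s0 expr0n mul0r addr0. Qed.

Lemma gradE x a : pd a s x = om x 0 a. Proof. by rewrite mxE. Qed.

Lemma derive_row_mx p q (M : 'rV[R]_n -> 'M[R]_(p, q)) i x v :
  'd_v (fun y => row i (M y)) x = row i ('d_v M x).
Proof. by apply/matrixP => k l; rewrite derive_matE mxE derive_matE; under eq_fun do rewrite mxE. Qed.

Lemma smooth_row_mx p q (M : 'rV[R]_n -> 'M[R]_(p, q)) i :
  smooth_mx U M -> smooth_mx U (fun y => row i (M y)).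
Proof. by move=> sM k l; apply: smooth_ext (sM i l) => // y _; rewrite mxE. Qed.

(** At a zero of [s], the term [s *: P] of [derive_grad] contributes the gradient times [P], and the
    error term contributes nothing. *)
Lemma derive2_grad_zero x a c : U x -> s x = 0 ->
  'd_(basis_vec c) ('d_(basis_vec a) om) x
  = (om x *m (C c x)^T - rho x *: row c (G x)) *m (C a x)^T
    + om x *m ('d_(basis_vec c) (C a) x)^T
    - (pd c rho x *: row a (G x)
       + rho x *: row a (C c x *m G x + G x *m (C c x)^T))
    - om x 0 c *: row a (P x).
Proof.
move=> Ux s0; have sC b : smooth_mx U (C b) by exact: smooth_conn.
have sP : smooth_mx U P by exact: smooth_schouten_mx.
have srho : smooth_on U rho by exact: smooth_scale_rho.
have som : smooth_mx U om by exact: smooth_grad.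
have sf2 : smooth_mx U (fun y => (f a y).1.2) by apply: smooth_row; have [] := sf a.
have s1 := smooth_mxM oU som (smooth_mx_tr oU (sC a)).
have s2 := smooth_mxZ oU srho (smooth_row_mx a sG).
have s3 := smooth_mxZ oU ss (smooth_row_mx a sP).
have s4 := smooth_mxZ oU (smoothX 2 oU ss) sf2.
rewrite (derive_mat_ext oU _ (fun y Uy => derive_grad a Uy) Ux).
have s12 := smooth_mxD oU s1 (smooth_mxN oU s2).
have s123 := smooth_mxD oU s12 (smooth_mxN oU s3).
rewrite (derive_matD _ s123 s4) // (derive_matD _ s12 (smooth_mxN oU s3)) //.
rewrite (derive_matD _ s1 (smooth_mxN oU s2)) // (derive_matN _ s2) // (derive_matN _ s3) //.
rewrite (derive_matM oU _ som (smooth_mx_tr oU (sC a)) Ux) derive_mat_tr.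
rewrite (derive_matZ _ srho (smooth_row_mx a sG)) // derive_row_mx.
rewrite (derive_matZ _ ss (smooth_row_mx a sP)) // derive_row_mx.
rewrite (derive_matZ _ (smoothX 2 oU ss) sf2) //.
rewrite (derive_metric oU symG uG) // (derive_grad_zero c Ux s0).
(* The second order of vanishing enters here. *)
have -> : 'D_(basis_vec c) (fun y => s y ^+ 2) x = 0.
  by under eq_fun do rewrite expr2; rewrite (derive_mul _ ss ss) // s0 mulr0 mul0r addr0.
by rewrite s0 expr0n !scale0r !addr0 -(gradE x c).
Qed.

(* Equivalently, the Weyl tensor annihilates the gradient along the zero locus. *)
Lemma grad_curv_zero x a c : U x -> s x = 0 ->
  om x *m (curv_mx G c a x)^T
  = pd c rho x *: row a (G x) - pd a rho x *: row c (G x)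
    + om x 0 c *: row a (P x) - om x 0 a *: row c (P x).
Proof.
move=> Ux s0; have E := derive_mat_sym oU (basis_vec c) (basis_vec a) (smooth_grad oU ss) Ux.
have H := etrans (esym (derive2_grad_zero a c Ux s0)) (etrans E (derive2_grad_zero c a Ux s0)).
(* Torsion-freeness: this part of the derivative of the metric is symmetric in [a] and [c] and drops
   out of the antisymmetrised equation. *)
have T : row a (C c x *m G x) = row c (C a x *m G x).
  apply/rowP => b; rewrite !row_entry !mxE; apply: eq_bigr => e _; rewrite !conn_mx_entry.
  by rewrite (christoffelC oU symG _ _ _ Ux).
move: H; rewrite /curv_mx -/C !(trmxD, trmxN) !trmx_mul.
rewrite !(linearD (row a)) !(linearD (row c)) /= T !row_mul.
move: ('d_(basis_vec c) (C a) x) ('d_(basis_vec a) (C c) x) (C a x) (C c x) (om x)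
  (rho x) (pd c rho x) (pd a rho x) (om x 0 a) (om x 0 c) (P x) (G x).
move=> D1 D2 Ca Cc w r pc pa oa oc PP GG H.
rewrite !(mulmxDl, mulmxDr, mulNmx, mulmxN, mulmxA) -!scalemxAl in H *.
apply/rowP => b; move/rowP: H => /(_ b); rewrite !entryE.
move: ((w *m D1^T) 0 b) ((w *m D2^T) 0 b) ((w *m Ca^T *m Cc^T) 0 b)
  ((w *m Cc^T *m Ca^T) 0 b) ((row a GG *m Cc^T) 0 b) ((row c GG *m Ca^T) 0 b).
move: ((row c Ca *m GG) 0 b) ((row a GG) 0 b) ((row c GG) 0 b) ((row a PP) 0 b) ((row c PP) 0 b).
move=> t1 t2 t3 t4 t5 t6 t7 t8 t9 t10 t11 H.
by lra.
Qed.

(** The derivative of I^2 = 2 s rho + |ds|^2 vanishes at zeros of [s], where [I] is parallel. This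
    expresses [rho] through the scalar |ds|^2 and ds, which gives its behaviour under changes of
    chart. *)
Lemma derive_grad_norm_zero x a : U x -> s x = 0 ->
  pd a (fun y => (om y *m K y *m (om y)^T) 0 0) x = - (2 * rho x * om x 0 a).
Proof.
move=> Ux s0; have sI := smooth_scale_tractor oU sG uG ss.
have som : smooth_mx U om by exact: smooth_grad.
have srho : smooth_on U rho by exact: smooth_scale_rho.
have := derive_tr_metric oU sG symG uG oU (fun u Uu => Uu) (smooth_mx_id oU) (basis_vec a) sI sI Ux.
rewrite parI // s0 expr0n scale0r tr_metricE [in X in _ = X]tr_metricE /=.
rewrite !(mulr0, mul0r, add0r, mul0mx, trmx0, mulmx0) !mxE !addr0.
have sK := smooth_inv oU sG uG.
have sN := smooth_mxM oU (smooth_mxM oU som sK) (smooth_mx_tr oU som).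
under eq_fun do rewrite tr_metricE /=.
rewrite (derive_add _ (smoothD oU (smoothM oU ss srho) (smoothM oU srho ss)) (sN 0 0)) //.
rewrite (derive_add _ (smoothM oU ss srho) (smoothM oU srho ss)) //.
rewrite (derive_mul _ ss srho) // (derive_mul _ srho ss) // s0 !(mulr0, mul0r).
rewrite -/(pd a s x) gradE => H.
by apply/eqP; rewrite -subr_eq0 -[X in _ == X]H; apply/eqP; rewrite /pd; ring.
Qed.

End AlmostEinstein.

(** * The tractor connection and the scale tractor along a map *)

Section AlongMap.
Context {R : realType} {n : nat} {V : normedModType R}.
Variables (U : set 'rV[R]_n) (G : 'rV[R]_n -> 'M[R]_n) (O : set V) (x : V -> 'rV[R]_n).
Hypotheses (OU : forall u, O u -> U (x u)) (sx : smooth_mx O x).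

Lemma tr_conn_along (T : 'rV[R]_n -> tractor R n) u v : tr_smooth U T -> O u ->
  tr_conn G x (fun w => T (x w)) u v
  = \sum_a ('d_v x u) 0 a *: tr_conn G id T (x u) (basis_vec a).
Proof.
move=> [sT1 /smooth_row sT2 sT3] Ou; have Ux := OU Ou.
have dx a := smooth_diff (sx 0 a) Ou.
rewrite tr_connE (derive_comp v (smooth_diff sT1 Ux) dx) (derive_comp v (smooth_diff sT3 Ux) dx).
rewrite (derive_along OU sx v sT2 Ou).
under [in RHS]eq_bigr do rewrite tr_connE conn_along_id derive_mat_id -!rowE.
set t := (T (x u)).1.1; set mu := (T (x u)).1.2; set r := (T (x u)).2.
have P1 (F : 'I_n -> tractor R n) : (\sum_a F a).1.1 = \sum_a (F a).1.1.
  by elim/big_ind2: _ => // ? ? ? ? <- <-.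
have P2 (F : 'I_n -> tractor R n) : (\sum_a F a).1.2 = \sum_a (F a).1.2.
  by elim/big_ind2: _ => // ? ? ? ? <- <-.
have P3 (F : 'I_n -> tractor R n) : (\sum_a F a).2 = \sum_a (F a).2.
  by elim/big_ind2: _ => // ? ? ? ? <- <-.
rewrite [RHS]surjective_pairing [X in _ = (X, _)]surjective_pairing P1 P2 P3 /=.
have Dx a : 'D_v (fun z => x z 0 a) u = ('d_v x u) 0 a by rewrite derive_matE.
congr (_, _, _).
- rewrite mxE -sumrB; apply: eq_bigr => a _; rewrite Dx -mulrBr; congr (_ * (_ - _)).
  by rewrite !mxE.
- rewrite /conn_along raddf_sum mulmx_sumr.
  rewrite (mulmx_sum_row _ (G (x u))) (mulmx_sum_row _ (schouten_mx G (x u))) !scaler_sumr.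
  rewrite -sumrB -!big_split; apply: eq_bigr => a _ /=.
  rewrite trmxZ -scalemxAr !scalerDr scalerN; apply/rowP => b; rewrite !entryE; ring.
- rewrite -!mulmxA mxE -sumrB; apply: eq_bigr => a _; rewrite Dx -mulrBr; congr (_ * (_ - _)).
  by rewrite -!row_mul row_entry mulmxA.
Qed.

End AlongMap.

Section ParallelScale.
Context {R : realType} {n : nat} {V : normedModType R}.
Variables (U : set 'rV[R]_n) (G : 'rV[R]_n -> 'M[R]_n) (s : 'rV[R]_n -> R)
  (f : 'I_n -> 'rV[R]_n -> tractor R n).
Hypotheses (oU : open U) (sG : smooth_mx U G)
  (symG : forall x, U x -> (G x)^T = G x) (uG : forall x, U x -> G x \in unitmx)
  (ss : smooth_on U s)
  (parI : forall x a, U x ->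
     tr_conn G id (scale_tractor G s) x (basis_vec a) = s x ^+ 2 *: f a x).
Variables (O : set V) (x : V -> 'rV[R]_n).
Hypotheses (oO : open O) (OU : forall u, O u -> U (x u)) (sx : smooth_mx O x).

Lemma tr_conn_scale_zero u v : O u -> s (x u) = 0 ->
  tr_conn G x (fun w => scale_tractor G s (x w)) u v = 0.
Proof.
move=> Ou s0; rewrite (tr_conn_along G OU sx v (smooth_scale_tractor oU sG uG ss) Ou).
by rewrite big1 // => a _; rewrite parI ?s0 ?expr0n ?scale0r ?scaler0 //; exact: OU.
Qed.

(** The other Leibniz term contains the derivative of [I], which is 0 here. Both the preservation of
    the orthogonal of [I] and the constancy of the pairing along parallel sections come from
    this. *)
Lemma derive_scale_pairing (S : V -> tractor R n) u v :
  tr_smooth O S -> O u -> s (x u) = 0 ->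
  'D_v (fun w => tr_metric G (x w) (S w) (scale_tractor G s (x w))) u
  = tr_metric G (x u) (tr_conn G x S u v) (scale_tractor G s (x u)).
Proof.
move=> sS Ou s0.
have sI : tr_smooth O (fun w => scale_tractor G s (x w)).
  have [s1 s2 s3] := smooth_scale_tractor oU sG uG ss.
  by split=> [|b|]; [exact: smooth_comp oO OU s1 (sx 0)|exact: smooth_comp oO OU (s2 b) (sx 0)
    |exact: smooth_comp oO OU s3 (sx 0)].
rewrite (derive_tr_metric oU sG symG uG oO OU sx v sS sI Ou) (tr_conn_scale_zero v Ou s0).
by rewrite [X in _ + X]tr_metricE /= !(mulr0, add0r) trmx0 mulmx0 mxE addr0.
Qed.

End ParallelScale.

Lemma mx0E (R : realType) p q i j : (0 : 'M[R]_(p, q)) i j = 0.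
Proof. exact: mxE. Qed.

(** * Matrix algebra behind the Gauss equation *)

Section GaussAlgebra.
Context {R : realType} {m : nat}.
Implicit Types (G K : 'M[R]_(1 + m)) (J : 'M[R]_(m, 1 + m)) (h : 'M[R]_m) (w : 'rV[R]_(1 + m)).

(** In the frame [B] of the normal vector [w *m K] followed by the tangent rows [J], the Gram matrix
    is block diagonal with inverse [D], as [eps] is its own inverse. A one-sided inverse of a square
    matrix is two-sided, so [G *m B^T *m D *m B = 1], that is, [K = B^T *m D *m B]. *)
Lemma tangent_normal_decomposition G K J h w (eps : R) :
  G *m K = 1%:M -> G^T = G -> J *m G *m J^T = h -> h \in unitmx ->
  w *m J^T = 0 -> (w *m K *m w^T) 0 0 = eps -> eps * eps = 1 -> K^T = K ->
  J^T *m invmx h *m J + eps *: ((w *m K)^T *m (w *m K)) = K.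
Proof.
move=> GK sG JGJ uh wJ ww ee sK; have KG := mulmx1C GK.
have wwM : w *m K *m w^T = eps%:M by rewrite [LHS]mx11_scalar ww.
pose B : 'M[R]_(1 + m) := col_mx (w *m K) J.
pose D : 'M[R]_(1 + m) := block_mx eps%:M 0 0 (invmx h).
have E1 : J *m w^T = 0 by rewrite -(trmxK (J *m w^T)) trmx_mul trmxK wJ trmx0.
have BGB : B *m G *m B^T *m D = 1%:M.
  rewrite /B /D tr_col_mx mul_col_mx mul_col_row mulmx_block !mulmx0 !addr0 !add0r.
  rewrite trmx_mul sK !mulmxA -(mulmxA w K G) KG mulmx1 wJ !mul0mx.
  rewrite -(mulmxA J G K) GK mulmx1 E1 mul0mx wwM -scalar_mxM ee JGJ mulmxV //.
  by rewrite -scalar_mx_block.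
rewrite -!mulmxA in BGB; have := mulmx1C BGB; rewrite -!mulmxA => GBDB.
have KE : K *m (G *m (B^T *m (D *m B))) = K by rewrite GBDB mulmx1.
rewrite mulmxA KG mul1mx in KE; apply: (etrans _ KE).
rewrite /B /D mul_block_col !mul0mx addr0 add0r.
by rewrite tr_col_mx mul_row_col mul_scalar_mx -scalemxAr addrC.
Qed.

(** The hypothesis is the equality of mixed second derivatives of [J] with the Gauss formula
    substituted: [C] and [E] are the induced and ambient connections, [D] and [F] their derivatives,
    [t] stands for eps rho and [r] for rho. Multiplying by [W] is projection to the tangent space
    and kills the terms that end in [nu]. *)
Lemma gauss_curvature_alg n (J : 'M[R]_(n, m)) (Dlk Dkl Ck Cl : 'M[R]_n)
    (Flk Fkl Ek El : 'M[R]_m) (hk hl dlk dkl : 'cV[R]_n) (nu Jk Jl : 'rV[R]_m)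
    (W : 'M[R]_(m, n)) (t tk tl r : R) :
  J *m W = 1%:M -> nu *m W = 0 ->
  (Dlk *m J + Ck *m (Cl *m J - J *m El + t *: (hl *m nu)))
  - ((Cl *m J - J *m El + t *: (hl *m nu)) *m Ek + J *m Flk)
  + (tl *: (hk *m nu) + t *: (dlk *m nu + hk *m (- (nu *m El) - r *: Jl)))
  = (Dkl *m J + Cl *m (Ck *m J - J *m Ek + t *: (hk *m nu)))
  - ((Ck *m J - J *m Ek + t *: (hk *m nu)) *m El + J *m Fkl)
  + (tk *: (hl *m nu) + t *: (dkl *m nu + hl *m (- (nu *m Ek) - r *: Jk))) ->
  Dlk - Dkl + Ck *m Cl - Cl *m Ck
  = J *m (Flk - Fkl + Ek *m El - El *m Ek) *m W
    + (t * r) *: (hk *m (Jl *m W) - hl *m (Jk *m W)).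
Proof.
move=> JW nW /(congr1 (mulmx^~ W)).
rewrite !(mulmxDl, mulmxDr, mulNmx, mulmxN) -!(scalemxAl, scalemxAr).
rewrite !(mulmxDl, mulmxDr, mulNmx, mulmxN) -!(scalemxAl, scalemxAr).
rewrite -!mulmxA nW JW !(mulmx0, mulmx1, mulmxN, oppr0, scaler0, addr0, add0r).
rewrite !mulmxA => H.
apply/matrixP => i j; move/matrixP: H => /(_ i j); rewrite !entryE.
move: ((Ck *m Cl) i j) ((Cl *m Ck) i j) ((Ck *m J *m El *m W) i j) ((Cl *m J *m Ek *m W) i j)
  ((J *m Ek *m El *m W) i j) ((J *m El *m Ek *m W) i j) ((J *m Flk *m W) i j) ((J *m Fkl *m W) i j)
  ((hk *m nu *m El *m W) i j) ((hl *m nu *m Ek *m W) i j) ((hk *m Jl *m W) i j) ((hl *m Jk *m W) i j).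
move=> a1 a2 a3 a4 a5 a6 a7 a8 a9 a10 a11 a12 H.
move/eqP: H; rewrite -subr_eq0 => /eqP H; apply/eqP; rewrite -subr_eq0 -H; apply/eqP.
by ring.
Qed.

(** Koszul's argument: an array symmetric in its first two indices is recovered from its
    symmetrisation in the last two. Here [D] is the derivative of the induced metric. *)
Lemma koszul_of_symmetric n (Z : 'I_n -> 'M[R]_(n, m)) (G : 'M[R]_m) (W : 'M[R]_(m, n))
    (D : 'I_n -> 'I_n -> 'I_n -> R) :
  (forall k l, row l (Z k) = row k (Z l)) ->
  (forall i j l, D i j l = (Z i *m G *m W) j l + (Z i *m G *m W) l j) ->
  forall k b e, D k e b + D b e k - D e k b = 2 * (Z k *m G *m W) b e.
Proof.
move=> Zs DE k b e.
have Qs i j l : (Z i *m G *m W) j l = (Z j *m G *m W) i l.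
  by rewrite -(row_entry j) -(row_entry i) !row_mul Zs.
by rewrite !DE (Qs e k b) (Qs b e k) (Qs e b k) (Qs b k e); ring.
Qed.

(** [W *m J] is the projection [1 - eps *: (w^T *m nu)] along the normal, so a curvature trace over
    tangent directions is the full trace minus the part with a normal pair. *)
Lemma ricci_trace_alg n (J : 'M[R]_(n, m)) (G K : 'M[R]_m) (H : 'M[R]_n)
    (nu w : 'rV[R]_m) (eps : R) (cv : 'I_m -> 'I_m -> 'M[R]_m) j k :
  J^T *m H *m J + eps *: (nu^T *m nu) = K -> G *m K = 1%:M -> G *m nu^T = w^T ->
  \sum_l (J *m (\sum_a \sum_b (J l b * J k a) *: cv b a) *m (G *m J^T *m H)) j l
  = \sum_a J k a * \sum_b (J *m cv b a) j b
    - eps * \sum_a \sum_b J k a * nu 0 b * (w *m (cv b a)^T *m J^T) 0 j.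
Proof.
move=> sK GK Gnu; set W := G *m J^T *m H.
have WJ : W *m J = 1%:M - eps *: (w^T *m nu).
  by rewrite /W -!mulmxA (mulmxA J^T) -[J^T *m H *m J](addrK (eps *: (nu^T *m nu))) sK
     mulmxBr GK -scalemxAr mulmxA Gnu.
have e b a : \sum_l J l b * (J *m cv b a *m W) j l
    = (J *m cv b a) j b - eps * nu 0 b * (w *m (cv b a)^T *m J^T) 0 j.
  transitivity ((J *m cv b a *m (W *m J)) j b).
    by rewrite mulmxA [RHS]mxE; apply: eq_bigr => l _; rewrite mulrC.
  rewrite WJ mulmxBr mulmx1 -scalemxAr !entryE; congr (_ - _).
  rewrite mulmxA [X in eps * X]mxE big_ord1 -mulrA; congr (_ * _); rewrite mulrC; congr (_ * _).
  by rewrite -[w *m _ *m _]trmxK [RHS]mxE !trmx_mul !trmxK mulmxA.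
transitivity (\sum_a J k a * \sum_b \sum_l J l b * (J *m cv b a *m W) j l).
  transitivity (\sum_l \sum_a \sum_b J k a * (J l b * (J *m cv b a *m W) j l)).
    apply: eq_bigr => l _; rewrite mulmx_sumr mulmx_suml summxE; apply: eq_bigr => a _.
    rewrite mulmx_sumr mulmx_suml summxE; apply: eq_bigr => b _.
    by rewrite -scalemxAr -scalemxAl entryE; ring.
  rewrite exchange_big; apply: eq_bigr => a _ /=.
  by rewrite exchange_big mulr_sumr; apply: eq_bigr => b _ /=; rewrite mulr_sumr.
rewrite mulr_sumr -sumrB; apply: eq_bigr => a _.
rewrite [X in J k a * X](eq_bigr _ (fun b _ => e b a)) !mulr_sumr -sumrB.
by apply: eq_bigr => b _; ring.
Qed.

Lemma sandwichE n p q (A : 'M[R]_(n, m)) (M : 'M[R]_(m, p)) (B : 'M[R]_(q, p)) j k :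
  (A *m M *m B^T) j k = \sum_a B k a * \sum_c A j c * M c a.
Proof. by rewrite mxE; apply: eq_bigr => a _; rewrite !mxE mulrC. Qed.

Lemma dot_sumE n q (H : 'M[R]_(n, q)) (M : 'M[R]_(n, q)) :
  \sum_a \sum_b H a b * M a b = \tr (H *m M^T).
Proof.
by apply: eq_bigr => a _; rewrite mxE; apply: eq_bigr => b _; rewrite mxE.
Qed.

(** Contraction of the right-hand side of [grad_curv_zero] with one normal and two tangent vectors;
    [p] stands for d rho. In use [J *m w^T] and [nu *m G *m J^T] are 0, and two terms survive. *)
Lemma weyl_trace_alg n (J : 'M[R]_(n, m)) (G P : 'M[R]_m) (p w nu : 'rV[R]_m) k j :
  \sum_a \sum_b J k a * nu 0 b *
    ((p 0 b *: row a G - p 0 a *: row b G + w 0 b *: row a P - w 0 a *: row b P) *m J^T) 0 j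
  = (nu *m p^T) 0 0 * (J *m G *m J^T) k j - (J *m p^T) k 0 * (nu *m G *m J^T) 0 j
    + (nu *m w^T) 0 0 * (J *m P *m J^T) k j - (J *m w^T) k 0 * (nu *m P *m J^T) 0 j.
Proof.
have X (F : 'M[R]_m) (v v' : 'rV[R]_m) (A B : 'rV[R]_m) :
    \sum_a \sum_b (A 0 a * B 0 b * (v 0 b * (F *m J^T) a j))
    = (B *m v^T) 0 0 * (A *m F *m J^T) 0 j.
  rewrite -mulmxA [X in _ = X * _]mxE [X in _ = _ * X]mxE mulr_sumr.
  apply: eq_bigr => a _; rewrite mulr_suml; apply: eq_bigr => b _.
  by rewrite !mxE; ring.
have Y (F : 'M[R]_m) (v : 'rV[R]_m) (A B : 'rV[R]_m) :
    \sum_a \sum_b (A 0 a * B 0 b * (v 0 a * (F *m J^T) b j))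
    = (A *m v^T) 0 0 * (B *m F *m J^T) 0 j.
  rewrite exchange_big -(X F v v B A) /=; apply: eq_bigr => a _; apply: eq_bigr => b _; ring.
have r1 (F : 'M[R]_m) : (J *m F *m J^T) k j = (row k J *m F *m J^T) 0 j.
  by rewrite -!row_mul row_entry.
have r2 (v : 'rV[R]_m) : (J *m v^T) k 0 = (row k J *m v^T) 0 0.
  by rewrite -row_mul row_entry.
rewrite !r1 !r2 -(X G p p) -(Y G p) -(X P w w) -(Y P w) -!sumrB -!big_split -!sumrB.
apply: eq_bigr => a _ /=; rewrite -!sumrB -!big_split -!sumrB; apply: eq_bigr => b _ /=.
rewrite !mulmxBl mulmxDl mulmxBl -!scalemxAl !entryE -!row_mul !row_entry; ring.
Qed.

End GaussAlgebra.

(** * Immersions into the zero locus *)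

Section Immersion.
Context {R : realType} {m : nat}.
Variables (U : set 'rV[R]_m.+1) (G : 'rV[R]_m.+1 -> 'M[R]_m.+1) (s : 'rV[R]_m.+1 -> R)
  (f : 'I_m.+1 -> 'rV[R]_m.+1 -> tractor R m.+1).
Hypotheses (oU : open U) (sG : smooth_mx U G)
  (symG : forall x, U x -> (G x)^T = G x) (uG : forall x, U x -> G x \in unitmx)
  (ss : smooth_on U s) (sf : forall a, tr_smooth U (f a))
  (parI : forall x a, U x ->
     tr_conn G id (scale_tractor G s) x (basis_vec a) = s x ^+ 2 *: f a x).
Variables (O : set 'rV[R]_m) (y : 'rV[R]_m -> 'rV[R]_m.+1) (h : 'rV[R]_m -> 'M[R]_m)
  (eps : R).
Hypotheses (oO : open O) (OU : forall u, O u -> U (y u)) (sy : smooth_mx O y)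
  (sy0 : forall u, O u -> s (y u) = 0) (ee : eps * eps = 1).

Definition diff_mx (z : 'rV[R]_m -> 'rV[R]_m.+1) (u : 'rV[R]_m) : 'M[R]_(m, m.+1) :=
  \matrix_(k, a) pd k (fun w => z w 0 a) u.

Let J := diff_mx y.
Let om := grad s.
Let rho := scale_rho G s.
Let K x := invmx (G x).
(** The gradient with raised index: a normal vector, unlike the conormal called [nu] in the
    theorem. *)
Let nu u := om (y u) *m K (y u).
Let E k u := conn_along G y (basis_vec k) u.

Hypotheses (norm_om : forall u, O u -> (om (y u) *m K (y u) *m (om (y u))^T) 0 0 = eps)
  (hE : forall u, O u -> h u = J u *m G (y u) *m (J u)^T)
  (uh : forall u, O u -> h u \in unitmx).

Lemma smooth_diff_mx : smooth_mx O J.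
Proof.
move=> k a; apply: smooth_ext (smooth_derive (basis_vec k) (sy 0 a)) => // u _.
by rewrite mxE.
Qed.

Lemma row_diff_mx k u : 'd_(basis_vec k) y u = row k (J u).
Proof. by apply/rowP => a; rewrite derive_matE !mxE. Qed.

Lemma grad_tangent u : O u -> om (y u) *m (J u)^T = 0.
Proof.
move=> Ou; apply/rowP => k; rewrite mxE [RHS]mxE.
have : 'D_(basis_vec k) (fun w => s (y w)) u = 0.
  rewrite (eq_derive (U := O) (g := fun=> 0)) ?derive_cst //.
have ds := smooth_diff ss (OU Ou).
rewrite (derive_comp (basis_vec k) ds) => [H|a]; last exact: smooth_diff (sy 0 a) Ou.
by apply: (etrans _ H); apply: eq_bigr => a _; rewrite !mxE mulrC.
Qed.

Lemma tangent_grad u : O u -> J u *m (om (y u))^T = 0.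
Proof. by move=> Ou; rewrite -(trmxK (J u *m _)) trmx_mul trmxK grad_tangent // trmx0. Qed.

Lemma inv_mulG x : U x -> K x *m G x = 1%:M.
Proof. by move=> /uG; exact: mulVmx. Qed.

Lemma mulG_inv x : U x -> G x *m K x = 1%:M.
Proof. by move=> /uG; exact: mulmxV. Qed.

Lemma inv_sym x : U x -> (K x)^T = K x.
Proof. by move=> Ux; rewrite /K trmx_inv symG. Qed.

Lemma nuG u : O u -> nu u *m G (y u) = om (y u).
Proof. by move=> Ou; rewrite /nu -mulmxA inv_mulG ?mulmx1 //; exact: OU. Qed.

Lemma Gnu u : O u -> G (y u) *m (nu u)^T = (om (y u))^T.
Proof.
move=> Ou; rewrite -[G _]symG; last exact: OU.
by rewrite -trmx_mul nuG.
Qed.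

Lemma om_nu u : O u -> (om (y u) *m (nu u)^T) 0 0 = eps.
Proof.
move=> Ou; rewrite -(norm_om Ou) /nu trmx_mul inv_sym ?mulmxA //; exact: OU.
Qed.

Lemma inv_metric_split u : O u ->
  (J u)^T *m invmx (h u) *m J u + eps *: ((nu u)^T *m nu u) = K (y u).
Proof.
move=> Ou; have Uy := OU Ou.
apply: (@tangent_normal_decomposition R m (G (y u)) (K (y u)) (J u) (h u) (om (y u))).
- exact: mulG_inv.
- exact: symG.
- by rewrite hE.
- exact: uh.
- exact: grad_tangent.
- exact: norm_om.
- exact: ee.
- exact: inv_sym.
Qed.

Lemma induced_sym u : O u -> (h u)^T = h u.
Proof.
by move=> Ou; rewrite hE // !trmx_mul trmxK symG ?mulmxA //; exact: OU.
Qed.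

Lemma smooth_induced : smooth_mx O h.
Proof.
have sGy := smooth_mx_comp oO OU sG sy.
have := smooth_mxM oO (smooth_mxM oO smooth_diff_mx sGy) (smooth_mx_tr oO smooth_diff_mx).
by apply: smooth_mx_ext => // u Ou; rewrite hE.
Qed.

Lemma derive_grad_along u k : O u -> 'd_(basis_vec k) (fun u => om (y u)) u
  = om (y u) *m (E k u)^T - rho (y u) *: (row k (J u) *m G (y u)).
Proof.
move=> Ou; have Uy := OU Ou; have som := smooth_grad oU ss.
rewrite (derive_along OU sy (basis_vec k) som Ou) /E /conn_along.
rewrite row_diff_mx raddf_sum mulmx_sumr.
have -> : row k (J u) *m G (y u) = \sum_a row k (J u) 0 a *: row a (G (y u)).
  by rewrite mulmx_sum_row.
rewrite scaler_sumr -sumrB; apply: eq_bigr => a _ /=.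
rewrite (derive_grad_zero parI a Uy (sy0 Ou)) trmxZ.
by rewrite scalerBr -scalemxAr !scalerA [rho _ * _]mulrC.
Qed.

(** Weingarten's formula. The tangential part is a multiple of the tangent vector itself, which is
    umbilicity. *)
Lemma derive_nu u k : O u -> 'd_(basis_vec k) nu u
  = - (nu u *m E k u) - rho (y u) *: row k (J u).
Proof.
move=> Ou; have Uy := OU Ou; have som := smooth_mx_comp oO OU (smooth_grad oU ss) sy.
have sK := smooth_mx_comp oO OU (smooth_inv oU sG uG) sy.
rewrite (derive_matM oO (basis_vec k) som sK Ou) derive_grad_along //.
rewrite (derive_inv_metric_along oU sG symG uG oO OU sy (basis_vec k) Ou).
rewrite -/(E k u) -/(K (y u)) /nu.
rewrite mulmxBl -scalemxAl -(mulmxA (row k (J u))) mulG_inv // mulmx1.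
rewrite mulmxN mulmxDr !mulmxA; apply/rowP => b; rewrite !entryE; ring.
Qed.

(** The covariant Hessian of the immersion: row [l] is the ambient covariant derivative of the
    [l]-th tangent vector in direction [k]. *)
Let Z k u := 'd_(basis_vec k) J u + J u *m E k u.

Lemma derive_diff_mx_sym k l u : O u ->
  row l ('d_(basis_vec k) J u) = row k ('d_(basis_vec l) J u).
Proof.
move=> Ou; apply/rowP => a; rewrite !row_entry !derive_matE.
have e i j : (fun w => J w i j) = 'D_(basis_vec i) (fun w => y w 0 j).
  by apply/funext => w; rewrite mxE.
by rewrite (e l a) (e k a); exact: derive_derive_sym (sy 0 a) Ou.
Qed.

Lemma conn_along_sym k l u : O u -> row l (J u) *m E k u = row k (J u) *m E l u.
Proof.
move=> Ou; rewrite /E /conn_along !row_diff_mx !mulmx_sumr.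
apply/rowP => b; rewrite !summxE.
have e i j : \sum_c (row i (J u) *m (row j (J u) 0 c *: conn_mx G c (y u))) 0 b
    = \sum_c \sum_d row j (J u) 0 c * row i (J u) 0 d * christoffel G b c d (y u).
  apply: eq_bigr => c _; rewrite -scalemxAr scalemxE [X in _ * X]mxE mulr_sumr.
  by apply: eq_bigr => d _; rewrite conn_mx_entry mulrA.
rewrite (e l k) (e k l) exchange_big; apply: eq_bigr => c _; apply: eq_bigr => d _.
rewrite /= (christoffelC oU symG b d c (OU Ou)).
by rewrite [row _ _ 0 c * _]mulrC.
Qed.

Lemma second_deriv_sym k l u : O u -> row l (Z k u) = row k (Z l u).
Proof.
move=> Ou; rewrite /Z !rowD !row_mul; apply: (f_equal2 (fun p q => p + q)).
  exact: derive_diff_mx_sym.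
exact: conn_along_sym.
Qed.

Lemma derive_induced k u : O u -> 'd_(basis_vec k) h u
  = Z k u *m G (y u) *m (J u)^T + (Z k u *m G (y u) *m (J u)^T)^T.
Proof.
move=> Ou; have Uy := OU Ou; have sGy := smooth_mx_comp oO OU sG sy.
have sJ := smooth_diff_mx; have sJt := smooth_mx_tr oO sJ; have sJG := smooth_mxM oO sJ sGy.
rewrite (derive_mat_ext oO _ hE Ou) (derive_matM oO _ sJG sJt Ou) derive_mat_tr.
rewrite (derive_matM oO _ sJ sGy Ou).
rewrite (derive_metric_along oU sG symG uG OU sy (basis_vec k) Ou) -/(E k u) /Z.
move: ('d_(basis_vec k) J u) (E k u) (J u) (G (y u)) (symG Uy) => D e j g sg.
rewrite !(trmx_mul, trmxD, trmxK) sg !(mulmxDl, mulmxDr, mulmxA).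
by rewrite -!addrA; do 2 congr (_ + _); rewrite addrC.
Qed.

Lemma koszul_induced k u : O u ->
  koszul_mx h k u = 2 *: (Z k u *m G (y u) *m (J u)^T).
Proof.
move=> Ou; apply/matrixP => b e; rewrite mxE scalemxE.
apply: (@koszul_of_symmetric _ _ _ (fun i => Z i u) (G (y u)) (J u)^T
  (fun i j l => pd i (fun w => h w j l) u)).
  by move=> i j; exact: second_deriv_sym.
move=> i j l; have /matrixP /(_ j l) := derive_induced i Ou.
by rewrite derive_matE addmxE [_^T j l]mxE.
Qed.

(* Decompose the covariant Hessian of the immersion along the tangent frame
   and the normal: the normal part is the second fundamental form, which is
   pure trace because the Hessian of the scale is. *)
Lemma gauss_formula k u : O u -> 'd_(basis_vec k) J u
  = conn_mx h k u *m J u - J u *m E k u + (eps * rho (y u)) *: (col k (h u) *m nu u).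
Proof.
move=> Ou; have Uy := OU Ou.
have -> : 'd_(basis_vec k) J u = Z k u - J u *m E k u by rewrite /Z addrK.
(* The normal part, from differentiating [J *m om^T = 0]. *)
have Zom : Z k u *m (om (y u))^T = rho (y u) *: col k (h u).
  have sJ := smooth_diff_mx; have somt := smooth_mx_tr oO (smooth_mx_comp oO OU (smooth_grad oU ss) sy).
  have := derive_matM oO (basis_vec k) sJ somt Ou.
  rewrite (derive_mat_ext (B := fun=> 0) oO _ tangent_grad Ou) derive_mat_cst derive_mat_tr.
  rewrite derive_grad_along // /Z trmxD trmxN trmxZ !trmx_mul trmxK symG //.
  rewrite mulmxDl -(mulmxA (J u)) mulmxBr => /esym H.
  have -> : col k (h u) = J u *m (G (y u) *m (row k (J u))^T).
    by rewrite hE // !mulmxA colE -mulmxA -colE tr_row.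
  move: H; rewrite -scalemxAr !mulmxA => /eqP; rewrite addrA subr_eq0 => /eqP ->.
  by [].
(* Inserting [G *m K] and splitting [K] separates the tangential from the normal part; Koszul's
   formula identifies the former with the induced connection. *)
have ZE : Z k u = Z k u *m G (y u) *m K (y u) by rewrite -mulmxA mulG_inv // mulmx1.
rewrite {1}ZE -(inv_metric_split Ou) mulmxDr.
rewrite -scalemxAr !mulmxA -(mulmxA (Z k u) (G _) (nu u)^T) Gnu // Zom -!scalemxAl scalerA.
rewrite conn_mxE koszul_induced // -!scalemxAl [2^-1 *: _]scalerA mulVf ?pnatr_eq0 // scale1r.
by rewrite trmx_inv induced_sym // addrAC.
Qed.

Lemma smooth_conn_along k : smooth_mx O (E k).
Proof.
apply: smooth_mx_sum => // a; apply: smooth_mxZ => //.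
  by have := smooth_derive_mat (basis_vec k) sy; apply.
exact: smooth_mx_comp oO OU (smooth_conn oU sG uG a) sy.
Qed.

Lemma derive_conn_along k l u : O u -> 'd_(basis_vec l) (E k) u
  = \sum_a ('d_(basis_vec l) J u) k a *: conn_mx G a (y u)
    + \sum_a \sum_b (J u k a * J u l b) *: 'd_(basis_vec b) (conn_mx G a) (y u).
Proof.
move=> Ou; have sC a := smooth_mx_comp oO OU (smooth_conn oU sG uG a) sy.
have EE : E k = fun w => \sum_a J w k a *: conn_mx G a (y w).
  apply/funext => w; rewrite /E /conn_along row_diff_mx.
  by apply: eq_bigr => a _; rewrite row_entry.
rewrite EE (derive_mat_sum (U := O)) //; last first.
  by move=> a; apply: smooth_mxZ => //; exact: smooth_diff_mx.
rewrite -big_split; apply: eq_bigr => a _ /=.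
rewrite (derive_matZ _ (smooth_diff_mx k a) (sC a) Ou) derive_matE.
congr (_ + _); rewrite (derive_along OU sy (basis_vec l) (smooth_conn oU sG uG a) Ou).
rewrite row_diff_mx scaler_sumr; apply: eq_bigr => b _.
by rewrite row_entry scalerA.
Qed.

(** The curvature of a pulled-back connection is the pull-back of the curvature, since the second
    derivatives of the map are symmetric and cancel. *)
Lemma curvature_along k l u : O u ->
  'd_(basis_vec l) (E k) u - 'd_(basis_vec k) (E l) u + E k u *m E l u - E l u *m E k u
  = \sum_a \sum_b (J u l b * J u k a) *: curv_mx G b a (y u).
Proof.
move=> Ou; rewrite (derive_conn_along k l Ou) (derive_conn_along l k Ou).
have -> : \sum_a ('d_(basis_vec l) J u) k a *: conn_mx G a (y u)
    = \sum_a ('d_(basis_vec k) J u) l a *: conn_mx G a (y u).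
  apply: eq_bigr => a _; congr (_ *: _).
  by rewrite -(row_entry k ('d_(basis_vec l) J u)) derive_diff_mx_sym // row_entry.
have EE i : E i u = \sum_a J u i a *: conn_mx G a (y u).
  rewrite /E /conn_along row_diff_mx.
  by apply: eq_bigr => a _; rewrite row_entry.
have EM i j : E i u *m E j u
    = \sum_a \sum_b (J u i a * J u j b) *: (conn_mx G a (y u) *m conn_mx G b (y u)).
  rewrite !EE mulmx_suml; apply: eq_bigr => a _; rewrite mulmx_sumr.
  by apply: eq_bigr => b _; rewrite -scalemxAl -scalemxAr scalerA.
have X (F : 'I_m.+1 -> 'I_m.+1 -> 'M[R]_m.+1) :
    \sum_a \sum_b F a b = \sum_a \sum_b F b a by exact: exchange_big.
rewrite !EM opprD addrACA subrr add0r.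
rewrite (X (fun a b => (J u l a * J u k b) *: 'd_(basis_vec b) (conn_mx G a) (y u))).
rewrite (X (fun a b => (J u l a * J u k b) *: (conn_mx G a (y u) *m conn_mx G b (y u)))).
rewrite -sumrB -big_split -sumrB; apply: eq_bigr => a _ /=.
rewrite -sumrB -big_split -sumrB; apply: eq_bigr => b _ /=.
rewrite /curv_mx [J u k a * _]mulrC.
by rewrite -!scalerBr -!scalerDr -scalerBr.
Qed.

(** Sends an ambient vector, written as a row, to the coefficients of its tangential part in the
    frame [J]. *)
Let W u := G (y u) *m (J u)^T *m invmx (h u).

Lemma tangent_W u : O u -> J u *m W u = 1%:M.
Proof. by move=> Ou; rewrite /W !mulmxA -hE // mulmxV // uh. Qed.

Lemma nu_W u : O u -> nu u *m W u = 0.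
Proof. by move=> Ou; rewrite /W !mulmxA -/(nu u) nuG // grad_tangent // mul0mx. Qed.

(** The Gauss equation. By umbilicity the terms quadratic in the second fundamental form have the
    shape of constant curvature eps rho^2. *)
Lemma curvature_induced k l u : O u -> curv_mx h l k u
  = J u *m (\sum_a \sum_b (J u l b * J u k a) *: curv_mx G b a (y u)) *m W u
    + (eps * rho (y u) * rho (y u)) *:
      (col k (h u) *m (row l (J u) *m W u) - col l (h u) *m (row k (J u) *m W u)).
Proof.
move=> Ou; rewrite -(curvature_along k l Ou).
have sh := smooth_induced; have sJ := smooth_diff_mx; have sE := smooth_conn_along.
have sC i := smooth_conn oO sh uh i.
have snu : smooth_mx O nu.
  have som := smooth_mx_comp oO OU (smooth_grad oU ss) sy.
  by have := smooth_mxM oO som (smooth_mx_comp oO OU (smooth_inv oU sG uG) sy); apply.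
have srho : smooth_on O (fun u => rho (y u)).
  exact: smooth_comp oO OU (smooth_scale_rho oU sG uG ss) (sy 0).
have st : smooth_on O (fun u => eps * rho (y u)) := smoothM oO (smooth_cst O eps) srho.
have sc i : smooth_mx O (fun u => col i (h u)).
  by move=> a b; apply: smooth_ext (sh a i) => // w _; rewrite mxE.
have D i j : 'd_(basis_vec j) ('d_(basis_vec i) J) u
    = ('d_(basis_vec j) (conn_mx h i) u *m J u
       + conn_mx h i u *m (conn_mx h j u *m J u - J u *m E j u
                           + (eps * rho (y u)) *: (col j (h u) *m nu u)))
    - ((conn_mx h j u *m J u - J u *m E j u + (eps * rho (y u)) *: (col j (h u) *m nu u))
       *m E i u + J u *m 'd_(basis_vec j) (E i) u)
    + ('D_(basis_vec j) (fun u => eps * rho (y u)) u *: (col i (h u) *m nu u)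
       + (eps * rho (y u)) *: ('d_(basis_vec j) (fun u => col i (h u)) u *m nu u
           + col i (h u) *m (- (nu u *m E j u) - rho (y u) *: row j (J u)))).
  have s1 := smooth_mxM oO (sC i) sJ; have s2 := smooth_mxM oO sJ (sE i).
  have s3 := smooth_mxM oO (sc i) snu; have s4 := smooth_mxZ oO st s3.
  have s12 := smooth_mxD oO s1 (smooth_mxN oO s2).
  rewrite (derive_mat_ext oO _ (fun w Ow => gauss_formula i Ow) Ou).
  rewrite (derive_matD _ s12 s4 Ou) (derive_matD _ s1 (smooth_mxN oO s2) Ou).
  rewrite (derive_matN _ s2 Ou) (derive_matM oO _ (sC i) sJ Ou) (derive_matM oO _ sJ (sE i) Ou).
  rewrite (derive_matZ _ st s3 Ou) (derive_matM oO _ (sc i) snu Ou).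
  by rewrite (derive_nu j Ou) (gauss_formula j Ou).
have := derive_mat_sym oO (basis_vec l) (basis_vec k) sJ Ou.
move=> S; have {S} := etrans (esym (D k l)) (etrans S (D l k)).
exact: gauss_curvature_alg (tangent_W Ou) (nu_W Ou).
Qed.

Let P u := schouten_mx G (y u).
Let q u := (nu u *m P u *m (nu u)^T) 0 0.
Let tau u := schouten_trace G (y u).

Lemma nu_derive_rho u : O u -> (nu u *m (\row_a pd a rho (y u))^T) 0 0 = q u.
Proof.
move=> Ou; have Uy := OU Ou; rewrite /q -mulmxA [LHS]mxE [RHS]mxE.
apply: eq_bigr => a _; congr (_ * _); rewrite 2!mxE.
rewrite (derive_scale_rho_zero parI a Uy (sy0 Ou)) -/(P u) -mulmxA.
by rewrite /nu trmx_mul inv_sym // -row_mul row_entry.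
Qed.

(** The ambient dimension being [m.+1], the full trace gives [(m - 1) P + tau h]. The normal part is
    evaluated by [grad_curv_zero] and removes [P + eps q h], where [q] is both P(n, n) and the
    normal derivative of [rho]. The quadratic terms give [m - 1] times eps rho^2 h. *)
Lemma ricci_induced j k u : (2 < m.+1)%N -> O u -> ricci h j k u
  = (m%:R - 2) * (J u *m P u *m (J u)^T) j k
    + (tau u - eps * q u + eps * rho (y u) ^+ 2 * (m%:R - 1)) * h u j k.
Proof.
move=> m2 Ou; have Uy := OU Ou; rewrite (ricci_curv oO induced_sym) //.
have JW := tangent_W Ou.
rewrite (eq_bigr _ (fun l _ => congr1 (fun M : 'M[R]_m => M j l) (curvature_induced k l Ou))).
under eq_bigr do rewrite !entryE.
rewrite big_split /= -mulr_sumr sumrB.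
have -> : \sum_l (col k (h u) *m (row l (J u) *m W u)) j l = m%:R * h u j k.
  transitivity (\sum_(l < m) h u j k); last by rewrite sumr_const card_ord mulr_natl.
  by apply: eq_bigr => l _; rewrite -row_mul JW mxE big_ord1 !mxE eqxx mulr1.
have -> : \sum_l (col l (h u) *m (row k (J u) *m W u)) j l = h u j k.
  rewrite (bigD1 k) //= big1 ?addr0 => [|l lk];
    rewrite -row_mul JW mxE big_ord1 !mxE ?eqxx ?mulr1 //.
  by rewrite eq_sym (negPf lk) mulr0.
rewrite (ricci_trace_alg _ _ _ (inv_metric_split Ou) (mulG_inv Uy) (Gnu Ou)).
have -> : \sum_a J u k a * \sum_b (J u *m curv_mx G b a (y u)) j b
    = (m.+1%:R - 2) * (J u *m P u *m (J u)^T) j k + tau u * h u j k.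
  rewrite hE // !sandwichE !mulr_sumr -big_split; apply: eq_bigr => a _ /=.
  rewrite mulrCA [tau u * _]mulrCA -mulrDr; congr (_ * _).
  rewrite !mulr_sumr -big_split /=.
  transitivity (\sum_c J u j c * ricci G c a (y u)).
    under eq_bigr do rewrite mxE.
    rewrite exchange_big; apply: eq_bigr => c _; rewrite (ricci_curv oU symG) // mulr_sumr.
    by [].
  apply: eq_bigr => c _; rewrite schoutenE // schouten_mx_entry /tau.
  by move: (schouten _ _ _ _) (schouten_trace _ _) => S t; ring.
pose p : 'rV[R]_m.+1 := \row_a pd a rho (y u).
have -> : \sum_a \sum_b J u k a * nu u 0 b
      * (om (y u) *m (curv_mx G b a (y u))^T *m (J u)^T) 0 j
    = q u * h u j k + eps * (J u *m P u *m (J u)^T) j k.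
  have wE a b : om (y u) *m (curv_mx G b a (y u))^T
      = p 0 b *: row a (G (y u)) - p 0 a *: row b (G (y u))
        + om (y u) 0 b *: row a (P u) - om (y u) 0 a *: row b (P u).
    by rewrite (grad_curv_zero oU sG symG uG ss sf parI a b Uy (sy0 Ou)) ![p _ _]mxE.
  under eq_bigr => a _ do under eq_bigr => b _ do rewrite wE.
  rewrite weyl_trace_alg nu_derive_rho // tangent_grad // nuG // grad_tangent // -hE //.
  rewrite !mx0E !(mul0r, mulr0, subr0).
  have -> : (nu u *m (om (y u))^T) 0 0 = eps by exact: norm_om.
  have -> : h u k j = h u j k by rewrite -[in LHS]induced_sym // mxE.
  have -> : (J u *m P u *m (J u)^T) k j = (J u *m P u *m (J u)^T) j k.
    have sP : (P u)^T = P u.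
      by apply/matrixP => a b; rewrite mxE !schouten_mx_entry (schoutenC oU sG symG uG).
    by rewrite -[in LHS](trmxK (J u *m P u *m _)) mxE !trmx_mul trmxK sP mulmxA.
  by [].
have e2 : eps * eps = 1 by [].
rewrite mulrDr [eps * (eps * _)]mulrA e2 mul1r -natr1.
move: (J u *m _ *m _) (h u) => A B; ring.
Qed.

(* The tracefree part of the Gauss equation: umbilicity and the vanishing of
   the normal components of the Weyl tensor make the Fialkow tensor pure trace. *)
Lemma schouten_induced j k u : (2 < m)%N -> O u -> schouten h j k u
  = (J u *m P u *m (J u)^T) j k + eps * 2^-1 * rho (y u) ^+ 2 * h u j k.
Proof.
move=> m2 Ou; have Uy := OU Ou; have m3 : (2 < m.+1)%N by exact: ltnW.
have sP : (P u)^T = P u.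
  by apply/matrixP => a b; rewrite mxE !schouten_mx_entry (schoutenC oU sG symG uG).
(* The trace over tangent directions is the full trace [tau] less the normal entry. *)
have trP : \sum_j \sum_k invmx (h u) j k * (J u *m P u *m (J u)^T) j k = tau u - eps * q u.
  rewrite dot_sumE !trmx_mul trmxK sP !mulmxA (mxtrace_mulC _ (J u)^T) !mulmxA.
  have -> : (J u)^T *m invmx (h u) *m J u = K (y u) - eps *: ((nu u)^T *m nu u).
    by rewrite -(inv_metric_split Ou) addrK.
  rewrite mulmxBl raddfB /=; congr (_ - _).
    rewrite /tau schouten_traceE //; [|exact: symG|exact: uG].
    rewrite -[in LHS]sP -dot_sumE; apply: eq_bigr => a _; apply: eq_bigr => b _.
    by rewrite schouten_mx_entry.
  by rewrite -scalemxAl mxtraceZ -mulmxA mxtrace_mulC trace_mx11 /q.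
have trh : \sum_j \sum_k invmx (h u) j k * h u j k = m%:R.
  by rewrite dot_sumE induced_sym // mulVmx ?uh // mxtrace1.
(* Solving for the Schouten tensor divides by [m - 2]: the hypersurface must have dimension at least
   3. *)
have nz2 : (m%:R - 2 : R) != 0.
  by rewrite subr_eq0 -[2]/(2%:R) eqr_nat gtn_eqF.
have nz1 : (m%:R - 1 : R) != 0.
  by rewrite subr_eq0 -[1]/(1%:R) eqr_nat gtn_eqF // ltnW.
pose k0 := tau u - eps * q u + eps * rho (y u) ^+ 2 * (m%:R - 1).
have scal : scalar_curv h u = (m%:R - 2) * (tau u - eps * q u) + k0 * m%:R.
  rewrite -trP -[X in _ = _ + _ * X]trh /scalar_curv !mulr_sumr -big_split; apply: eq_bigr => a _ /=.
  rewrite !mulr_sumr -big_split; apply: eq_bigr => b _ /=.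
  rewrite ricci_induced // -/k0 /inv_metric.
  by move: (invmx (h u)) (h u) (J u *m _ *m _) => A B C; ring.
rewrite /schouten ricci_induced // /schouten_trace scal -/k0 /k0.
move: (J u *m _ *m _) (h u) (tau u) (q u) (rho (y u)) => A B t r p.
by field; rewrite nz1 nz2.
Qed.

(** * Restriction of tractors to the hypersurface and its inverse *)

Definition tr_restrict u (V : tractor R m.+1) : tractor R m :=
  (V.1.1, V.1.2 *m (J u)^T, V.2 + eps * 2^-1 * rho (y u) ^+ 2 * V.1.1).

(** Inverse of [tr_restrict] on the orthogonal of [I]. The middle slot is raised with [h], pushed
    forward by [J] and lowered with [G]; the multiple of [om] is forced by the orthogonality sigma
    rho + mu(n) = 0, because om(n) = eps. *)
Definition tr_lift u (W : tractor R m) : tractor R m.+1 :=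
  (W.1.1,
   W.1.2 *m invmx (h u) *m J u *m G (y u) - (eps * rho (y u) * W.1.1) *: om (y u),
   W.2 - eps * 2^-1 * rho (y u) ^+ 2 * W.1.1).

Lemma tr_metric_scale_zero u V : O u ->
  tr_metric G (y u) V (scale_tractor G s (y u))
  = V.1.1 * rho (y u) + (V.1.2 *m (nu u)^T) 0 0.
Proof.
move=> Ou; rewrite tr_metricE [(scale_tractor _ _ _).1.1]/= sy0 // mulr0 addr0.
by rewrite /nu trmx_mul inv_sym ?mulmxA //; exact: OU.
Qed.

Lemma tr_lift_perp u S : O u ->
  tr_metric G (y u) (tr_lift u S) (scale_tractor G s (y u)) = 0.
Proof.
move=> Ou; rewrite tr_metric_scale_zero // /tr_lift /= mulmxBl -!mulmxA Gnu // tangent_grad //.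
rewrite !mulmx0 sub0r -scalemxAl !entryE om_nu //.
by rewrite -[eps * _ * _ * _]mulrC !mulrA ee mul1r mulrC subrr.
Qed.

Lemma tr_liftK u S : O u -> tr_restrict u (tr_lift u S) = S.
Proof.
move=> Ou; rewrite /tr_restrict /tr_lift /= mulmxBl -scalemxAl grad_tangent // scaler0 subr0.
rewrite -!mulmxA [J u *m (_ *m _)]mulmxA -hE // mulVmx ?uh // mulmx1 subrK.
by case: S => [[]].
Qed.

(** The difference of the middle slots vanishes on tangent vectors by restriction and on the normal
    by orthogonality, hence on everything by [inv_metric_split]. *)
Lemma tr_restrict_inj u V V' : O u ->
  tr_metric G (y u) V (scale_tractor G s (y u)) = 0 ->
  tr_metric G (y u) V' (scale_tractor G s (y u)) = 0 ->
  tr_restrict u V = tr_restrict u V' -> V = V'.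
Proof.
move=> Ou; rewrite !tr_metric_scale_zero //.
case: V V' => [[a b] c] [[a' b'] c'] /= p p' [ea bJ ec].
rewrite -ea in p' ec *; move/addIr: ec => <-.
congr (_, _, _); apply/eqP; rewrite -subr_eq0; apply/eqP.
have Uy := OU Ou.
rewrite -[LHS]mulmx1 -(mulmx1C (mulG_inv Uy)) mulmxA -(inv_metric_split Ou) mulmxDr.
rewrite -scalemxAr !mulmxA !(mulmxBl b b') bJ subrr !mul0mx add0r.
have -> : b *m (nu u)^T - b' *m (nu u)^T = 0.
  rewrite [LHS]mx11_scalar !entryE.
  have -> : (b *m (nu u)^T) 0 0 = (b' *m (nu u)^T) 0 0.
    by apply: (addrI (a * rho (y u))); rewrite p p'.
  by rewrite subrr raddf0.
by rewrite !mul0mx scaler0 mul0mx.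
Qed.

Section AlongCurve.
Context {V : normedModType R}.
Variables (A : set V) (c : V -> 'rV[R]_m).
Hypotheses (oA : open A) (AO : forall t, A t -> O (c t)) (sc : smooth_mx A c).

Let x t := y (c t).

Lemma smooth_along : smooth_mx A x.
Proof. exact: smooth_mx_comp oA AO sy sc. Qed.

Lemma velocity_along t v : A t -> 'd_v x t = 'd_v c t *m J (c t).
Proof.
move=> At; rewrite (derive_along AO sc v sy At) mulmx_sum_row.
by apply: eq_bigr => k _; rewrite row_diff_mx.
Qed.

Lemma conn_along_velocity t v : A t ->
  conn_along G x v t = \sum_k ('d_v c t) 0 k *: E k (c t).
Proof.
move=> At; rewrite /conn_along velocity_along // /E /conn_along.
transitivity (\sum_a \sum_k (('d_v c t) 0 k * J (c t) k a) *: conn_mx G a (x t)).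
  by apply: eq_bigr => a _; rewrite mxE scaler_suml.
rewrite exchange_big; apply: eq_bigr => k _; rewrite scaler_sumr row_diff_mx.
by apply: eq_bigr => a _; rewrite row_entry scalerA.
Qed.

Lemma derive_diff_along t v : A t -> 'd_v (fun w => J (c w)) t
  = conn_along h c v t *m J (c t) - J (c t) *m conn_along G x v t
    + (eps * rho (x t)) *: ((h (c t) *m ('d_v c t)^T) *m nu (c t)).
Proof.
move=> At; have Oc := AO At.
rewrite (derive_along AO sc v smooth_diff_mx At) conn_along_velocity //.
rewrite {1}/conn_along mulmx_suml mulmx_sumr -sumrB.
have -> : h (c t) *m ('d_v c t)^T = \sum_k ('d_v c t) 0 k *: col k (h (c t)).
  apply/colP => i; rewrite mxE summxE; apply: eq_bigr => k _.
  by rewrite !mxE mulrC.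
rewrite mulmx_suml scaler_sumr -big_split; apply: eq_bigr => k _ /=.
rewrite gauss_formula // !scalerDr scalerN -!scalemxAl -scalemxAr !scalerA.
by rewrite [_ * ('d_v c t) 0 k]mulrC.
Qed.

Lemma derive_rho_along t v : A t ->
  'D_v (fun w => rho (x w)) t = ('d_v x t *m P (c t) *m (nu (c t))^T) 0 0.
Proof.
move=> At; have Oc := AO At; have Ux := OU Oc.
have sr : smooth_on U rho := smooth_scale_rho oU sG uG ss.
rewrite (derive_comp v (smooth_diff sr Ux)) => [|a]; last exact: smooth_diff (smooth_along 0 a) At.
rewrite -mulmxA [RHS]mxE; apply: eq_bigr => a _; rewrite derive_matE; congr (_ * _).
rewrite (derive_scale_rho_zero parI a Ux (sy0 Oc)) -/(P (c t)) -mulmxA.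
by rewrite /nu trmx_mul inv_sym // -row_mul row_entry.
Qed.

Lemma schouten_mx_induced u : (2 < m)%N -> O u -> schouten_mx h u
  = J u *m P u *m (J u)^T + (eps * 2^-1 * rho (y u) ^+ 2) *: h u.
Proof.
by move=> m2 Ou; apply/matrixP => j k; rewrite schouten_mx_entry schouten_induced // !entryE.
Qed.

(** In the middle slot the three multiples of eps rho^2 sigma, with coefficients 1/2, 1/2 and -1,
    cancel. In the bottom slot the intrinsic Schouten term sees only the tangential part of [mu];
    the missing normal part is eps rho sigma P(X, n), which the derivative of the shift supplies
    since d rho = P(ds). *)
Lemma tr_conn_restrict (S : V -> tractor R m.+1) t v : (2 < m)%N ->
  tr_smooth A S -> A t ->
  tr_metric G (x t) (S t) (scale_tractor G s (x t)) = 0 ->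
  tr_conn h c (fun w => tr_restrict (c w) (S w)) t v
  = tr_restrict (c t) (tr_conn G x S t v).
Proof.
move=> m2 [sS1 /smooth_row sS2 sS3] At; have Oc := AO At; have Ux := OU Oc.
rewrite tr_metric_scale_zero // => perp.
have sr : smooth_on A (fun w => rho (x w)).
  exact: smooth_comp oA (fun w Aw => OU (AO Aw)) (smooth_scale_rho oU sG uG ss) (smooth_along 0).
have sJ := smooth_mx_comp oA AO smooth_diff_mx sc.
have sJt := smooth_mx_tr oA sJ.
have st := smoothM oA (smooth_cst A (eps * 2^-1)) (smoothX 2 oA sr).
rewrite !tr_connE /tr_restrict /=.
rewrite (derive_matM oA v sS2 sJt At) derive_mat_tr (derive_diff_along v At).
rewrite (derive_add v sS3 (smoothM oA st sS1) At) (derive_mul v st sS1 At).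
have -> : 'D_v (fun w => eps * 2^-1 * rho (x w) ^+ 2) t
    = eps * rho (x t) * 'D_v (fun w => rho (x w)) t.
  rewrite (derive_mul v (smooth_cst A _) (smoothX 2 oA sr) At) derive_cst mul0r add0r.
  under eq_fun do rewrite expr2.
  by rewrite (derive_mul v sr sr At); field.
rewrite (derive_rho_along v At) (schouten_mx_induced m2 Oc) -/(P (c t)) -/(x t).
have iK := inv_metric_split Oc; have HH := mulmxV (uh Oc); have HE := hE Oc.
rewrite velocity_along //.
move: iK HH HE; rewrite -/(x t) -/(P (c t)) /=.
set H := h (c t); set X := 'd_v c t; set j := J (c t); set g := G (y (c t)).
set B := conn_along h c v t; set F := conn_along G x v t; set N := nu (c t) in perp *.
set k := K (y (c t)); set p := P (c t); set r := rho (y (c t)) in perp *.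
set mu := (S t).1.2 in perp *; set sg := (S t).1.1 in perp *; set t2 := (S t).2.
set D := derive_mat _ _ _ => iK HH HE; set D1 := 'D_v _ t; set D2 := 'D_v _ t.
have NE : mu *m N^T = (- (sg * r))%:M.
  by rewrite [LHS]mx11_scalar; congr (_%:M); apply/eqP; rewrite -addr_eq0 addrC perp.
have sH : H^T = H by exact: induced_sym.
have kE : invmx g = k by [].
clearbody H X j g B F N k p r mu sg t2 D D1 D2.
congr (_, _, _).
- by congr (_ - _); rewrite trmx_mul trmxK mulmxA.
- rewrite !(trmxD, trmxN, trmxZ) !trmx_mul !trmxK sH.
  rewrite !(mulmxDl, mulmxDr, mulNmx, mulmxN) -!(scalemxAl, scalemxAr) !mulmxA.
  rewrite NE -!mulmxA mul_scalar_mx !mulmxA.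
  rewrite (_ : X *m j *m g *m j^T = X *m H); last by rewrite HE !mulmxA.
  by apply/rowP => b; rewrite !entryE; field.
- have -> : (X *m (j *m p *m j^T + (eps * 2^-1 * r ^+ 2) *: H) *m invmx H *m (mu *m j^T)^T) 0 0
      = (X *m j *m p *m k *m mu^T) 0 0 + eps * (X *m j *m p *m N^T) 0 0 * (sg * r)
        + eps * 2^-1 * r ^+ 2 * (X *m j *m mu^T) 0 0.
    rewrite trmx_mul trmxK mulmxDr !mulmxDl -!(scalemxAl, scalemxAr) !entryE.
    rewrite -(mulmxA X H) HH mulmx1 !mulmxA; congr (_ + _).
    rewrite -(mulmxA _ j^T) -(mulmxA _ (j^T *m _)).
    have -> : j^T *m invmx H *m j = k - eps *: (N^T *m N) by rewrite -iK addrK.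
    rewrite mulmxBr mulmxBl -scalemxAr -scalemxAl !entryE mulmxA -(mulmxA _ N).
    have -> : N *m mu^T = (- (sg * r))%:M.
      by rewrite -[LHS]trmxK trmx_mul trmxK NE tr_scalar_mx.
    rewrite mul_mx_scalar !entryE; ring.
  by rewrite kE; ring.
Qed.

End AlongCurve.

End Immersion.

(** * Straightening a function with nonzero gradient *)

Section Coordinates.
Context {R : realType} {n : nat}.
Implicit Types (x w : 'rV[R]_n).

Lemma coord_le_norm w b : `|w 0 b| <= `|w|.
Proof. by rewrite [leRHS]/Num.Def.normr /= mx_normrE; exact: (le_bigmax _ _ (0, b)). Qed.

Lemma norm_le_coord w e : 0 <= e -> (forall b, `|w 0 b| <= e) -> `|w| <= e.
Proof.
move=> e0 we; rewrite [leLHS]/Num.Def.normr /= mx_normrE (bigmax_le _ e0) // => -[i b] _ /=.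
by rewrite ord1.
Qed.

Lemma ball_coordP x w e : 0 < e ->
  ball x e w <-> forall b, `|w 0 b - x 0 b| < e.
Proof.
move=> e0; split=> [[_ xw] b|xw]; first by have := xw 0 b; rewrite /ball /= distrC.
by split=> // i b; rewrite ord1 /ball /= distrC.
Qed.

End Coordinates.

Lemma near_gt0 (R : realType) (V : normedModType R) (f : V -> R) x :
  {for x, continuous f} -> 0 < f x -> \forall y \near x, 0 < f y.
Proof. by move=> cf f0; apply: (cvgr_gt _ cf). Qed.

Section Straightening.
Context {R : realType} {m : nat}.
Variables (U : set 'rV[R]_m.+1) (s : 'rV[R]_m.+1 -> R) (a : 'I_m.+1) (x0 : 'rV[R]_m.+1).
Hypotheses (oU : open U) (ss : smooth_on U s) (Ux0 : U x0) (pos : 0 < pd a s x0).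

(** Replaces the coordinate [a] by [s], moved to position 0 where slice charts expect the defining
    function. *)
Definition straighten (x : 'rV[R]_m.+1) : 'rV[R]_m.+1 :=
  \row_b (if unlift ord0 b is Some k then x 0 (lift a k) else s x).

(** With [z] fixed, this is the line parallel to axis [a] that contains every preimage of [z];
    inverting [straighten] means solving [s = z 0 ord0] on it. *)
Definition insert_coord (z : 'rV[R]_m.+1) (t : R) : 'rV[R]_m.+1 :=
  \row_b (if unlift a b is Some k then z 0 (lift ord0 k) else t).

Lemma straighten0 x : straighten x 0 ord0 = s x.
Proof. by rewrite mxE unlift_none. Qed.

Lemma straightenS x k : straighten x 0 (lift ord0 k) = x 0 (lift a k).
Proof. by rewrite mxE liftK. Qed.

Lemma insert_coord_at z t : insert_coord z t 0 a = t.
Proof. by rewrite mxE unlift_none. Qed.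

Lemma insert_coord_lift z t k : insert_coord z t 0 (lift a k) = z 0 (lift ord0 k).
Proof. by rewrite mxE liftK. Qed.

Lemma insert_straighten x : insert_coord (straighten x) (x 0 a) = x.
Proof.
apply/rowP => b; case: (unliftP a b) => [k|] ->.
  by rewrite insert_coord_lift straightenS.
by rewrite insert_coord_at.
Qed.

Lemma straighten_insert z t : s (insert_coord z t) = z 0 ord0 ->
  straighten (insert_coord z t) = z.
Proof.
move=> st; apply/rowP => b; case: (unliftP ord0 b) => [k|] ->.
  by rewrite straightenS insert_coord_lift.
by rewrite straighten0.
Qed.

Lemma insert_coord_line z t h :
  insert_coord z (t + h) = insert_coord z t + h *: basis_vec a.
Proof.
apply/rowP => b; rewrite !entryE; case: (unliftP a b) => [k|] ->.
  by rewrite !insert_coord_lift mxE eqxx [lift a k == a]eq_sym (negPf (neq_lift _ _)) mulr0 addr0.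
by rewrite !insert_coord_at mxE !eqxx mulr1.
Qed.

Lemma straighten_box : exists2 d, 0 < d &
  forall x, ball x0 d x -> U x /\ 0 < pd a s x.
Proof.
have cp : {for x0, continuous (pd a s)}.
  by apply: (@smooth_continuous _ _ U) => //; exact: smooth_derive.
have npos : \forall x \near x0, 0 < pd a s x.
  exact: near_gt0 cp pos.
have nU : \forall x \near x0, U x by exact: open_nbhs_nbhs.
have nUp := filterI nU npos.
have [d /= d0 xd] : nbhs_ball x0 (U `&` [set x | 0 < pd a s x]).
  by apply/nbhs_ballP; exact: nUp.
by exists d.
Qed.

Lemma smooth_straighten : smooth_mx U straighten.
Proof.
move=> i b; rewrite ord1; case: (unliftP ord0 b) => [k|] ->.
  apply: smooth_ext (smooth_mx_id oU 0 (lift a k)) => // x _.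
  by rewrite straightenS.
by apply: smooth_ext ss => // x _; rewrite straighten0.
Qed.

Section Box.
Variables (d : R).
Hypotheses (d0 : 0 < d) (box : forall x, ball x0 d x -> U x /\ 0 < pd a s x).
Let B := ball x0 d.

(** Balls of the sup norm are boxes, so the segment stays in [B], where [s] has positive derivative
    along it. *)
Lemma insert_coord_incr z t1 t2 : B (insert_coord z t1) -> B (insert_coord z t2) ->
  t1 < t2 -> s (insert_coord z t1) < s (insert_coord z t2).
Proof.
move=> /(ball_coordP _ _ d0) B1 /(ball_coordP _ _ d0) B2 t12.
have h0 : 0 < t2 - t1 by rewrite subr_gt0.
have Bt h : 0 <= h <= t2 - t1 -> B (insert_coord z t1 + h *: basis_vec a).
  move=> /andP[h0' ht]; apply/(ball_coordP _ _ d0) => b; rewrite -insert_coord_line.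
  have := B1 b; have := B2 b; case: (unliftP a b) => [k|] ->.
    by rewrite !insert_coord_lift.
  by rewrite !insert_coord_at !ltr_norml => /andP[? ?] /andP[? ?]; apply/andP; split; lra.
have [t /andP[t0 tt] E] := mean_value_line h0 (fun h hh => smooth_diff ss (box (Bt h hh)).1).
have E2 : insert_coord z t2 = insert_coord z t1 + (t2 - t1) *: basis_vec a.
  by rewrite -insert_coord_line addrC subrK.
rewrite -subr_gt0 E2 E; apply: mulr_gt0 => //.
have th : 0 <= t <= t2 - t1 by rewrite !ltW.
exact: (box (Bt t th)).2.
Qed.

Lemma straighten_inj x x' : B x -> B x' -> straighten x = straighten x' -> x = x'.
Proof.
move=> Bx Bx' E; rewrite -(insert_straighten x) -(insert_straighten x') -E.
have Bx1 : B (insert_coord (straighten x) (x 0 a)) by rewrite insert_straighten.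
have Bx2 : B (insert_coord (straighten x) (x' 0 a)) by rewrite E insert_straighten.
have sE : s (insert_coord (straighten x) (x 0 a)) = s (insert_coord (straighten x) (x' 0 a)).
  by rewrite insert_straighten E insert_straighten -!straighten0 E.
case: (ltgtP (x 0 a) (x' 0 a)) => [lt|lt|->] //.
  by have := insert_coord_incr Bx1 Bx2 lt; rewrite sE ltxx.
by have := insert_coord_incr Bx2 Bx1 lt; rewrite sE ltxx.
Qed.

Lemma smooth_insert_coord t b :
  smooth_on [set: 'rV[R]_m.+1] (fun z => insert_coord z t 0 b).
Proof.
case: (unliftP a b) => [k|] ->.
  apply: smooth_ext (smooth_mx_id openT 0 (lift ord0 k)) => [|z _]; first exact: openT.
  by rewrite insert_coord_lift.
apply: smooth_ext (smooth_cst _ t) => [|z _]; first exact: openT.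
by rewrite insert_coord_at.
Qed.

(** At the two ends of a short segment through [x1], [s] lies strictly below and above its value at
    [x1]. Both inequalities persist for [z] near [straighten x1], and the intermediate value theorem
    solves [s = z 0 ord0] in between. *)
Lemma straighten_surj x1 e : B x1 -> 0 < e ->
  \forall z \near straighten x1, exists x, [/\ B x, ball x1 e x & straighten x = z].
Proof.
move=> Bx1 e0; have oB : open B by exact: ball_open.
have [r0 /= r00 xr0] : nbhs_ball x1 B by apply/nbhs_ballP; exact: open_nbhs_nbhs.
(* Halving keeps the closed segment, ends included, inside both open balls. *)
pose r := Num.min (r0 / 2) (e / 2).
have r_gt0 : 0 < r by rewrite lt_min !divr_gt0.
have rr0 : r < r0 by rewrite gt_min ltr_pdivrMr // ltr_pMr // ltr1n.
have re : r < e by rewrite gt_min [X in _ || X]ltr_pdivrMr // ltr_pMr // ltr1n orbT.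
pose z1 := straighten x1; pose t1 : R := x1 0 a; rewrite -/z1.
have near_box (z : 'rV[R]_m.+1) (t : R) : (forall k, `|z 0 (lift ord0 k) - z1 0 (lift ord0 k)| < r) ->
    `|t - t1| <= r -> B (insert_coord z t) /\ ball x1 e (insert_coord z t).
  move=> zk tr; have H b : `|insert_coord z t 0 b - x1 0 b| <= r.
    case: (unliftP a b) => [k|] ->; last by rewrite insert_coord_at.
    by rewrite insert_coord_lift -straightenS ltW.
  split; first by apply/xr0/(ball_coordP _ _ r00) => b; exact: le_lt_trans rr0.
  by apply/(ball_coordP _ _ e0) => b; exact: le_lt_trans re.
have z1k : forall k, `|z1 0 (lift ord0 k) - z1 0 (lift ord0 k)| < r.
  by move=> k; rewrite subrr normr0.
have [Bm _] := near_box z1 (t1 - r) z1k ltac:(by rewrite addrAC subrr sub0r normrN gtr0_norm).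
have [Bp _] := near_box z1 (t1 + r) z1k ltac:(by rewrite addrAC subrr add0r gtr0_norm).
have B1 : B (insert_coord z1 t1) by rewrite insert_straighten.
have lo : s (insert_coord z1 (t1 - r)) < s x1.
  rewrite -[in X in _ < X](insert_straighten x1).
  by apply: insert_coord_incr => //; rewrite ltrBlDr ltrDl.
have hi : s x1 < s (insert_coord z1 (t1 + r)).
  rewrite -[in X in X < _](insert_straighten x1).
  by apply: insert_coord_incr => //; rewrite ltrDl.
have cs t : B (insert_coord z1 t) -> {for z1, continuous (fun z => s (insert_coord z t))}.
  move=> Bt; apply: (@continuous_comp _ _ _ (fun z => insert_coord z t) s).
    apply: continuous_row => b.
    by apply: smooth_continuous (smooth_insert_coord t b) _.
  by apply: smooth_continuous ss _; have [] := box Bt.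
have cc b : {for z1, continuous (fun z : 'rV[R]_m.+1 => z 0 b)} by exact: coord_continuous.
have nlo : \forall z \near z1, s (insert_coord z (t1 - r)) < z 0 ord0.
  have cd : {for z1, continuous (fun z : 'rV[R]_m.+1 => z 0 ord0 - s (insert_coord z (t1 - r)))}.
    by apply: continuousB; [exact: cc|exact: cs].
  have := near_gt0 cd; rewrite subr_gt0 straighten0 => /(_ lo).
  by apply: filterS => z; rewrite subr_gt0.
have nhi : \forall z \near z1, (z : 'rV[R]_m.+1) 0 ord0 < s (insert_coord z (t1 + r)).
  have cd : {for z1, continuous (fun z : 'rV[R]_m.+1 => s (insert_coord z (t1 + r)) - z 0 ord0)}.
    by apply: continuousB; [exact: cs|exact: cc].
  have := near_gt0 cd; rewrite subr_gt0 straighten0 => /(_ hi).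
  by apply: filterS => z; rewrite subr_gt0.
have nk : \forall z \near z1, ball z1 r z by exact: nbhsx_ballx.
near=> z.
have zk k : `|z 0 (lift ord0 k) - z1 0 (lift ord0 k)| < r.
  by have : ball z1 r z by [near: z]; move=> /(ball_coordP _ _ r_gt0); exact.
have [t] : exists2 t, t \in `[t1 - r, t1 + r] & s (insert_coord z t) = z 0 ord0.
  apply: IVT.
  - by rewrite lerD2l ge0_cp // ltW.
  - apply: continuous_in_subspaceT => t; rewrite inE /= in_itv /= => tr.
    apply: (@continuous_comp _ _ _ (fun t => insert_coord z t) s).
      apply: continuous_row => b; case: (unliftP a b) => [k|] ->.
        have -> : (fun u : R => insert_coord z u 0 (lift a k)) = cst (z 0 (lift ord0 k)).
          by apply/funext => u; rewrite insert_coord_lift.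
        exact: cvg_cst.
      have -> : (fun u : R => insert_coord z u 0 a) = id.
        by apply/funext => u; rewrite insert_coord_at.
      exact: cvg_id.
    apply: smooth_continuous ss _.
    have [|Bt _] := near_box z t zk; last by have [] := box Bt.
    by rewrite ler_norml; case/andP: tr => ? ?; apply/andP; split; lra.
  - have l : s (insert_coord z (t1 - r)) < z 0 ord0 by near: z.
    have u : z 0 ord0 < s (insert_coord z (t1 + r)) by near: z.
    by rewrite ge_min le_max (ltW l) (ltW u) orbT.
rewrite in_itv /= => tr sz; exists (insert_coord z t).
have [|Bt Et] := near_box z t zk.
  by rewrite ler_norml; case/andP: tr => ? ?; apply/andP; split; lra.
by split=> //; exact: straighten_insert.
Unshelve. all: by end_near.
Qed.

(** [x0] is a junk value off the image of the box; on the image the preimage is unique by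
    [straighten_inj]. *)
Definition unstraighten (z : 'rV[R]_m.+1) : 'rV[R]_m.+1 :=
  xget x0 [set x | ball x0 d x /\ straighten x = z].

Let psi := unstraighten.
Let B' := [set z | exists2 x, B x & straighten x = z].

Lemma unstraightenP z : B' z -> B (psi z) /\ straighten (psi z) = z.
Proof.
move=> [x Bx xz]; rewrite /psi /unstraighten.
by apply: (@xgetPex _ x0 [set x | ball x0 d x /\ straighten x = z]); exists x.
Qed.

Lemma unstraightenK x : B x -> psi (straighten x) = x.
Proof.
move=> Bx; have [By E] : B (psi (straighten x)) /\ straighten (psi (straighten x)) = straighten x.
  by apply: unstraightenP; exists x.
exact: straighten_inj E.
Qed.

Lemma open_straighten_box : open B'.
Proof.
rewrite openE => z [x Bx <-].
have := straighten_surj Bx ltr01; apply: filterS => w [x' [Bx' _ E]].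
by exists x'.
Qed.

Lemma continuous_unstraighten z : B' z -> {for z, continuous psi}.
Proof.
move=> [x Bx <-]; have psix := unstraightenK Bx.
apply: continuous_row => b.
have H : (fun z => psi z 0 b) @ nbhs (straighten x) --> psi (straighten x) 0 b; last exact: H.
rewrite psix; apply/cvgrPdist_lt => e e0; apply: (@filterS _ (nbhs (straighten x)) _ _ _ _ (straighten_surj Bx e0)).
move=> w [x' [Bx' xx' <-]]; rewrite /= (unstraightenK Bx') distrC.
by move/(ball_coordP _ _ e0): xx'; exact.
Qed.

Lemma unstraighten_lift z k : B' z -> psi z 0 (lift a k) = z 0 (lift ord0 k).
Proof. by move=> /unstraightenP[_ {2}<-]; rewrite straightenS. Qed.

Lemma s_unstraighten z : B' z -> s (psi z) = z 0 ord0.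
Proof. by move=> /unstraightenP[_ {2}<-]; rewrite straighten0. Qed.

(** Implicit differentiation: the [a]-component of the displacement for which ds equals [v 0 ord0],
    the other components being those of [v]. *)
Definition unstraighten_diff x (v : 'rV[R]_m.+1) : R :=
  (v 0 ord0 + \sum_k (- pd (lift a k) s x) * v 0 (lift ord0 k)) * (pd a s x)^-1.

Lemma differentiable_unstraighten z : B' z ->
  differentiable (fun z => psi z 0 a) z /\
  forall v, 'D_v (fun z => psi z 0 a) z = unstraighten_diff (psi z) v.
Proof.
move=> B'z; have [Bx xz] := unstraightenP B'z; have [Ux p0] := box Bx.
set x1 := psi z in Bx xz Ux p0 *; set p := pd a s x1 in p0 *.
pose l (b : 'I_m.+1) : R := if unlift ord0 b is Some k then - pd (lift a k) s x1 * p^-1 else p^-1.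
pose L (w : 'rV[R]_m.+1) : R := \sum_b w 0 b * l b.
have LE w : L w = unstraighten_diff x1 w.
  rewrite /L big_ord_recl /l unlift_none /unstraighten_diff mulrDl; congr (_ + _).
  by rewrite mulr_suml; apply: eq_bigr => k _; rewrite liftK -/p; ring.
have Llin : linear L.
  move=> k u v; rewrite /L scaler_sumr -big_split; apply: eq_bigr => b _ /=.
  by rewrite !mxE /GRing.scale /=; ring.
pose LM := GRing.isLinear.Build _ _ _ _ L Llin.
pose LL : {linear 'rV[R]_m.+1 -> R} := HB.pack L LM.
have Lcont : continuous LL.
  move=> w; apply: (@smooth_continuous _ _ [set: 'rV[R]_m.+1] L w) => //.
  apply: smooth_sum => [|b]; first exact: openT.
  apply: smoothM (smooth_cst _ _) => //; first exact: openT.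
  by apply: smooth_mx_id; exact: openT.
pose C := \sum_b `|l b|.
have C0 : 0 <= C by apply: sumr_ge0.
have LC w : `|L w| <= C * `|w|.
  rewrite /L (le_trans (ler_norm_sum _ _ _)) // mulr_suml; apply: ler_sum => b _.
  by rewrite normrM mulrC ler_wpM2l // coord_le_norm.
have ds := smooth_diff ss Ux.
have [] := @eps_differentiable R _ _ (fun z => psi z 0 a) z LL Lcont.
  move=> e e0.
  (* The bound [p / 2] lets the unknown displacement [D] along [a] be absorbed, giving
     [D <= (2 * C + 1) * N] with [N] the norm of [w - z]. Then [N + D <= (2 * C + 2) * N], and the
     second bound yields the error [e * N]. *)
  pose eta := Num.min (p / 2) (e * p / (2 * C + 2)).
  have k0 : 0 < 2 * C + 2 by lra.
  have eta0 : 0 < eta by rewrite lt_min !(divr_gt0, mulr_gt0).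
  have eta1 : eta <= p / 2 by rewrite ge_min lexx.
  have eta2 : eta * (2 * C + 2) <= e * p.
    by rewrite -ler_pdivlMr // ge_min lexx orbT.
  have nB : \forall w \near z, B' w by apply: open_nbhs_nbhs; split=> //; exact: open_straighten_box.
  have nd := continuous_unstraighten B'z (differentiable_eps ds eta0).
  apply: filterS2 nB nd => w B'w /= dsw.
  set x := psi w in dsw *; rewrite -/x1 in dsw *.
  have dsE : 'd s x1 (x - x1) = (x - x1) 0 a * p + \sum_k (x - x1) 0 (lift a k) * pd (lift a k) s x1.
    rewrite -deriveE // derive_pd // (bigD1_ord a) //.
  have E : ((x - x1) 0 a - L (w - z)) * p = 'd s x1 (x - x1) - (s x - s x1).
    rewrite dsE !s_unstraighten // LE /unstraighten_diff -/p mulrBl divfK ?gt_eqF //.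
    have -> : \sum_k (x - x1) 0 (lift a k) * pd (lift a k) s x1
        = - \sum_k - pd (lift a k) s x1 * (w - z) 0 (lift ord0 k).
      rewrite -sumrN; apply: eq_bigr => k _; rewrite !entryE !unstraighten_lift //; ring.
    by rewrite !entryE; ring.
  have xx : `|x - x1| <= `|w - z| + `|(x - x1) 0 a|.
    apply: norm_le_coord => [|b]; first by rewrite addr_ge0.
    case: (unliftP a b) => [k|] ->; last by rewrite lerDr.
    have -> : (x - x1) 0 (lift a k) = (w - z) 0 (lift ord0 k).
      by rewrite !entryE !unstraighten_lift.
    by rewrite ler_wpDr // coord_le_norm.
  have Q : `|(x - x1) 0 a - L (w - z)| * p <= eta * (`|w - z| + `|(x - x1) 0 a|).
    rewrite -[X in _ * X]gtr0_norm // -normrM E distrC.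
    exact: le_trans dsw (ler_wpM2l (ltW eta0) xx).
  have Dl : `|(x - x1) 0 a| <= C * `|w - z| + `|(x - x1) 0 a - L (w - z)|.
    have := ler_normD (L (w - z)) ((x - x1) 0 a - L (w - z)).
    rewrite (addrC (L _)) subrK => h; apply: (le_trans h).
    by apply: lerD => //; exact: LC.
  suff H : `|x 0 a - x1 0 a - L (w - z)| <= e * `|w - z| by exact: H.
  move: Q Dl; rewrite !entryE.
  have N0 := normr_ge0 (w - z); have := normr_ge0 (x 0 a - x1 0 a).
  have := normr_ge0 (x 0 a - x1 0 a - L (w - z)).
  move: `|x 0 a - x1 0 a - L (w - z)| `|x 0 a - x1 0 a| `|w - z| N0 => Q D N N0 Q0 D0 Qp DC.
  have Q2 : Q <= (N + D) / 2.
    rewrite -(ler_pM2r p0); apply: (le_trans Qp).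
    have : eta * (N + D) <= p / 2 * (N + D) by apply: ler_wpM2r => //; rewrite addr_ge0.
    by lra.
  have D2 : D <= (2 * C + 1) * N by nra.
  rewrite -(ler_pM2r p0); apply: (le_trans Qp).
  have : eta * (N + D) <= eta * ((2 * C + 2) * N).
    by rewrite ler_pM2l //; nra.
  by have := ler_wpM2r N0 eta2; lra.
move=> dpsi dE; split=> // v.
by rewrite deriveE // dE -LE.
Qed.

(** Bootstrap: the derivative of [psi] is a rational expression in the partial derivatives of [s] at
    [psi], so class C^j for [psi] gives class C^j for its derivatives. *)
Lemma smooth_unstraighten : smooth_mx B' psi.
Proof.
have oB := open_straighten_box.
have lift_smooth k j : class_C j B' (fun z => psi z 0 (lift a k)).
  have := smooth_mx_id oB 0 (lift ord0 k) j.
  by apply: class_C_ext => // z B'z; rewrite unstraighten_lift.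
suff H j : class_C j B' (fun z => psi z 0 a).
  by move=> i b j; rewrite ord1; case: (unliftP a b) => [k|] ->.
elim: j => [|j IH].
  move=> z /differentiable_unstraighten[dz _]; exact: differentiable_continuous.
have psiU z : B' z -> U (psi z) by move=> /unstraightenP[/box[]].
have Cpsi b : class_C j B' (fun z => psi z 0 b) by case: (unliftP a b) => [k|] ->.
have Cpd b : class_C j B' (fun z => pd b s (psi z)).
  by apply: class_C_comp oB psiU (smooth_derive _ ss j) Cpsi.
split=> [z /differentiable_unstraighten[] //|v].
have : class_C j B' (fun z => unstraighten_diff (psi z) v).
  apply: class_CM => //; last first.
    by apply: class_CV => // z /unstraightenP[/box[_ /lt0r_neq0]].
  apply: class_CD (class_C_cst _ _ _) _ => //; apply: class_C_sum => // k.
  apply: class_CM (class_C_cst _ _ _) => //.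
  have := class_CM oB (class_C_cst j B' (-1)) (Cpd (lift a k)).
  by apply: class_C_ext => // z _; rewrite mulN1r.
apply: class_C_ext => // z /differentiable_unstraighten[_ dE].
by rewrite dE.
Qed.

End Box.
End Straightening.

Arguments open_straighten_box {R m U s a x0} ss {d} d0 box.
Arguments continuous_unstraighten {R m U s a x0} ss {d} d0 box {z} B'z : rename.

Local Notation jacobian := Defs.jacobian.
Local Notation coord := Defs.coord.

Lemma eq_grad (R : realType) n (U : set 'rV[R]_n) (f h : 'rV[R]_n -> R) x :
  open U -> U x -> (forall y, U y -> f y = h y) -> grad f x = grad h x.
Proof. by move=> oU Ux fh; apply/rowP => a; rewrite 2!mxE; exact: (eq_derive _ oU Ux fh). Qed.

(** * Charts *)

Section ChartTransitions.
Context {R : realType} {T : topologicalType} {n : nat}.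
Implicit Types (k l : chart R T n).

Lemma open_transition_dom k l : is_chart k -> is_chart l ->
  open [set x | cimg k x /\ cdom l (param k x)].
Proof.
move=> [_ oi _ ip] [od _ _ _]; rewrite openE => x [ix dx].
have [_ _ cx] := ip _ ix.
have n1 : nbhs x (cimg k) by exact: open_nbhs_nbhs.
have n2 : nbhs x (param k @^-1` cdom l) by apply: cx; exact: open_nbhs_nbhs.
exact: filterI n1 n2.
Qed.

Variable X : atlas R T n.
Hypothesis hM : is_manifold X.
Implicit Types (i j : idx X) (p : T) (x : 'rV[R]_n).

Lemma is_chart_ch i : is_chart (ch i).
Proof. by have [_ + _ _ _] := hM. Qed.

Lemma open_im i : open (im i).
Proof. by have [] := is_chart_ch i. Qed.

Lemma im_coord i p : dom i p -> im i (coord (ch i) p).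
Proof. by move=> ip; have [_ _ h _] := is_chart_ch i; have [] := h _ ip. Qed.

Lemma coordK i p : dom i p -> param (ch i) (coord (ch i) p) = p.
Proof. by move=> ip; have [_ _ h _] := is_chart_ch i; have [] := h _ ip. Qed.

Lemma dom_param i x : im i x -> dom i (param (ch i) x).
Proof. by move=> ix; have [_ _ _ h] := is_chart_ch i; have [] := h _ ix. Qed.

Lemma paramK i x : im i x -> coord (ch i) (param (ch i) x) = x.
Proof. by move=> ix; have [_ _ _ h] := is_chart_ch i; have [] := h _ ix. Qed.

Definition transition_dom i j := [set x | im i x /\ dom j (param (ch i) x)].

Definition transition i j x := coord (ch j) (param (ch i) x).

Lemma open_transition i j : open (transition_dom i j).
Proof. exact: open_transition_dom (is_chart_ch i) (is_chart_ch j). Qed.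

Lemma smooth_chart_transition i j : smooth_mx (transition_dom i j) (transition i j).
Proof.
apply: smooth_row => b; have [_ _ _ h _] := hM; have [h1 _] := h i j.
exact: (h1 b).
Qed.

Lemma transition_im i j x : transition_dom i j x -> im j (transition i j x).
Proof. by move=> [_ jx]; exact: im_coord. Qed.

Lemma transition_domP i j p : dom i p -> dom j p -> transition_dom i j (coord (ch i) p).
Proof. by move=> ip jp; split; [exact: im_coord|rewrite coordK]. Qed.

Lemma transition_coord i j p : dom i p -> transition i j (coord (ch i) p) = coord (ch j) p.
Proof. by move=> ip; rewrite /transition coordK. Qed.

Lemma derive_transition i j p a :
  'd_(basis_vec a) (transition i j) (coord (ch i) p) = row a (jacobian i j p).
Proof. by apply/rowP => b; rewrite derive_matE !mxE. Qed.

Lemma grad_transition (F : T -> R) i j p : dom i p -> dom j p ->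
  differentiable (fun x => F (param (ch j) x)) (coord (ch j) p) ->
  grad (fun x => F (param (ch i) x)) (coord (ch i) p)
  = grad (fun x => F (param (ch j) x)) (coord (ch j) p) *m (jacobian i j p)^T.
Proof.
move=> ip jp dF; have D := transition_domP ip jp.
apply/rowP => a; rewrite mxE.
have -> : pd a (fun x => F (param (ch i) x)) (coord (ch i) p)
    = pd a (fun x => F (param (ch j) (transition i j x))) (coord (ch i) p).
  apply: (@eq_derive _ _ (transition_dom i j)) => // [|x [_ jx]]; first exact: open_transition.
  by rewrite /transition coordK.
have := @derive_comp _ _ _ (fun x => F (param (ch j) x)) (transition i j)
  (coord (ch i) p) (basis_vec a).
rewrite transition_coord // /pd => ->.
- by rewrite mxE; apply: eq_bigr => b _; rewrite !mxE mulrC.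
- exact: dF.
- by move=> b; exact: smooth_diff (smooth_chart_transition i j 0 b) D.
Qed.

Lemma jacobian_cocycle i j (k : idx X) p : dom i p -> dom j p -> dom k p ->
  jacobian i k p = jacobian i j p *m jacobian j k p.
Proof.
move=> ip jp kp; have D := transition_domP ip jp; apply/matrixP => a b.
have dF : differentiable (fun x => coord (ch k) (param (ch j) x) 0 b) (coord (ch j) p).
  exact: smooth_diff (smooth_chart_transition j k 0 b) (transition_domP jp kp).
have /rowP/(_ a) := grad_transition (F := fun q => coord (ch k) q 0 b) ip jp dF.
by rewrite !mxE => ->; apply: eq_bigr => e _; rewrite !mxE mulrC.
Qed.

Lemma jacobian_id i p : dom i p -> jacobian i i p = 1%:M.
Proof.
move=> ip; apply/matrixP => a b; rewrite mxE.
have -> : pd a (fun y => coord (ch i) (param (ch i) y) 0 b) (coord (ch i) p)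
    = pd a (fun y : 'rV[R]_n => y 0 b) (coord (ch i) p).
  apply: (@eq_derive _ _ (im i)) => [||x ix]; [exact: open_im|exact: im_coord|];
    by rewrite paramK.
by rewrite /pd derive_coord !mxE eqxx eq_sym.
Qed.

Lemma jacobianK i j p : dom i p -> dom j p -> jacobian i j p *m jacobian j i p = 1%:M.
Proof. by move=> ip jp; rewrite -jacobian_cocycle // jacobian_id. Qed.

Lemma jacobian_unit i j p : dom i p -> dom j p -> jacobian i j p \in unitmx.
Proof. by move=> ip jp; case: (mulmx1_unit (jacobianK ip jp)). Qed.

Lemma invmx_congruence (J G : 'M[R]_n) : J \in unitmx -> G \in unitmx ->
  J^T *m invmx (J *m G *m J^T) *m J = invmx G.
Proof.
move=> uJ uG; set M := J *m G *m J^T.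
have uM : M \in unitmx by rewrite !unitmx_mul unitmx_tr uJ uG.
have E : J *m (G *m (J^T *m invmx M *m J)) = J by rewrite !mulmxA -/M mulmxV // mul1mx.
by rewrite -[LHS](mulKmx uG) -[G *m _](mulKmx uJ) E mulVmx // mulmx1.
Qed.

Lemma tr_metric_coord_change (Gi Gj : 'rV[R]_n -> 'M[R]_n) (J : 'M[R]_n)
    (S S' : tractor R n) x x' :
  J \in unitmx -> Gi x = J *m Gj x' *m J^T -> Gj x' \in unitmx ->
  tr_metric Gi x (tr_coord_change J S) (tr_coord_change J S') = tr_metric Gj x' S S'.
Proof.
move=> uJ E uG; rewrite !tr_metricE /= E; congr (_ + _).
by rewrite trmx_mul trmxK -(invmx_congruence uJ uG) !mulmxA.
Qed.

End ChartTransitions.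

Arguments open_im {R T n X} hM i.
Arguments open_transition {R T n X} hM i j.

Section Metrics.
Context {R : realType} {T : topologicalType} {n : nat}.
Variables (X : atlas R T n) (q : nat) (g : metric X).
Hypothesis hg : is_metric q g.

Lemma signature_sym (A : 'M[R]_n) : has_signature q A -> A^T = A /\ A \in unitmx.
Proof.
move=> [Q uQ E]; set D := diag_mx _ in E.
have uD : D \in unitmx.
  rewrite unitmxE det_diag unitfE; apply/prodf_neq0 => k _.
  by rewrite !mxE; case: ifP; rewrite ?oppr_eq0 oner_eq0.
have uQt : Q^T \in unitmx by rewrite unitmx_tr.
have AE : A = invmx Q *m D *m invmx Q^T by rewrite -E !mulmxA mulVmx // mul1mx mulmxK.
split; first by rewrite AE !trmx_mul trmx_inv trmxK tr_diag_mx -trmx_inv mulmxA.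
by rewrite AE !unitmx_mul !unitmx_inv uQ uD uQt.
Qed.

Lemma smooth_metric i : smooth_mx (im i) (g i).
Proof. by have [h _ _] := hg; exact: h. Qed.

Lemma sym_metric i x : im i x -> (g i x)^T = g i x.
Proof. by move=> ix; have [_ h _] := hg; have [] := signature_sym (h i x ix). Qed.

Lemma unit_metric i x : im i x -> g i x \in unitmx.
Proof. by move=> ix; have [_ h _] := hg; have [] := signature_sym (h i x ix). Qed.

Lemma metric_coord_change p i j : dom i p -> dom j p ->
  g i (coord (ch i) p) = jacobian i j p *m g j (coord (ch j) p) *m (jacobian i j p)^T.
Proof. by have [_ _ h] := hg; exact: h. Qed.

End Metrics.

Section StraightenedChart.
Context {R : realType} {T : topologicalType} {m : nat}.
Variables (X : atlas R T m.+1) (i : idx X) (s : 'rV[R]_m.+1 -> R) (a : 'I_m.+1)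
  (x0 : 'rV[R]_m.+1) (d : R).
Hypotheses (hM : is_manifold X) (ss : smooth_on (im i) s) (d0 : 0 < d)
  (box : forall x, ball x0 d x -> im i x /\ 0 < pd a s x).

Let psi := unstraighten s a x0 d.

(** Once compatible with the atlas, this chart belongs to it by maximality; this is how slice charts
    are found. *)
Definition straightened_chart : chart R T m.+1 :=
  Chart [set q | dom i q /\ ball x0 d (coord (ch i) q)]
        [set z | exists2 x, ball x0 d x & straighten s a x = z]
        (fun q => straighten s a (coord (ch i) q))
        (fun z => param (ch i) (psi z)).

Lemma is_chart_straightened : is_chart straightened_chart.
Proof.
have [od oi di ii] := is_chart_ch hM i.
have sS := smooth_straighten a (open_im hM i) ss.
split.
- rewrite openE => q [iq Bq]; have [_ _ cq] := di q iq.
  have n1 : nbhs q (dom i) by exact: open_nbhs_nbhs.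
  have n2 : nbhs q (coord (ch i) @^-1` ball x0 d).
    by apply: cq; apply: open_nbhs_nbhs; split=> //; exact: ball_open.
  exact: filterI n1 n2.
- by have oB := open_straighten_box ss d0 box.
- move=> q [iq Bq]; have [_ _ cq] := di q iq; split=> /=.
  + by exists (coord (ch i) q).
  + by rewrite /psi (unstraightenK ss d0 box Bq) (coordK hM).
  + apply: (@continuous_comp _ _ _ (coord (ch i)) (straighten s a)); first exact: cq.
    by apply: continuous_row => b; apply: smooth_continuous (sS 0 b) _; exact: im_coord.
- move=> z B'z; have [Bz zE] := unstraightenP B'z; have [iz _] := box Bz; split=> /=.
  + by split; [exact: dom_param|rewrite (paramK hM)].
  + by rewrite (paramK hM).
  + apply: (@continuous_comp _ _ _ psi (param (ch i))).
      by have cz := continuous_unstraighten ss d0 box B'z.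
    by have [_ _] := ii _ iz.
Qed.

Lemma compatible_straightened (j : idx X) : compatible (ch j) straightened_chart.
Proof.
have hk := is_chart_straightened; have hj := is_chart_ch hM j; split=> b.
  have o1 := open_transition_dom hj hk.
  have sS := smooth_straighten a (open_im hM i) ss.
  apply: (smooth_comp o1 (y := transition j i) _ (sS 0 b)) => [x [jx [ix _]]|e].
    exact: im_coord.
  by apply: smooth_sub (smooth_chart_transition hM j i 0 e) => x [jx [ix _]].
have o1 := open_transition_dom hk hj.
apply: (smooth_comp o1 (y := psi) _ (smooth_chart_transition hM i j 0 b)) => [z [B'z jz]|e].
  by split=> //; have [Bz _] := unstraightenP B'z; have [] := box Bz.
have sU := smooth_unstraighten ss d0 box.
by apply: smooth_sub (sU 0 e) => z [].
Qed.

End StraightenedChart.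

Section TractorCongruence.
Context {R : realType} {n : nat} {V : normedModType R}.
Variables (G : 'rV[R]_n -> 'M[R]_n) (A : set V).
Hypothesis oA : open A.

Lemma tr_conn_ext (y y' : V -> 'rV[R]_n) (F F' : V -> tractor R n) u v :
  A u -> (forall w, A w -> y w = y' w) -> (forall w, A w -> F w = F' w) ->
  tr_conn G y F u v = tr_conn G y' F' u v.
Proof.
move=> Au yE FE; rewrite !tr_connE /conn_along (derive_mat_ext oA v yE Au) (yE _ Au) (FE _ Au).
have E1 := eq_derive v oA Au (fun w Aw => congr1 (fun S : tractor R n => S.1.1) (FE w Aw)).
have E2 := derive_mat_ext oA v (fun w Aw => congr1 (fun S : tractor R n => S.1.2) (FE w Aw)) Au.
have E3 := eq_derive v oA Au (fun w Aw => congr1 (fun S : tractor R n => S.2) (FE w Aw)).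
by rewrite /= in E1 E2 E3; rewrite E1 E2 E3.
Qed.

Lemma smooth_tr_metric (U : set 'rV[R]_n) (y : V -> 'rV[R]_n) (F F' : V -> tractor R n) :
  smooth_mx U G -> (forall x, U x -> G x \in unitmx) ->
  (forall u, A u -> U (y u)) -> smooth_mx A y ->
  tr_smooth A F -> tr_smooth A F' -> smooth_on A (fun u => tr_metric G (y u) (F u) (F' u)).
Proof.
move=> sG uG AU sy [sF1 /smooth_row sF2 sF3] [sF1' /smooth_row sF2' sF3'].
have sGy := smooth_mx_comp oA AU sG sy.
have sK := smooth_inv oA sGy (fun u Au => uG _ (AU u Au)).
have s1 := smoothD oA (smoothM oA sF1 sF3') (smoothM oA sF3 sF1').
have s2 := smooth_mxM oA (smooth_mxM oA sF2 sK) (smooth_mx_tr oA sF2').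
have := smoothD oA s1 (s2 0 0).
by apply: smooth_ext => // u _; rewrite tr_metricE.
Qed.

Lemma tr_smooth_ext (F F' : V -> tractor R n) :
  (forall u, A u -> F u = F' u) -> tr_smooth A F -> tr_smooth A F'.
Proof.
move=> E [s1 s2 s3]; split=> [|b|].
- by apply: smooth_ext s1 => // u /E ->.
- by apply: smooth_ext (s2 b) => // u /E ->.
- by apply: smooth_ext s3 => // u /E ->.
Qed.

Lemma tr_smooth_sub (B : set V) (F : V -> tractor R n) :
  B `<=` A -> tr_smooth A F -> tr_smooth B F.
Proof.
by move=> BA [s1 s2 s3]; split=> [|b|]; [exact: smooth_sub s1|exact: smooth_sub (s2 b)|exact: smooth_sub s3].
Qed.

Lemma tr_smooth_local (F : V -> tractor R n) :
  (forall u, A u -> exists2 B, B u & tr_smooth B F) -> tr_smooth A F.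
Proof.
move=> h; split=> [|b|]; apply: smooth_local => u /h[B Bu [s1 s2 s3]]; exists B => //.
Qed.

End TractorCongruence.

Lemma derive_zero_constant (R : realType) (F : R -> R) (l r t0 t1 : R) :
  (forall t, l < t < r -> is_derive t (1 : R) F 0) -> l < t0 < r -> l < t1 < r -> F t0 = F t1.
Proof.
move=> dF; wlog lt01 : t0 t1 / t0 < t1 => [H i0 i1|].
  by have [lt|lt|->] := ltgtP t0 t1 => //; [|apply/esym]; exact: H.
move=> /andP[l0 r0] /andP[l1 r1].
have dF' t : t0 <= t <= t1 -> is_derive t (1 : R) F 0.
  move=> /andP[a b]; apply: dF.
  by apply/andP; split; [exact: lt_le_trans l0 a|exact: le_lt_trans b r1].
have [t|t|t _] := @MVT R F (fun=> 0) t0 t1 lt01.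
- by rewrite in_itv /= => /andP[a b]; apply: dF'; rewrite !ltW.
- apply: continuous_in_subspaceT => s; rewrite inE /= in_itv /= => sh.
  have [dl _] := dF' s sh.
  exact/differentiable_continuous/derivable1_diffP.
- by rewrite mul0r => /eqP; rewrite subr_eq0 => /eqP ->.
Qed.

(** * Linear algebra of coordinate slices *)

Section Slices.
Context {R : realType} {m : nat}.

Lemma slice_in0 (u : 'rV[R]_m) : slice_in u 0 ord0 = 0.
Proof. by rewrite mxE unlift_none. Qed.

Lemma slice_inS (u : 'rV[R]_m) k : slice_in u 0 (lift ord0 k) = u 0 k.
Proof. by rewrite mxE liftK. Qed.

Lemma slice_inK : cancel (@slice_in R m) slice_pull.
Proof. by move=> u; apply/rowP => k; rewrite mxE slice_inS. Qed.

Lemma slice_pullK (x : 'rV[R]_m.+1) : x 0 ord0 = 0 -> slice_in (slice_pull x) = x.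
Proof.
move=> x0; apply/rowP => b; case: (unliftP ord0 b) => [k|] ->.
  by rewrite slice_inS mxE.
by rewrite slice_in0.
Qed.

Definition slice_mx : 'M[R]_(m, m.+1) := \matrix_(k, a) (lift ord0 k == a)%:R.

Lemma slice_in_linear (u : 'rV[R]_m) : slice_in u = u *m slice_mx.
Proof.
apply/rowP => b; rewrite [RHS]mxE; case: (unliftP ord0 b) => [k|] ->.
  rewrite slice_inS (bigD1 k) //= !mxE eqxx mulr1 big1 ?addr0 // => l lk.
  by rewrite mxE (inj_eq (@lift_inj _ _)) (negPf lk) mulr0.
by rewrite slice_in0 big1 // => k _; rewrite mxE eq_sym (negPf (neq_lift _ _)) mulr0.
Qed.

Lemma slice_pull_mx (w : 'rV[R]_m.+1) : slice_pull w = w *m slice_mx^T.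
Proof.
apply/rowP => k; rewrite !mxE (bigD1 (lift ord0 k)) //= !mxE eqxx mulr1 big1 ?addr0 // => b bk.
by rewrite !mxE eq_sym (negPf bk) mulr0.
Qed.

Lemma smooth_slice_in (O : set 'rV[R]_m) : open O -> smooth_mx O (@slice_in R m).
Proof.
move=> oO; have := smooth_mxM oO (smooth_mx_id oO) (fun i j => smooth_cst O (slice_mx i j)).
by apply: smooth_mx_ext => // u _; rewrite slice_in_linear.
Qed.

Lemma derive_slice_in u v : 'd_v (@slice_in R m) u = slice_in v.
Proof.
have -> : @slice_in R m = (fun u => u *m slice_mx).
  by apply/funext => w; exact: slice_in_linear.
have sM : smooth_mx [set: 'rV[R]_m] (fun=> slice_mx) by move=> i j; exact: smooth_cst.
rewrite (derive_matM openT v (smooth_mx_id openT) sM) // derive_mat_id.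
by rewrite derive_mat_cst mulmx0 addr0.
Qed.

Lemma continuous_slice_in (u : 'rV[R]_m) : {for u, continuous (@slice_in R m)}.
Proof.
apply: continuous_row => b; exact: (smooth_continuous (smooth_slice_in openT 0 b)).
Qed.

(** Covectors that annihilate the slice have only their component 0, so they form a line. *)
Lemma slice_covector_multiple (c w : 'rV[R]_m.+1) :
  c *m slice_mx^T = 0 -> w *m slice_mx^T = 0 -> w != 0 ->
  w 0 ord0 != 0 /\ c = (c 0 ord0 / w 0 ord0) *: w.
Proof.
rewrite -!slice_pull_mx => c0 w0 wn.
have E (v : 'rV[R]_m.+1) k : slice_pull v = 0 -> v 0 (lift ord0 k) = 0.
  by move=> /rowP/(_ k); rewrite !mxE.
have w00 : w 0 ord0 != 0.
  apply: contra wn => /eqP w00; apply/eqP/rowP => b; rewrite [RHS]mxE.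
  by case: (unliftP ord0 b) => [k|] -> //; exact: E.
split=> //; apply/rowP => b; rewrite [RHS]mxE; case: (unliftP ord0 b) => [k|] ->.
  by rewrite !E // mulr0.
by rewrite divfK.
Qed.

(** If [v] lies in the kernel of the restricted metric, lowering its index gives a covector that
    annihilates the slice, hence [l *: w]. Pairing with [w] gives [l * eps = 0], so [v] is 0. *)
Lemma sandwich_slice_unit (G : 'M[R]_m.+1) (w : 'rV[R]_m.+1) (eps : R) :
  G \in unitmx -> w *m slice_mx^T = 0 -> (w *m invmx G *m w^T) 0 0 = eps -> eps != 0 ->
  slice_mx *m G *m slice_mx^T \in unitmx.
Proof.
move=> uG wJ ww e0.
have wn : w != 0.
  by apply: contra e0 => /eqP w0; rewrite -ww w0 !mul0mx mx0E.
rewrite -row_free_unit -kermx_eq0; apply/eqP/row_matrixP => i.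
set v := row i (kermx _); rewrite row0.
have vh : v *m (slice_mx *m G *m slice_mx^T) = 0.
  by rewrite /v -row_mul mulmx_ker row0.
pose c := v *m slice_mx *m G.
have cJ : c *m slice_mx^T = 0 by rewrite /c -vh !mulmxA.
have [_] := slice_covector_multiple cJ wJ wn; set l := _ / _ => cE.
have l0 : l = 0.
  have : (c *m invmx G *m w^T) 0 0 = l * eps by rewrite cE -!scalemxAl scalemxE ww.
  rewrite /c mulmxK // -mulmxA.
  have -> : slice_mx *m w^T = 0 by rewrite -[slice_mx]trmxK -trmx_mul wJ trmx0.
  by rewrite mulmx0 mx0E => /esym/eqP; rewrite mulf_eq0 (negPf e0) orbF => /eqP.
have : v *m slice_mx = 0 by rewrite -[LHS](mulmxK uG) -/c cE l0 scale0r mul0mx.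
rewrite -slice_in_linear => vs; rewrite -[v]slice_inK vs.
by apply/rowP => k; rewrite !mxE.
Qed.

End Slices.

(** * The zero locus as a hypersurface *)

Section EinsteinScale.
Context {R : realType} {m : nat} {T : topologicalType}.
Variables (X : atlas R T m.+1) (q : nat) (g : metric X) (sg : T -> R) (eps : R)
  (f : idx X -> 'I_m.+1 -> 'rV[R]_m.+1 -> tractor R m.+1) (S : set T).
Hypotheses (hM : is_manifold X) (hg : is_metric q g) (ssg : smooth_fun X sg)
  (SE : forall p, S p <-> sg p = 0) (ee : eps * eps = 1).

Let sc (i : idx X) x := sg (param (ch i) x).
Let I i := scale_tractor (g i) (sc i).
Let om i := grad (sc i).
Let rho i := scale_rho (g i) (sc i).
Let K i x := invmx (g i x).

Hypotheses (sf : forall i a, tr_smooth (im i) (f i a))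
  (parI : forall i x a, im i x -> tr_conn (g i) id (I i) x (basis_vec a) = sc i x ^+ 2 *: f i a x)
  (normI : forall p i, S p -> dom i p ->
     tr_metric (g i) (coord (ch i) p) (I i (coord (ch i) p)) (I i (coord (ch i) p)) = eps).

Implicit Types (i j : idx X) (p : T).

Let sG i : smooth_mx (im i) (g i) := smooth_metric hg i.
Let symG i x : im i x -> (g i x)^T = g i x := @sym_metric _ _ _ _ _ _ hg i x.
Let uG i x : im i x -> g i x \in unitmx := @unit_metric _ _ _ _ _ _ hg i x.
Let ssc i : smooth_on (im i) (sc i) := ssg i.

Lemma eps_neq0 : eps != 0.
Proof. by apply/eqP => e0; have := ee; rewrite e0 mulr0 => /esym/eqP; rewrite oner_eq0. Qed.

Lemma scale_zero i p : S p -> dom i p -> sc i (coord (ch i) p) = 0.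
Proof. by move=> /SE sp ip; rewrite /sc (coordK hM). Qed.

Lemma grad_norm i p : S p -> dom i p ->
  (om i (coord (ch i) p) *m K i (coord (ch i) p) *m (om i (coord (ch i) p))^T) 0 0 = eps.
Proof.
move=> Sp ip; rewrite -(normI Sp ip) tr_metricE /=.
by rewrite -/(sc i (coord (ch i) p)) scale_zero // mul0r mulr0 !add0r.
Qed.

Lemma grad_coord_change i j p : dom i p -> dom j p ->
  om i (coord (ch i) p) = om j (coord (ch j) p) *m (jacobian i j p)^T.
Proof.
move=> ip jp; apply: (grad_transition hM ip jp).
by apply: smooth_diff (ssc j) _; exact: im_coord.
Qed.

Lemma grad_neq0 i p : S p -> dom i p -> exists a, om i (coord (ch i) p) 0 a != 0.
Proof.
move=> Sp ip; apply: contrapT => h; have := grad_norm Sp ip.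
have -> : om i (coord (ch i) p) = 0.
  apply/rowP => a; rewrite [RHS]mxE; apply/eqP; apply: contrapT => /negP oa.
  by apply: h; exists a.
by rewrite !mul0mx mx0E => e; have := eps_neq0; rewrite -e eqxx.
Qed.

(* The scale tractor transforms as it should at points of the zero locus:
   its bottom slot is determined by the differential of |ds|^2, so the
   transformation law of the Schouten tensor is not needed. *)
Lemma rho_coord_change i j p : S p -> dom i p -> dom j p ->
  rho i (coord (ch i) p) = rho j (coord (ch j) p).
Proof.
move=> Sp ip jp; have D := transition_domP hM ip jp.
pose F k x := (om k x *m K k x *m (om k x)^T) 0 0.
have FE k r : dom k r -> forall l, dom l r -> F k (coord (ch k) r) = F l (coord (ch l) r).
  move=> kr l lr; rewrite /F (grad_coord_change kr lr) /K (metric_coord_change hg kr lr).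
  rewrite trmx_mul trmxK -(invmx_congruence (jacobian_unit hM kr lr) (uG (im_coord hM lr))).
  by rewrite !mulmxA.
have dF k r : S r -> dom k r -> forall a, pd a (F k) (coord (ch k) r)
    = - (2 * rho k (coord (ch k) r) * om k (coord (ch k) r) 0 a).
  move=> Sr kr a.
  exact: (derive_grad_norm_zero (open_im hM k) (@sG k) (@symG k) (@uG k) (ssc k) (@parI k) a
    (im_coord hM kr) (scale_zero Sr kr)).
have sF k : smooth_on (im k) (F k).
  have so := smooth_grad (open_im hM k) (ssc k); have sK := smooth_inv (open_im hM k) (@sG k) (@uG k).
  exact: (smooth_mxM (open_im hM k) (smooth_mxM (open_im hM k) so sK) (smooth_mx_tr (open_im hM k) so) 0 0).
have E : grad (F i) (coord (ch i) p) = grad (F j) (coord (ch j) p) *m (jacobian i j p)^T.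
  pose Fp r := F j (coord (ch j) r).
  have E1 : grad (fun x => Fp (param (ch i) x)) (coord (ch i) p) = grad (F i) (coord (ch i) p).
    apply: (eq_grad (open_transition hM i j) D) => x [ix jx].
    by rewrite /Fp -(FE i (param (ch i) x)) ?(paramK hM) //; exact: dom_param.
  have E2 : grad (fun x => Fp (param (ch j) x)) (coord (ch j) p) = grad (F j) (coord (ch j) p).
    by apply: (eq_grad (open_im hM j) (im_coord hM jp)) => x jx; rewrite /Fp (paramK hM).
  apply: (etrans (esym E1)); rewrite -E2; apply: (grad_transition hM ip jp).
  apply: (near_differentiable (f := F j)); last by apply: smooth_diff (sF j) _; exact: im_coord.
  by apply: near_open (open_im hM j) (im_coord hM jp) _ => x jx; rewrite /Fp (paramK hM).
have GE k r : S r -> dom k r ->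
    grad (F k) (coord (ch k) r) = - (2 * rho k (coord (ch k) r)) *: om k (coord (ch k) r).
  by move=> Sr kr; apply/rowP => a; rewrite [LHS]mxE (dF _ _ Sr kr) scalemxE mulNr.
have [a a0] := grad_neq0 Sp ip; move: E; rewrite !GE // -scalemxAl -grad_coord_change //.
move=> /rowP/(_ a); rewrite !scalemxE => /(mulIf a0)/oppr_inj.
by apply: mulfI; rewrite pnatr_eq0.
Qed.

Lemma scale_coord_change i j p : S p -> dom i p -> dom j p ->
  I i (coord (ch i) p) = tr_coord_change (jacobian i j p) (I j (coord (ch j) p)).
Proof.
move=> Sp ip jp; rewrite /I /tr_coord_change.
rewrite [LHS]surjective_pairing [X in (X, _) = _]surjective_pairing; congr (_, _, _).
- by rewrite /= -!/(sc _ _) !scale_zero.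
- exact: grad_coord_change.
- exact: rho_coord_change.
Qed.

Lemma slice_chart_exists p : S p -> exists2 i : idx X, is_slice S i & dom i p.
Proof.
move=> Sp; have [_ _ cov _ maxX] := hM; have [i ip] := cov p.
have [a a0] := grad_neq0 Sp ip; rewrite mxE in a0.
(* Straightening needs a positive derivative, so [s] will be the scale or its negative; only its
   zero set matters. *)
have main (s : 'rV[R]_m.+1 -> R) : smooth_on (im i) s -> 0 < pd a s (coord (ch i) p) ->
    (forall x, s x = 0 <-> sc i x = 0) -> exists2 i : idx X, is_slice S i & dom i p.
  move=> ss pos s0; have [d d0 box] := straighten_box (open_im hM i) ss (im_coord hM ip) pos.
  have hk := is_chart_straightened hM ss d0 box.
  have [i' E] := maxX _ hk (compatible_straightened hM ss d0 box).
  exists i'; last by rewrite /dom E /=; split=> //; exact: ballxx.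
  move=> r; rewrite /dom E /= => -[ir _]; rewrite straighten0.
  split=> [/SE s0r|]; first by apply/s0; rewrite /sc (coordK hM).
  by move=> /s0; rewrite /sc (coordK hM) // => /SE.
have x_im := im_coord hM ip.
have [neg|pos|z] := ltgtP (pd a (sc i) (coord (ch i) p)) 0.
- apply: (main (fun x => - sc i x)).
  + by apply: smoothN; [exact: open_im|exact: ssc].
  + by rewrite /pd (derive_opp _ (@ssc i) x_im) oppr_gt0.
  + by move=> x; split=> [/eqP|->]; rewrite ?oppr0 // oppr_eq0 => /eqP.
- exact: (main (sc i)).
- by rewrite z eqxx in a0.
Qed.

Local Notation hidx := (idx (hyp_atlas S X)).

Lemma param_slice (j : hidx) u : im (sval j) (slice_in u) ->
  S (param (ch (sval j)) (slice_in u)).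
Proof.
move=> ju; apply/(svalP j); first exact: dom_param.
by rewrite (paramK hM) // slice_in0.
Qed.

Definition slice_dom (j : hidx) i : set 'rV[R]_m :=
  [set u | transition_dom (sval j) i (slice_in u)].

(** The hypersurface seen in an arbitrary chart [i], parametrised by slice coordinates [j]. The
    results on immersions apply to this map. *)
Definition slice_map (j : hidx) i (u : 'rV[R]_m) : 'rV[R]_m.+1 :=
  transition (sval j) i (slice_in u).

Lemma open_slice_preimage (A : set 'rV[R]_m.+1) : open A -> open [set u | A (@slice_in R m u)].
Proof. by move=> oA; apply: open_comp oA => u _; exact: continuous_slice_in. Qed.

Lemma open_slice_dom (j : hidx) i : open (slice_dom j i).
Proof. exact: open_slice_preimage (open_transition hM (sval j) i). Qed.

Lemma smooth_slice_map (j : hidx) i : smooth_mx (slice_dom j i) (slice_map j i).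
Proof.
have oD := @open_slice_dom j i.
have h := smooth_mx_comp oD _ (smooth_chart_transition hM (sval j) i) (smooth_slice_in oD).
by apply: h.
Qed.

Lemma slice_map_im (j : hidx) i u : slice_dom j i u -> im i (slice_map j i u).
Proof. exact: transition_im. Qed.

Lemma scale_slice_map (j : hidx) i u : slice_dom j i u -> sc i (slice_map j i u) = 0.
Proof.
move=> [ju iu]; rewrite /sc /slice_map /transition (coordK hM) //.
by apply/SE; exact: param_slice.
Qed.

Lemma diff_mx_slice_in u : diff_mx (@slice_in R m) u = @slice_mx R m.
Proof.
apply/row_matrixP => k; rewrite -row_diff_mx derive_slice_in slice_in_linear.
by rewrite -rowE.
Qed.

Lemma diff_mx_slice_map (j : hidx) i u : slice_dom j i u ->
  diff_mx (slice_map j i) u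
  = @slice_mx R m *m jacobian (sval j) i (param (ch (sval j)) (slice_in u)).
Proof.
move=> D; have [ju iu] := D; apply/row_matrixP => k; rewrite -row_diff_mx.
have oD := @open_slice_dom j i; have jp := dom_param hM ju.
rewrite (derive_along (U := transition_dom (sval j) i) (fun _ => id) (smooth_slice_in oD)
  (basis_vec k) (smooth_chart_transition hM (sval j) i) D).
rewrite derive_slice_in slice_in_linear -rowE row_mul mulmx_sum_row.
apply: eq_bigr => a _; congr (_ *: _).
by rewrite -derive_transition // (paramK hM).
Qed.

Lemma induced_metricE (j : hidx) u :
  induced_metric g j u = @slice_mx R m *m g (sval j) (slice_in u) *m (@slice_mx R m)^T.
Proof.
apply/matrixP => k l.
have -> : @slice_mx R m *m g (sval j) (slice_in u)
    = \matrix_(k, a) g (sval j) (slice_in u) (lift ord0 k) a.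
  apply/row_matrixP => b; rewrite row_mul; apply/rowP => a.
  rewrite [LHS]mxE (bigD1 (lift ord0 b)) //= !mxE eqxx mul1r big1 ?addr0 // => e eb.
  by rewrite !mxE eq_sym (negPf eb) mul0r.
by rewrite -[RHS]row_entry row_mul -slice_pull_mx !mxE.
Qed.

Lemma induced_metric_slice_map (j : hidx) i u : slice_dom j i u ->
  induced_metric g j u
  = diff_mx (slice_map j i) u *m g i (slice_map j i u) *m (diff_mx (slice_map j i) u)^T.
Proof.
move=> D; have [ju iu] := D; have jp := dom_param hM ju.
rewrite induced_metricE diff_mx_slice_map // trmx_mul.
have := metric_coord_change hg jp iu; rewrite (paramK hM) // => ->.
by rewrite !mulmxA.
Qed.

Lemma grad_norm_slice_map (j : hidx) i u : slice_dom j i u ->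
  (om i (slice_map j i u) *m K i (slice_map j i u) *m (om i (slice_map j i u))^T) 0 0 = eps.
Proof.
move=> [ju iu]; exact: grad_norm (param_slice ju) iu.
Qed.

Lemma slice_dom_self (j : hidx) u : im j u -> slice_dom j (sval j) u.
Proof. by move=> ju; split=> //; exact: dom_param. Qed.

Lemma nondegenerate_induced (j : hidx) u : im j u -> induced_metric g j u \in unitmx.
Proof.
move=> ju; have D := slice_dom_self ju; rewrite induced_metricE.
apply: (sandwich_slice_unit (w := om (sval j) (slice_in u)) (eps := eps)).
- by apply: uG.
- have oO := open_slice_preimage (open_im hM (sval j)).
  rewrite -(diff_mx_slice_in u).
  apply: (grad_tangent (@ssc (sval j)) oO (fun _ => id) (smooth_slice_in oO)) => //.
  move=> w jw; rewrite /sc; apply/SE; exact: param_slice.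
- have := grad_norm (param_slice (j := j) ju) (dom_param hM ju).
  by rewrite (paramK hM).
- exact: eps_neq0.
Qed.

Lemma slice_point (j : hidx) i p (u := slice_pull (coord (ch (sval j)) p)) :
  S p -> dom (sval j) p -> dom i p ->
  [/\ slice_in u = coord (ch (sval j)) p, slice_dom j i u & slice_map j i u = coord (ch i) p].
Proof.
move=> Sp jp ip.
have E : slice_in u = coord (ch (sval j)) p.
  by rewrite /u slice_pullK //; apply/(svalP j).
split=> //; last by rewrite /slice_map E transition_coord.
by rewrite /slice_dom /= E; exact: transition_domP.
Qed.

Lemma slice_idx p : S p -> exists j : hidx, dom (sval j) p.
Proof. by move=> /slice_chart_exists[i si ip]; exists (exist _ i si). Qed.

(** Both gradients annihilate the tangent space. The chart [i] may fail to be a slice chart, so the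
    comparison is made after transport to a slice chart by the Jacobian. *)
Lemma tangential_gradient i p (F : 'rV[R]_m.+1 -> R) : S p -> dom i p ->
  smooth_on (im i) F -> (forall r, S r -> dom i r -> F (coord (ch i) r) = 0) ->
  exists l, grad F (coord (ch i) p) = l *: om i (coord (ch i) p).
Proof.
move=> Sp ip sF F0; have [j jp] := slice_idx Sp.
have [uE D yE] := slice_point Sp jp ip; set u := slice_pull _ in uE D yE.
have oD := @open_slice_dom j i.
have t1 : grad F (slice_map j i u) *m (diff_mx (slice_map j i) u)^T = 0.
  apply: (grad_tangent sF oD (@slice_map_im j i) (@smooth_slice_map j i)) => // w [jw iw].
  by apply: F0 iw; exact: param_slice.
have t2 : om i (slice_map j i u) *m (diff_mx (slice_map j i) u)^T = 0.
  apply: (grad_tangent (@ssc i) oD (@slice_map_im j i) (@smooth_slice_map j i)) => // w Dw.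
  exact: scale_slice_map.
rewrite yE in t1 t2; rewrite diff_mx_slice_map // uE (coordK hM) // in t1 t2.
rewrite trmx_mul mulmxA in t1; rewrite trmx_mul mulmxA in t2.
have uJ : (jacobian (sval j) i p)^T \in unitmx by rewrite unitmx_tr jacobian_unit.
have wn : om i (coord (ch i) p) *m (jacobian (sval j) i p)^T != 0.
  have [a a0] := grad_neq0 Sp ip; apply/eqP => /(congr1 (mulmx^~ (invmx (jacobian (sval j) i p)^T))).
  by rewrite mulmxK // mul0mx => /rowP/(_ a); rewrite [RHS]mxE => /eqP; rewrite (negPf a0).
have [_] := slice_covector_multiple t1 t2 wn; set l := _ / _ => E; exists l.
by rewrite -[LHS](mulmxK uJ) E -scalemxAl mulmxK.
Qed.

Lemma slice_pull_grad (j : hidx) p : S p -> dom (sval j) p ->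
  slice_pull (om (sval j) (coord (ch (sval j)) p)) = 0.
Proof.
move=> Sp jp; have [uE D _] := slice_point Sp jp jp; set u := slice_pull _ in uE D.
have oO := open_slice_preimage (open_im hM (sval j)).
rewrite slice_pull_mx -(diff_mx_slice_in u) -uE.
apply: (grad_tangent (@ssc (sval j)) oO (fun _ => id) (smooth_slice_in oO)).
  by move=> w jw; rewrite /sc; apply/SE; exact: param_slice.
by case: D.
Qed.

Definition restrict (j : hidx) i u (V : tractor R m.+1) : tractor R m :=
  tr_restrict (g i) (sc i) (slice_map j i) eps u V.

Definition extend (j : hidx) i u (W : tractor R m) : tractor R m.+1 :=
  tr_lift (g i) (sc i) (slice_map j i) (induced_metric g j) eps u W.

Definition scale_perp i p (V : tractor R m.+1) :=
  tr_metric (g i) (coord (ch i) p) V (I i (coord (ch i) p)) = 0.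

Local Notation hcoord j p := (slice_pull (coord (ch (sval j)) p)).

Let uH (j : hidx) i u : slice_dom j i u -> induced_metric g j u \in unitmx.
Proof. by case=> ju _; exact: nondegenerate_induced. Qed.

Section AtPoint.
Variables (p : T) (Sp : S p).

Lemma extendK (j : hidx) i W : dom (sval j) p -> dom i p ->
  restrict j i (hcoord j p) (extend j i (hcoord j p) W) = W.
Proof.
move=> jp ip; have [_ D _] := slice_point Sp jp ip.
exact: (tr_liftK (@ssc i) eps (@open_slice_dom j i) (@slice_map_im j i) (@smooth_slice_map j i)
  (@scale_slice_map j i) (@induced_metric_slice_map j i) (@uH j i) W D).
Qed.

Lemma extend_perp (j : hidx) i W : dom (sval j) p -> dom i p ->
  scale_perp i p (extend j i (hcoord j p) W).
Proof.
move=> jp ip; have [_ D E] := slice_point Sp jp ip; rewrite /scale_perp -E.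
exact: (tr_lift_perp (@symG i) (@uG i) (@ssc i) (induced_metric g j) (@open_slice_dom j i)
  (@slice_map_im j i) (@smooth_slice_map j i) (@scale_slice_map j i) ee (@grad_norm_slice_map j i) W D).
Qed.

Lemma restrict_inj (j : hidx) i V V' : dom (sval j) p -> dom i p ->
  scale_perp i p V -> scale_perp i p V' ->
  restrict j i (hcoord j p) V = restrict j i (hcoord j p) V' -> V = V'.
Proof.
move=> jp ip; have [_ D E] := slice_point Sp jp ip; rewrite /scale_perp -E.
exact: (tr_restrict_inj (@symG i) (@uG i) (@ssc i) (@open_slice_dom j i)
  (@slice_map_im j i) (@smooth_slice_map j i) (@scale_slice_map j i) ee (@grad_norm_slice_map j i)
  (@induced_metric_slice_map j i) (@uH j i) D).
Qed.

Lemma diff_mx_point (j : hidx) i : dom (sval j) p -> dom i p ->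
  diff_mx (slice_map j i) (hcoord j p) = @slice_mx R m *m jacobian (sval j) i p.
Proof.
by move=> jp ip; have [E D _] := slice_point Sp jp ip; rewrite diff_mx_slice_map // E (coordK hM).
Qed.

Lemma restrict_coord_change (j : hidx) i i' V : dom (sval j) p -> dom i p -> dom i' p ->
  restrict j i (hcoord j p) (tr_coord_change (jacobian i i' p) V) = restrict j i' (hcoord j p) V.
Proof.
move=> jp ip ip'; have [_ _ E] := slice_point Sp jp ip; have [_ _ E'] := slice_point Sp jp ip'.
rewrite /restrict /tr_restrict E E' !diff_mx_point //= -!/(rho _ _) (rho_coord_change Sp ip ip').
by rewrite (jacobian_cocycle hM jp ip ip') -mulmxA -trmx_mul mulmxA.
Qed.

(** A transition between slice charts preserves the locus where coordinate 0 vanishes, so tangential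
    rows of the ambient Jacobian have no component 0. *)
Lemma hyp_jacobian (j j' : hidx) : dom (sval j) p -> dom (sval j') p ->
  Defs.jacobian j j' p *m @slice_mx R m = @slice_mx R m *m jacobian (sval j) (sval j') p.
Proof.
move=> jp jp'; have [uE D _] := slice_point Sp jp jp'; rewrite -diff_mx_point //.
apply/matrixP => k b; rewrite [RHS]mxE; case: (unliftP ord0 b) => [b'|] ->.
  rewrite -[LHS]row_entry row_mul -slice_in_linear slice_inS !mxE.
  by congr (pd k _ _); apply/funext => w; rewrite mxE.
rewrite -[LHS]row_entry row_mul -slice_in_linear slice_in0.
rewrite /pd (@eq_derive _ _ (slice_dom j (sval j')) _ (cst 0)) ?derive_cst //.
  exact: open_slice_dom.
move=> w [jw iw]; apply/(svalP j') => //; exact: param_slice.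
Qed.

Lemma restrict_slice_change (j j' : hidx) i V : dom (sval j) p -> dom (sval j') p -> dom i p ->
  restrict j i (hcoord j p) V
  = tr_coord_change (Defs.jacobian j j' p) (restrict j' i (hcoord j' p) V).
Proof.
move=> jp jp' ip; have [_ _ E] := slice_point Sp jp ip; have [_ _ E'] := slice_point Sp jp' ip.
rewrite /restrict /tr_restrict /tr_coord_change E E' !diff_mx_point //=; congr (_, _, _).
have H := hyp_jacobian jp jp'; rewrite (jacobian_cocycle hM jp jp' ip) mulmxA -H.
by rewrite -[in RHS]mulmxA -trmx_mul mulmxA.
Qed.

Lemma scale_perp_coord_change i i' V : dom i p -> dom i' p ->
  scale_perp i p (tr_coord_change (jacobian i i' p) V) <-> scale_perp i' p V.
Proof.
move=> ip ip'; rewrite /scale_perp (scale_coord_change Sp ip ip').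
have u := uG (im_coord hM ip').
by rewrite (tr_metric_coord_change _ _ (jacobian_unit hM ip ip') (metric_coord_change hg ip ip') u).
Qed.

End AtPoint.

Section AlongMap.
Context {V : normedModType R}.
Variables (A : set V) (j : hidx) (i : idx X) (c : V -> 'rV[R]_m).
Hypotheses (oA : open A) (AD : forall t, A t -> slice_dom j i (c t)) (smc : smooth_mx A c).

Let smx : smooth_mx A (fun t => slice_map j i (c t)).
Proof. by have h := smooth_mx_comp oA AD (@smooth_slice_map j i) smc. Qed.

Let smd : smooth_mx A (fun t => diff_mx (slice_map j i) (c t)).
Proof.
by have h := smooth_mx_comp oA AD (smooth_diff_mx (@open_slice_dom j i) (@smooth_slice_map j i)) smc.
Qed.

Let smr : smooth_on A (fun t => rho i (slice_map j i (c t))).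
Proof.
exact: smooth_comp oA (fun t At => slice_map_im (AD At))
  (smooth_scale_rho (open_im hM i) (@sG i) (@uG i) (@ssc i)) (smx 0).
Qed.

Lemma smooth_restrict (F : V -> tractor R m.+1) :
  tr_smooth A F -> tr_smooth A (fun t => restrict j i (c t) (F t)).
Proof.
move=> [sF1 /smooth_row sF2 sF3]; split=> //=.
  by move=> b; exact: (smooth_mxM oA sF2 (smooth_mx_tr oA smd) 0 b).
exact: (smoothD oA sF3 (smoothM oA (smoothM oA (smooth_cst A (eps * 2^-1)) (smoothX 2 oA smr)) sF1)).
Qed.

Lemma smooth_extend (F : V -> tractor R m) :
  tr_smooth A F -> tr_smooth A (fun t => extend j i (c t) (F t)).
Proof.
move=> [sF1 /smooth_row sF2 sF3]; split=> //=.
  have sGx : smooth_mx A (fun t => g i (slice_map j i (c t))).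
    by have h := smooth_mx_comp oA (fun t At => slice_map_im (AD At)) (@sG i) smx.
  have so : smooth_mx A (fun t => om i (slice_map j i (c t))).
    by have h := smooth_mx_comp oA (fun t At => slice_map_im (AD At))
      (smooth_grad (open_im hM i) (@ssc i)) smx.
  have sh : smooth_mx A (fun t => induced_metric g j (c t)).
    have := smooth_mxM oA (smooth_mxM oA smd sGx) (smooth_mx_tr oA smd).
    apply: smooth_mx_ext => // t At; rewrite -induced_metric_slice_map //; exact: AD.
  have shi := smooth_inv oA sh (fun t At => uH (AD At)).
  have s1 := smooth_mxM oA (smooth_mxM oA (smooth_mxM oA sF2 shi) smd) sGx.
  have s2 := smooth_mxZ oA (smoothM oA (smoothM oA (smooth_cst A eps) smr) sF1) so.
  by move=> b; exact: (smooth_mxD oA s1 (smooth_mxN oA s2) 0 b).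
exact: (smoothB oA sF3 (smoothM oA (smoothM oA (smooth_cst A (eps * 2^-1)) (smoothX 2 oA smr)) sF1)).
Qed.

Lemma conn_restrict (F : V -> tractor R m.+1) t v : (2 < m)%N -> tr_smooth A F -> A t ->
  tr_metric (g i) (slice_map j i (c t)) (F t) (I i (slice_map j i (c t))) = 0 ->
  tr_conn (induced_metric g j) c (fun w => restrict j i (c w) (F w)) t v
  = restrict j i (c t) (tr_conn (g i) (fun w => slice_map j i (c w)) F t v).
Proof.
move=> m2 sF At perp.
exact: (tr_conn_restrict (open_im hM i) (@sG i) (@symG i) (@uG i) (@ssc i) (@sf i) (@parI i)
  (@open_slice_dom j i) (@slice_map_im j i) (@smooth_slice_map j i) (@scale_slice_map j i) ee
  (@grad_norm_slice_map j i) (@induced_metric_slice_map j i) (@uH j i) oA AD smc v m2 sF At perp).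
Qed.

End AlongMap.

(** * The unit conormal and the normal tractor *)

Section Conormal.
Variable nu : idx X -> 'rV[R]_m.+1 -> 'rV[R]_m.+1.
Hypotheses (hnu : unit_conormal S g eps nu) (m0 : (0 < m)%N).

(** Both covectors annihilate the slice and have norm [eps], so they agree up to sign in one slice
    chart; covariance gives the same sign in every chart at [p]. *)
Lemma conormal_grad p : S p -> exists2 l, l * l = 1 &
  forall i, dom i p -> nu i (coord (ch i) p) = l *: om i (coord (ch i) p).
Proof.
move=> Sp; have [_ nuT nu_slice nu_norm] := hnu; have [j jp] := slice_idx Sp.
have nj := nu_slice p (sval j) Sp jp (svalP j); have oj := slice_pull_grad Sp jp.
rewrite slice_pull_mx in nj; rewrite slice_pull_mx in oj.
have wn : om (sval j) (coord (ch (sval j)) p) != 0.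
  by have [a a0] := grad_neq0 Sp jp; apply: contra a0 => /eqP ->; rewrite mx0E.
have [_] := slice_covector_multiple nj oj wn; set l := _ / _ => E; exists l.
  have := nu_norm p (sval j) Sp jp; rewrite /= cov_pairingE E trmxZ -!scalemxAl -scalemxAr.
  rewrite !scalemxE grad_norm // mulrA => h.
  by apply: (mulIf eps_neq0); rewrite h mul1r.
by move=> i ip; rewrite (nuT p i (sval j)) // E -scalemxAl -grad_coord_change.
Qed.

(* The sign relating nu to om may depend on the point, and nu is only a
   conormal on S; the products nu_b nu_c and om_b om_c nevertheless agree
   along S, hence have the same tangential derivatives. *)
Lemma conormal_derivative p i l : S p -> dom i p -> l * l = 1 ->
  nu i (coord (ch i) p) = l *: om i (coord (ch i) p) ->
  forall b, exists k, forall a,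
    pd a (fun x => nu i x 0 b) (coord (ch i) p)
    = l * pd a (fun x => om i x 0 b) (coord (ch i) p) + k * om i (coord (ch i) p) 0 a.
Proof.
move=> Sp ip ll nl; have [snu _ _ _] := hnu; set x := coord (ch i) p.
have som := smooth_grad (open_im hM i) (@ssc i); have xi := im_coord hM ip.
pose e b a := pd a (fun x => nu i x 0 b) x - l * pd a (fun x => om i x 0 b) x.
suff H : forall b', exists k, forall a, e b' a = k * om i x 0 a.
  by move=> b; have [k kE] := H b; exists k => a; rewrite -kE /e; ring.
move=> b; have main b' c : exists k, forall a,
    l * (om i x 0 c * e b' a + om i x 0 b' * e c a) = k * om i x 0 a.
  move: b' => {}b; pose F z := nu i z 0 b * nu i z 0 c - om i z 0 b * om i z 0 c.
  have s1 := smoothM (open_im hM i) (snu i b) (snu i c).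
  have s2 := smoothM (open_im hM i) (som 0 b) (som 0 c).
  have sF : smooth_on (im i) F := smoothB (open_im hM i) s1 s2.
  have [|k kE] := tangential_gradient Sp ip sF.
    move=> r Sr ir; have [l' ll' E] := conormal_grad Sr.
    by rewrite /F E // !scalemxE mulrACA ll' mul1r subrr.
  exists k => a; have /rowP/(_ a) := kE; rewrite scalemxE -/x => <-.
  rewrite [RHS]mxE; have -> : pd a F x
      = pd a (fun z => nu i z 0 b) x * nu i x 0 c + nu i x 0 b * pd a (fun z => nu i z 0 c) x
        - (pd a (fun z => om i z 0 b) x * om i x 0 c + om i x 0 b * pd a (fun z => om i z 0 c) x).
    apply: etrans (derive_add _ s1 (smoothN (open_im hM i) s2) xi) _.
    apply: (f_equal2 (fun t t' => t + t')).
      exact: (derive_mul _ (snu i b) (snu i c) xi).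
    apply: etrans (derive_opp _ s2 xi) _; apply: (congr1 -%R).
    exact: (derive_mul _ (som 0 b) (som 0 c) xi).
  rewrite /e nl !scalemxE.
  move: (pd a (fun z => nu i z 0 b) x) (pd a (fun z => nu i z 0 c) x)
    (pd a (fun z => om i z 0 b) x) (pd a (fun z => om i z 0 c) x) (om i x 0 b) (om i x 0 c).
  move=> n1 n2 o1 o2 w1 w2.
  rewrite (_ : n1 * (l * w2) + l * w1 * n2 - (o1 * w2 + w1 * o2)
    = l * (w2 * (n1 - l * o1) + w1 * (n2 - l * o2)) + (l * l - 1) * (o1 * w2 + w1 * o2)).
    by rewrite ll subrr mul0r addr0.
  by ring.
have [c c0] := grad_neq0 Sp ip; rewrite -/x in c0.
have l0 : l != 0 by apply/eqP => l0; have := ll; rewrite l0 mulr0 => /esym/eqP; rewrite oner_eq0.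
(* For an index [c] with nonzero gradient component, the pair [(c, c)] determines [e c]; the pair
   [(b, c)] then determines [e b]. *)
have [k0 k0E] := main c c; have [k kE] := main b c.
have ec a : e c a = k0 / (2 * l * om i x 0 c) * om i x 0 a.
  have := k0E a => h; rewrite mulrAC -h; field.
  by rewrite c0 l0.
exists ((k / l - om i x 0 b * (k0 / (2 * l * om i x 0 c))) / om i x 0 c) => a.
have h := kE a; rewrite ec in h.
have -> : e b a = (k * om i x 0 a / l - om i x 0 b * (k0 / (2 * l * om i x 0 c) * om i x 0 a))
    / om i x 0 c.
  by rewrite -h; field; rewrite c0 l0.
by field; rewrite c0 l0.
Qed.

(** The covariant derivative of [nu] is - l rho g plus a term with a factor [om]. The inverse
    induced metric [M] annihilates conormals, so it kills that term and the normal correction in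
    [second_ff]; its trace against [g] is [m.+1 - 1]. *)
Lemma mean_curv_scale p i l : S p -> dom i p -> l * l = 1 ->
  nu i (coord (ch i) p) = l *: om i (coord (ch i) p) ->
  mean_curv (g i) eps (nu i) (coord (ch i) p) = - (l * rho i (coord (ch i) p)).
Proof.
move=> Sp ip ll nl; have [k kE] := choice (conormal_derivative Sp ip ll nl).
set x := coord (ch i) p in nl kE *; have xi := im_coord hM ip : im i x.
have sK : (K i x)^T = K i x by rewrite /K trmx_inv symG.
have GK : g i x *m K i x = 1%:M by apply: mulmxV; exact: uG.
pose n := nu i x *m K i x.
pose M a b := K i x a b - eps * n 0 a * n 0 b.
have nE b : raise (g i) x (nu i x) 0 b = n 0 b by rewrite raiseE sK.
have nn : (nu i x *m n^T) 0 0 = eps.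
  rewrite /n trmx_mul sK mulmxA nl trmxZ -!scalemxAl -scalemxAr !scalemxE mulrA ll mul1r.
  exact: grad_norm.
have nD b : n 0 b = \sum_a nu i x 0 a * K i x a b by rewrite /n mxE.
have nnE : (nu i x *m n^T) 0 0 = \sum_a nu i x 0 a * n 0 a.
  by rewrite mxE; apply: eq_bigr => a _; rewrite [_^T _ _]mxE.
have nuM b : \sum_a M a b * nu i x 0 a = 0.
  transitivity (n 0 b - eps * n 0 b * (nu i x *m n^T) 0 0); last by rewrite nn mulrAC ee mul1r subrr.
  by rewrite nnE mulr_sumr {1}nD -sumrB; apply: eq_bigr => a _; rewrite /M; ring.
have omM b : \sum_a M a b * om i x 0 a = 0.
  transitivity (l * \sum_a M a b * nu i x 0 a); last by rewrite nuM mulr0.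
  rewrite mulr_sumr; apply: eq_bigr => a _.
  by rewrite nl scalemxE mulrCA [l * (l * _)]mulrA ll mul1r.
have cdE a b : cov_deriv (g i) (nu i) a b x = - (l * rho i x * g i x a b) + k b * om i x 0 a.
  have /rowP/(_ b) := derive_grad_zero (@parI i) a xi (scale_zero Sp ip).
  rewrite derive_matE !entryE row_entry [(_ *m _) 0 b]mxE => E.
  rewrite /cov_deriv kE [pd a _ x]E nl.
  have -> : \sum_c christoffel (g i) c a b x * (l *: om i x) 0 c
      = l * \sum_c om i x 0 c * (conn_mx (g i) a x)^T c b.
    by rewrite mulr_sumr; apply: eq_bigr => c _; rewrite [_^T c b]mxE conn_mx_entry scalemxE; ring.
  rewrite -/x -/(rho i x); ring.
have MG : \sum_a \sum_b M a b * g i x a b = m%:R.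
  transitivity (\tr (g i x *m K i x) - eps * (nu i x *m n^T) 0 0).
    have nG a : nu i x 0 a = \sum_b n 0 b * g i x a b.
      have -> : nu i x = n *m g i x by rewrite /n -mulmxA mulVmx ?mulmx1 //; exact: uG.
      by rewrite mxE; apply: eq_bigr => b _; rewrite -[in LHS](symG xi) [_^T _ _]mxE.
    rewrite nnE /mxtrace mulr_sumr -sumrB; apply: eq_bigr => a _.
    rewrite nG mxE mulr_suml mulr_sumr -sumrB; apply: eq_bigr => b _.
    by rewrite -[in K i x b a]sK [_^T b a]mxE /M; ring.
  by rewrite GK mxtrace1 nn ee -addn1 natrD addrK.
rewrite /mean_curv.
have -> : \sum_a \sum_b (inv_metric (g i) x a b - eps * raise (g i) x (nu i x) 0 a
      * raise (g i) x (nu i x) 0 b) * second_ff (g i) eps (nu i) a b x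
    = - (l * rho i x) * \sum_a \sum_b M a b * g i x a b.
  rewrite exchange_big [in RHS]exchange_big mulr_sumr; apply: eq_bigr => b _.
  pose e := \sum_c raise (g i) x (nu i x) 0 c * cov_deriv (g i) (nu i) c b x.
  transitivity (\sum_a (- (l * rho i x) * (M a b * g i x a b)
      + k b * (M a b * om i x 0 a) - eps * e * (M a b * nu i x 0 a))).
    apply: eq_bigr => a _; rewrite /second_ff -/e cdE !nE -/(K i x a b) -/(M a b); ring.
  by rewrite sumrB big_split /= -!mulr_sumr nuM omM !mulr0 subr0 addr0.
by rewrite MG mulrC mulfK // pnatr_eq0 -lt0n.
Qed.

Lemma tr_metricZr (G : 'rV[R]_m.+1 -> 'M[R]_m.+1) x (V W : tractor R m.+1) l :
  tr_metric G x V (l *: W) = l * tr_metric G x V W.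
Proof.
by rewrite !tr_metricE /= trmxZ -scalemxAr scalemxE !mulrDr; congr (_ + _ + _); exact: mulrCA.
Qed.

Lemma normal_tractor_scale p : S p -> exists2 l, l * l = 1 &
  forall i, dom i p -> normal_tractor (g i) eps (nu i) (coord (ch i) p) = l *: I i (coord (ch i) p).
Proof.
move=> Sp; have [l ll nl] := conormal_grad Sp; exists l => // i ip.
rewrite /normal_tractor (mean_curv_scale Sp ip ll (nl i ip)) opprK nl //.
rewrite [RHS]surjective_pairing [X in _ = (X, _)]surjective_pairing.
apply: (f_equal2 pair) => //; apply: (f_equal2 pair) => //=.
by rewrite -/(sc _ _) scale_zero // [RHS]mulr0.
Qed.

Lemma normal_perpP p i V : S p -> dom i p ->
  tr_metric (g i) (coord (ch i) p) V (normal_tractor (g i) eps (nu i) (coord (ch i) p)) = 0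
  <-> tr_metric (g i) (coord (ch i) p) V (I i (coord (ch i) p)) = 0.
Proof.
move=> Sp ip; have [l ll E] := normal_tractor_scale Sp; rewrite E // tr_metricZr.
split=> [/eqP|->]; last by rewrite mulr0.
rewrite mulf_eq0 => /orP[/eqP l0|/eqP//].
by have := ll; rewrite l0 mulr0 => /esym/eqP; rewrite oner_eq0.
Qed.

Lemma scale_preserves_normal_perp : preserves_normal_perp S g eps nu.
Proof.
move=> j V G N sV V0 u v ju.
have oO := open_slice_preimage (open_im hM (sval j)).
have E w (W : tractor R m.+1) : im j w -> tr_metric G (slice_in w) W (N (slice_in w)) = 0
    <-> tr_metric G (slice_in w) W (I (sval j) (slice_in w)) = 0.
  move=> jw; have := normal_perpP W (param_slice (j := j) jw) (dom_param hM jw).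
  by rewrite (paramK hM).
apply/E => //.
have s0 : sc (sval j) (slice_in u) = 0 by apply/SE; exact: param_slice.
have := derive_scale_pairing (open_im hM (sval j)) (@sG (sval j)) (@symG (sval j)) (@uG (sval j))
  (@ssc (sval j)) (@parI (sval j)) oO (fun _ => id) (smooth_slice_in oO) v sV ju s0.
move=> <-; rewrite (@eq_derive _ _ _ _ (cst 0) _ _ oO ju) ?derive_cst // => w jw.
by apply/E => //; exact: V0.
Qed.

(** The conormal restricts to 0 on the slice, and the sign [l] enters only through its square, so
    the identification by mean curvature is the restriction defined through [rho]. *)
Lemma hyp_ident_restrict (j : hidx) i p (V : idx X -> tractor R m.+1) :
  S p -> dom (sval j) p -> dom i p -> is_tractor p V ->
  hyp_ident g eps nu p V j = restrict j i (hcoord j p) (V i).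
Proof.
move=> Sp jp ip hV; have [_ _ nu_slice _] := hnu; have [l ll nl] := conormal_grad Sp.
have [_ _ E] := slice_point Sp jp ip.
rewrite /hyp_ident /tr_ident (hV _ _ jp ip) (mean_curv_scale Sp jp ll (nl _ jp)) (rho_coord_change Sp jp ip).
rewrite /restrict /tr_restrict E diff_mx_point //= -/(rho i _); congr (_, _, _).
  rewrite slice_pull_mx mulmxBl -scalemxAl -(slice_pull_mx (nu _ _)) nu_slice ?scaler0 ?subr0 //.
    by rewrite trmx_mul mulmxA.
  exact: (svalP j).
by rewrite sqrrN exprMn [l ^+ 2]expr2 ll mul1r.
Qed.

End Conormal.

(** * Parallel transport *)

Section Curve.
Variables (l r : R) (gam : R -> T).
Hypotheses (sgam : smooth_curve X l r gam) (Sgam : forall t, l < t < r -> S (gam t)).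

Let A i := [set t | l < t < r /\ dom i (gam t)].
Let x i t := coord (ch i) (gam t).
Let c (j : hidx) t := hcoord j (gam t).

Let oA i : open (A i).
Proof.
rewrite openE => t [lr it]; have [cg _] := sgam.
have [od _ _ _] := is_chart_ch hM i.
have n1 : nbhs t (gam @^-1` dom i) by apply: (cg t lr); exact: open_nbhs_nbhs.
have n2 : nbhs t [set u | l < u < r].
  have tI : t \in `]l, r[ by rewrite in_itv.
  by apply: filterS (near_in_itvoo tI) => u; rewrite in_itv.
exact: filterI n2 n1.
Qed.

Let smx i : smooth_mx (A i) (x i).
Proof. by apply: smooth_row => b; have [_ h] := sgam; exact: h. Qed.

Let xim i t : A i t -> im i (x i t).
Proof. by move=> [_]; exact: im_coord. Qed.

Let smc (j : hidx) : smooth_mx (A (sval j)) (c j).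
Proof.
have := smooth_mxM (@oA (sval j)) (@smx (sval j)) (fun a b => smooth_cst _ ((@slice_mx R m)^T a b)).
by apply: smooth_mx_ext => // t _; rewrite /c slice_pull_mx.
Qed.

Let c_dom (j : hidx) i t : A (sval j) t -> A i t ->
  slice_dom j i (c j t) /\ slice_map j i (c j t) = x i t.
Proof. by move=> [lr jt] [_ it]; have [_] := slice_point (Sgam lr) jt it. Qed.

Lemma transport_scale_perp (V : idx X -> R -> tractor R m.+1) t0 t1 :
  section_along l r gam V -> parallel_along g l r gam V -> l < t0 < r -> l < t1 < r ->
  (forall i, dom i (gam t0) -> scale_perp i (gam t0) (V i t0)) ->
  forall i, dom i (gam t1) -> scale_perp i (gam t1) (V i t1).
Proof.
move=> [trV sV] pV lr0 lr1 perp0.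
have [_ _ cov _ _] := hM; have [ci cP] := choice cov.
pose F i t := tr_metric (g i) (x i t) (V i t) (I i (x i t)).
have FE i i' t : A i t -> A i' t -> F i t = F i' t.
  move=> [lr it] [_ it']; rewrite /F /x (trV t lr _ _ it it') (scale_coord_change (Sgam lr) it it').
  exact: (tr_metric_coord_change _ _ (jacobian_unit hM it it') (metric_coord_change hg it it')
    (uG (im_coord hM it'))).
have sF i : smooth_on (A i) (F i).
  apply: (smooth_tr_metric (@oA i) (@sG i) (@uG i) (@xim i) (@smx i) (sV i)).
  have [s1 s2 s3] := smooth_scale_tractor (open_im hM i) (@sG i) (@uG i) (@ssc i).
  have h f0 (sf0 : smooth_on (im i) f0) := smooth_comp (@oA i) (@xim i) sf0 (@smx i 0).
  by split=> [|b|]; [exact: (h _ s1)|exact: (h _ (s2 b))|exact: (h _ s3)].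
pose F0 t := F (ci (gam t)) t.
have F0E i t : A i t -> F0 t = F i t.
  by move=> At; have [lr _] := At; apply: (FE) At; split=> //; exact: cP.
have dF0 t : l < t < r -> is_derive t (1 : R) F0 0.
  move=> lr; set i := ci (gam t); have At : A i t by split=> //; exact: cP.
  have nF : \forall u \near t, F i u = F0 u.
    by apply: near_open (@oA i) At _ => u Au; rewrite -(F0E i).
  apply: DeriveDef.
    by apply: diff_derivable; apply: near_differentiable nF _; exact: smooth_diff (sF i) At.
  rewrite (@eq_derive _ _ _ _ (F i) _ (1 : R) (@oA i) At (F0E i)).
  rewrite (derive_scale_pairing (open_im hM i) (@sG i) (@symG i) (@uG i) (@ssc i) (@parI i)
    (@oA i) (@xim i) (@smx i) (1 : R) (sV i) At (scale_zero (Sgam lr) (cP _))).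
  rewrite pV //; first by rewrite tr_metricE /= !(mul0r, mul0mx) mxE !addr0.
  exact: cP.
move=> i1 ip1; rewrite /scale_perp -[LHS](F0E i1 t1) //.
by rewrite -(derive_zero_constant dF0 lr0 lr1); apply: perp0; exact: cP.
Qed.

Section Transport.
Variables (nu : idx X -> 'rV[R]_m.+1 -> 'rV[R]_m.+1) (t0 t1 : R) (V0 V1 : idx X -> tractor R m.+1).
Hypotheses (hnu : unit_conormal S g eps nu) (m2 : (2 < m)%N)
  (lr0 : l < t0 < r) (lr1 : l < t1 < r)
  (trV0 : is_tractor (gam t0) V0) (trV1 : is_tractor (gam t1) V1)
  (perp0 : normal_perp g eps nu (gam t0) V0).

Let m0 : (0 < m)%N. Proof. by apply: leq_trans m2. Qed.

Let perpP p (V : idx X -> tractor R m.+1) : S p ->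
  normal_perp g eps nu p V <-> forall i, dom i p -> scale_perp i p (V i).
Proof.
by move=> Sp; split=> h i ip; have := h i ip => /(normal_perpP hnu m0 (V i) Sp ip).
Qed.

Lemma restrict0 (j : hidx) i u : restrict j i u 0 = 0.
Proof. by rewrite /restrict /tr_restrict /= mul0mx mulr0 addr0. Qed.

Lemma transport_restrict : parallel_transport g l r gam t0 t1 V0 V1 ->
  normal_perp g eps nu (gam t1) V1 /\
  parallel_transport (induced_metric (S := S) g) l r gam t0 t1
    (hyp_ident (S := S) g eps nu (gam t0) V0) (hyp_ident (S := S) g eps nu (gam t1) V1).
Proof.
move=> [V [[trV sV] pV E0 E1]].
have perpV t : l < t < r -> forall i, dom i (gam t) -> scale_perp i (gam t) (V i t).
  move=> lr; apply: (transport_scale_perp (conj trV sV) pV lr0 lr) => i i0.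
  by rewrite E0 //; exact: ((perpP V0 (Sgam lr0)).1 perp0).
split; first by apply/(perpP V1 (Sgam lr1)) => i i1; rewrite -E1 //; exact: perpV.
pose W (j : hidx) t := restrict j (sval j) (c j t) (V (sval j) t).
have AD (j : hidx) t : A (sval j) t -> slice_dom j (sval j) (c j t).
  by move=> At; have [] := c_dom At At.
exists W; split; first split.
- move=> t lr j j' [jt _] [jt' _]; rewrite /W (trV t lr _ _ jt jt').
  rewrite (restrict_coord_change (Sgam lr)) //.
  exact: (restrict_slice_change (Sgam lr)).
- move=> j; apply: (@tr_smooth_sub _ _ _ (A (sval j))) => [t [lr []]//|].
  exact: (smooth_restrict (@oA (sval j)) (@AD j) (@smc j) (sV (sval j))).
- move=> j t lr [jt _]; have At : A (sval j) t by [].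
  have [_ E] := c_dom At At.
  apply: etrans (conn_restrict (@oA (sval j)) (@AD j) (@smc j) (1 : R) m2 (sV (sval j)) At _) _.
    by rewrite E; exact: perpV.
  rewrite (@tr_conn_ext _ _ _ _ (A (sval j)) (@oA (sval j)) _ (x (sval j)) _ (V (sval j))) //.
    by rewrite pV // restrict0.
  by move=> w Aw; have [] := c_dom Aw Aw.
- by move=> j [j0 _]; rewrite (hyp_ident_restrict hnu m0 (Sgam lr0) j0 j0) // /W E0.
- by move=> j [j1 _]; rewrite (hyp_ident_restrict hnu m0 (Sgam lr1) j1 j1) // /W E1.
Qed.

(** The ambient section is the pointwise lift of the intrinsic one. Injectivity of restriction on
    the orthogonal of [I] reduces its tensoriality, smoothness, end values and parallelism to facts
    about restrictions. *)
Lemma transport_extend : normal_perp g eps nu (gam t1) V1 ->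
  parallel_transport (induced_metric (S := S) g) l r gam t0 t1
    (hyp_ident (S := S) g eps nu (gam t0) V0) (hyp_ident (S := S) g eps nu (gam t1) V1) ->
  parallel_transport g l r gam t0 t1 V0 V1.
Proof.
move=> perp1 [W [[trW sW] pW E0 E1]].
have [j0 _] := slice_idx (Sgam lr0).
(* A slice chart at each time, [j0] being a default outside the interval. The choice need not vary
   regularly in [t]; [VE] shows that the lift does not depend on it. *)
have /choice[cj cjP] t : exists j : hidx, l < t < r -> dom (sval j) (gam t).
  have [lr|_] := boolP (l < t < r); last by exists j0.
  by have [j jt] := slice_idx (Sgam lr); exists j.
pose V i t := extend (cj t) i (c (cj t) t) (W (cj t) t).
have VP t i : l < t < r -> dom i (gam t) -> scale_perp i (gam t) (V i t).
  by move=> lr it; apply: (extend_perp (Sgam lr)) => //; exact: cjP.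
have VE t (j : hidx) i : l < t < r -> dom (sval j) (gam t) -> dom i (gam t) ->
    restrict j i (c j t) (V i t) = W j t.
  move=> lr jt it; have kt := cjP t lr.
  rewrite /c (restrict_slice_change (Sgam lr) _ jt kt it) (extendK (Sgam lr)) //.
  by rewrite -(trW t lr j (cj t)) //; split=> //; exact: Sgam.
have ends t V' (trV' : is_tractor (gam t) V') : l < t < r -> normal_perp g eps nu (gam t) V' ->
    eq_tractor (gam t) (W ^~ t) (hyp_ident (S := S) g eps nu (gam t) V') -> eq_tractor (gam t) (V ^~ t) V'.
  move=> lr perp' E i it; have kt := cjP t lr.
  apply: (restrict_inj (Sgam lr) kt it); first exact: VP.
    exact: ((perpP V' (Sgam lr)).1 perp').
  rewrite -(hyp_ident_restrict hnu m0 (Sgam lr) kt it trV') -E; last by split=> //; exact: Sgam.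
  exact: (VE _ (cj t)).
(* Near each time the lift is recomputed with the slice chart of that time held fixed. *)
have sV i : tr_smooth (A i) (V i).
  apply: tr_smooth_local => t [lr it]; pose j := cj t.
  have jt : dom (sval j) (gam t) by exact: cjP.
  pose B := A (sval j) `&` A i; have oB : open B by apply: openI; exact: oA.
  have BD u : B u -> slice_dom j i (c j u) by move=> [Aj Ai]; have [] := c_dom Aj Ai.
  have scB : smooth_mx B (c j) by move=> a b; apply: smooth_sub (@smc j a b) => u [].
  have sWB : tr_smooth B (W j).
    by apply: tr_smooth_sub (sW j) => u [[lu ju] _]; split=> //; split=> //; exact: Sgam.
  exists B => //; apply: (tr_smooth_ext oB _ (smooth_extend oB BD scB sWB)) => u [[lu ju] [_ iu]].
  apply: (restrict_inj (Sgam lu) ju iu); [exact: (extend_perp (Sgam lu))|exact: VP|].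
  by rewrite [LHS](extendK (Sgam lu)) // [RHS]VE.
exists V; split; first split=> //.
- move=> t lr i i' it it'; have kt := cjP t lr.
  apply: (restrict_inj (Sgam lr) kt it); first exact: VP.
    by apply/(scale_perp_coord_change (Sgam lr)) => //; exact: VP.
  apply: etrans (VE t _ i lr kt it) (esym _).
  exact: etrans (restrict_coord_change (Sgam lr) (V i' t) kt it it') (VE t _ i' lr kt it').
- move=> i t lr it; pose j := cj t; have jt : dom (sval j) (gam t) by exact: cjP.
  have Ai : A i t by []. have Aj : A (sval j) t by [].
  pose B := A (sval j) `&` A i; have oB : open B by apply: openI; exact: oA.
  have BD u : B u -> slice_dom j i (c j u) by move=> [Bj Bi]; have [] := c_dom Bj Bi.
  have scB : smooth_mx B (c j) by move=> a b; apply: smooth_sub (@smc j a b) => u [].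
  have sVB : tr_smooth B (V i) by apply: tr_smooth_sub (sV i) => u [].
  (* The covariant derivative is orthogonal to [I], as the pairing of [V] with [I] is constantly 0,
     and it restricts to the intrinsic derivative of [W], which is 0. *)
  apply: (restrict_inj (Sgam lr) jt it).
  + rewrite /scale_perp -(derive_scale_pairing (open_im hM i) (@sG i) (@symG i) (@uG i) (@ssc i)
      (@parI i) (@oA i) (@xim i) (@smx i) (1 : R) (sV i) Ai (scale_zero (Sgam lr) it)).
    rewrite (@eq_derive _ _ (A i) _ (cst 0) _ _ (@oA i) Ai) ?derive_cst // => w [lw iw].
    exact: VP.
  + by rewrite /scale_perp tr_metricE /= !(mul0r, mul0mx) mxE !addr0.
  + have [_ E] := c_dom Aj Ai.
    have h : tr_conn (induced_metric g j) (c j) (fun w => restrict j i (c j w) (V i w)) t (1 : R)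
        = restrict j i (c j t) (tr_conn (g i) (fun w => slice_map j i (c j w)) (V i) t (1 : R)).
      by apply: (conn_restrict oB BD scB (1 : R) m2 sVB) => //; rewrite E; exact: VP.
    rewrite restrict0 -[LHS]/(restrict j i (c j t) (tr_conn (g i) (x i) (V i) t (1 : R))).
    rewrite -(@tr_conn_ext _ _ _ _ B oB (fun w => slice_map j i (c j w)) (x i) (V i)) //.
      rewrite -h -[RHS](pW j t lr); last by split=> //; exact: Sgam.
      apply: (tr_conn_ext _ oB) => // w [[lw jw] [_ iw]]; exact: VE.
    by move=> w [Bj Bi]; have [] := c_dom Bj Bi.
- exact: ends.
- exact: ends.
Qed.

End Transport.

End Curve.

End EinsteinScale.

Theorem theorem8p4 (R : realType) (m : nat) (T : topologicalType)
  (X : atlas R T m.+1) (c : set (metric X)) (s : metric X -> T -> R) (eps : R)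
  (hd : (4 <= m.+1)%N)
  (hM : is_manifold X)
  (hc : is_conformal_class c)
  (hI : almost_pseudo_riemannian c s)
  (hS : zero_locus c s !=set0)
  (heps : eps = 1 \/ eps = -1)
  (hE : asymptotically_einstein c s eps) :
  nondegenerate_hypersurface (zero_locus c s) c /\
  forall g, c g ->
  forall nu : idx X -> 'rV[R]_m.+1 -> 'rV[R]_m.+1,
    unit_conormal (zero_locus c s) g eps nu ->
    preserves_normal_perp (zero_locus c s) g eps nu /\
    transports_coincide (zero_locus c s) g eps nu.
Proof.
have [[g0 cg0] [q _ hq]] := hc; have [hden _] := hI; have [normI [f hf parI]] := hE.
have ee : eps * eps = 1 by case: heps => ->; rewrite ?mulrNN mulr1.
have hg g : c g -> is_metric q g by move=> /hq[].
have ssg g : c g -> smooth_fun X (s g) by move=> /hden[].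
(* Values of a density in two scales differ by a positive factor, so one scale detects the zero
   locus. *)
have SE g : c g -> forall p, zero_locus c s p <-> s g p = 0.
  move=> cg p; split=> [|s0 g' cg']; first exact.
  have [_ /(_ g')[/(_ cg')[Om rOm] _]] := hq g cg.
  by have [_ E] := hden g cg; rewrite (E _ _ rOm) s0 mulr0.
have nI g (cg : c g) p i (Sp : zero_locus c s p) ip := normI g p i cg Sp ip.
split; first split.
- move=> p Sp.
  exact: (slice_chart_exists hM (ssg _ cg0) (SE _ cg0) ee (nI _ cg0) Sp).
- move=> g j u cg ju.
  exact: (nondegenerate_induced hM (hg _ cg) (ssg _ cg) (SE _ cg) ee (nI _ cg) ju).
move=> g cg nu hnu; have m3 : (2 < m)%N by rewrite -ltnS.
have pI i x a (ix : im i x) := parI g i x a cg ix.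
have [sf _ _] := hf g cg.
split.
  apply: (scale_preserves_normal_perp hM (hg _ cg) (ssg _ cg) (SE _ cg) ee pI (nI _ cg) hnu).
  by apply: leq_trans m3.
move=> l r gam t0 t1 sgam Sgam lr0 lr1 V0 V1 trV0 trV1 perp0; split=> [tr|[perp1 tr]].
  exact: (transport_restrict hM (hg _ cg) (ssg _ cg) (SE _ cg) ee sf pI (nI _ cg)
    sgam Sgam hnu m3 lr0 lr1 trV0 trV1 perp0 tr).
exact: (transport_extend hM (hg _ cg) (ssg _ cg) (SE _ cg) ee sf pI (nI _ cg)
  sgam Sgam hnu m3 lr0 lr1 trV0 trV1 perp0 perp1 tr).
Qed.
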